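(* For $p\in(1,\infty)$ let $\mathscr L^p$ be the family of all $L^p$-spaces. (1) Let $(\Gamma_n)_{n\in\mathbb N}$ be a sequence of finite groups with uniformly finite generating sets and let $X=\bigsqcup_{n\in\mathbb N}\Gamma_n$ be the separated disjoint union of $(\Gamma_n)$. For any $p\in(1,\infty)$ and any free ultrafilter $\omega$ on $\mathbb N$, if $X$ has geometric property $(T_{\mathscr L^p})$, then the limit group $\Gamma^\infty_\omega$ has property $(T_{\mathscr L^p})$. (2) Let $\Gamma$ be a finitely generated, residually finite group. For any $p\in(1,\infty)$ the following are equivalent: (a) $\Gamma$ has property $(T_{\mathscr L^p})$; (b) for any filtration $\{\Gamma_n\}$ of $\Gamma$, the box space $\mathrm{Box}_{\{\Gamma_n\}}(\Gamma)$ has geometric property $(T_{\mathscr L^p})$; (c) there exists a filtration $\{\Gamma_n\}$ of $\Gamma$ such that $\mathrm{Box}_{\{\Gamma_n\}}(\Gamma)$ has geometric property $(T_{\mathscr L^p})$.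
   Context: Spaces. In (1), each $\Gamma_n$ has a finite symmetric generating set $S_n$ with $\sup_n\#S_n<\infty$, word length $l_n$ and metric $d_n(g,h)=l_n(g^{-1}h)$. A separated disjoint union carries the given metric on each piece and distance $\infty$ between distinct pieces. The limit group is $\Gamma^\infty_\omega=\prod^b_n\Gamma_n/\mathcal N_{0,\omega}$, where $\prod^b_n\Gamma_n$ is the group of sequences $(\gamma_n)$ with $\sup_nl_n(\gamma_n)<\infty$ and $\mathcal N_{0,\omega}$ is the normal subgroup of those with $\lim_{n\to\omega}l_n(\gamma_n)=0$; it is finitely generated. In (2), a filtration is a nested sequence $\Gamma\trianglerighteq\Gamma_1\trianglerighteq\Gamma_2\trianglerighteq\cdots$ of finite index normal subgroups of $\Gamma$ with trivial intersection, and $\mathrm{Box}_{\{\Gamma_n\}}(\Gamma)=\bigsqcup_n\Gamma/\Gamma_n$ is the separated disjoint union of the quotients with quotient metrics (from a word metric on $\Gamma$). These spaces $X$ have bounded geometry; an entourage is a subset of $\{(x,y):d(x,y)\le R\}$ for some $R$; they are monogenic: there is a symmetric generating entourage $E_0$ (every entourage lies in some $n$-fold composition $E_0^{\circ n}$), which we fix. Geometric property. $\mathbb C_u[X]$ is the algebra of complex matrices $T=(T_{xy})_{x,y\in X}$ with uniformly bounded entries whose support $\mathrm{supp}(T)=\{(x,y):T_{xy}\ne 0\}$ is an entourage; $\ell^\infty(X)$ is the subalgebra of diagonal matrices. A partial translation is $V\in\mathbb C_u[X]$ with entries in $\{0,1\}$ and at most one nonzero entry in each row and each column; $R_V=\{x:\exists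 y,\ V_{xy}=1\}$. $\|T\|_{\ell^1}=\inf\{\sum_{i=1}^N\|f_i\|_\infty : T=\sum_{i=1}^N f_iV_i,\ f_i\in\ell^\infty(X),\ V_i\text{ partial translations}\}$. A representation of $\mathbb C_u[X]$ on a Banach space $B$ is a unital algebra homomorphism $\pi$ into $\mathcal L(B)$ with $\|\pi(T)\|\le\|T\|_{\ell^1}$. $B^\pi=\{\xi:\pi(V)\xi=\pi(\chi_{R_V})\xi\ \forall V\}$. $\pi$ has a spectral gap if there is $c>0$ such that for every $\xi$ with $\|[\xi]\|_{B/B^\pi}=1$ there is a partial translation $V$ with $\mathrm{supp}(V)\subseteq E_0$ and $\|[\pi(V)\xi-\pi(\chi_{R_V})\xi]\|_{B/B^\pi}\ge c$. $X$ has geometric property $(T_{\mathscr B})$ for a family $\mathscr B$ if every representation on every $B\in\mathscr B$ has a spectral gap. Group property. Let $G$ be a group with finite symmetric generating set $S$. For a homomorphism $\rho:G\to O(B)$ into the group of invertible linear isometries of $B$, let $B^\rho$ be the subspace of $\rho(G)$-fixed vectors and $\tilde\rho$ the induced action on $B/B^\rho$. $G$ has property $(T_{\mathscr B})$ if for every $B\in\mathscr B$ and every $\rho:G\to O(B)$ there is $c>0$ such that no unit vector $v\in B/B^\rho$ satisfies $\sup_{g\in S}\|\tilde\rho(g)v-v\|\le c$. *)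

(* Defs.v *)
From HB Require Import structures.
From mathcomp Require Import all_boot all_order all_algebra.
From mathcomp Require Import finmap generic_quotient complex.
From mathcomp Require Import all_classical all_reals all_analysis.

Set Implicit Arguments.
Unset Strict Implicit.
Unset Printing Implicit Defensive.
Import Order.TTheory GRing.Theory Num.Theory.
Import numFieldNormedType.Exports.
Local Open Scope quotient_scope.
Local Open Scope classical_set_scope.
Local Open Scope ring_scope.

(* The least element of P; 0 if P is empty. *)
Definition natmin (P : set nat) : nat :=
  if pselect (exists k, `[< P k >]) is left e then ex_minn e else 0%N.

Section WordLength.
Variable G : groupType.
Implicit Types (S : {fset G}) (g h : G).

Definition is_word S (w : seq G) g :=
  (forall s, s \in w -> s \in S) /\ (\prod_(s <- w) s)%g = g.

Definition sym_gen_set S :=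
  (forall s, s \in S -> s^-1%g \in S) /\ (forall g, exists w, is_word S w g).

Definition finitely_generated := exists S, sym_gen_set S.

Definition wlen S g : nat :=
  natmin [set k | exists2 w, is_word S w g & size w = k].

Definition wdist S g h : nat := wlen S (g^-1 * h)%g.
End WordLength.

Record marked_group := MarkedGroup {
  mg_group :> groupType;
  gens : {fset mg_group};
  gensP : sym_gen_set gens }.

Lemma natminP (P : set nat) : (exists k, P k) -> P (natmin P).
Proof.
case=> k Pk; rewrite /natmin; case: pselect => [e|]; last first.
  by case; exists k; apply/asboolP.
by case: ex_minnP => m /asboolP.
Qed.

Lemma natmin_le (P : set nat) k : P k -> (natmin P <= k)%N.
Proof.
move=> Pk; rewrite /natmin; case: pselect => [e|//].
by case: ex_minnP => m _; apply; apply/asboolP.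
Qed.

Section WordLengthTheory.
Variable G : marked_group.
Implicit Types g h : G.
Local Notation S := (gens G).

Lemma wlen_word g : exists2 w, is_word S w g & size w = wlen S g.
Proof.
have [w Sw] := (gensP G).2 g.
by apply: (@natminP [set k | exists2 w, is_word S w g & size w = k]); exists (size w), w.
Qed.

Lemma wlen_le w g : is_word S w g -> (wlen S g <= size w)%N.
Proof. by move=> Sw; apply: natmin_le; exists w. Qed.

Lemma wlen1 : wlen S 1%g = 0%N.
Proof.
by apply/eqP; rewrite -leqn0; apply: (@wlen_le [::]); split; rewrite ?big_nil.
Qed.

Lemma wlen_eq0 g : wlen S g = 0%N -> g = 1%g.
Proof.
by have [w [_ <-] <-] := wlen_word g => /size0nil ->; rewrite big_nil.
Qed.

Lemma wlenM g h : (wlen S (g * h)%g <= wlen S g + wlen S h)%N.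
Proof.
have [v [Sv <-] <-] := wlen_word g; have [w [Sw <-] <-] := wlen_word h.
rewrite -size_cat; apply: wlen_le; split; last by rewrite big_cat.
by move=> s; rewrite mem_cat => /orP[/Sv|/Sw].
Qed.

Lemma wlenV g : (wlen S g^-1%g <= wlen S g)%N.
Proof.
have [w [Sw <-] <-] := wlen_word g.
rewrite -size_rev -(size_map (fun s => s^-1%g)).
apply: wlen_le; split.
  by move=> s /mapP[t]; rewrite mem_rev => /Sw St ->; apply: (gensP G).1.
elim: w {Sw} => [|x w IH]; first by rewrite !big_nil invg1.
by rewrite rev_cons map_rcons -cats1 big_cat IH big_seq1 big_cons invgM.
Qed.
End WordLengthTheory.

Record normal_subgroup (G : groupType) := NormalSubgroup {
  nsub : set G;
  nsub1 : nsub 1%g;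
  nsubM : forall g h, nsub g -> nsub h -> nsub (g * h)%g;
  nsubV : forall g, nsub g -> nsub g^-1%g;
  nsubJ : forall g h, nsub g -> nsub (h^-1 * g * h)%g }.

Section Quotient.
Variables (G : groupType) (N : normal_subgroup G).

Definition coset_rel : rel G := fun g h => `[< nsub N (g^-1 * h)%g >].

Lemma coset_rel_refl : reflexive coset_rel.
Proof. by move=> g; apply/asboolP; rewrite mulVg; apply: nsub1. Qed.

Lemma coset_rel_sym : symmetric coset_rel.
Proof.
by move=> g h; apply/asboolP/asboolP => /nsubV; rewrite invgM invgK.
Qed.

Lemma coset_rel_trans : transitive coset_rel.
Proof.
move=> h g k /asboolP gh /asboolP hk; apply/asboolP.
by have := nsubM gh hk; rewrite mulgA mulgK.
Qed.

Canonical coset_equiv :=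
  EquivRel coset_rel coset_rel_refl coset_rel_sym coset_rel_trans.

Definition quot := {eq_quot coset_equiv}.
HB.instance Definition _ := Choice.on quot.
HB.instance Definition _ := EqQuotient.on quot.

Definition proj (g : G) : quot := \pi_quot g.

Lemma projP g h : proj g = proj h <-> nsub N (g^-1 * h)%g.
Proof.
by split=> [/eqmodP/asboolP //|Ngh]; apply/eqmodP/asboolP.
Qed.

Lemma projK (x : quot) : proj (repr x) = x.
Proof. exact: reprK. Qed.

Definition qmul (x y : quot) : quot := proj (repr x * repr y)%g.
Definition qinv (x : quot) : quot := proj (repr x)^-1%g.

Lemma qmulE g h : qmul (proj g) (proj h) = proj (g * h)%g.
Proof.
apply/projP; set g' := repr _; set h' := repr _.
have /projP Ng : proj g' = proj g by rewrite projK.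
have /projP Nh : proj h' = proj h by rewrite projK.
have := nsubM Nh (nsubJ h Ng).
by rewrite invgM !mulgA mulgK.
Qed.

Lemma qinvE g : qinv (proj g) = proj g^-1%g.
Proof.
apply/projP; set g' := repr _.
have /projP Ng : proj g' = proj g by rewrite projK.
have := nsubJ g^-1%g (nsubV Ng).
by rewrite invgM !invgK mulgA mulgV mul1g.
Qed.

Lemma qmulA : associative qmul.
Proof.
by move=> x y z; rewrite -(projK x) -(projK y) -(projK z) !qmulE mulgA.
Qed.

Lemma qmul1x : left_id (proj 1%g) qmul.
Proof. by move=> x; rewrite -(projK x) qmulE mul1g. Qed.

Lemma qmulx1 : right_id (proj 1%g) qmul.
Proof. by move=> x; rewrite -(projK x) qmulE mulg1. Qed.

Lemma qmulVx : left_inverse (proj 1%g) qinv qmul.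
Proof. by move=> x; rewrite -(projK x) qinvE qmulE mulVg. Qed.

Lemma qmulxV : right_inverse (proj 1%g) qinv qmul.
Proof. by move=> x; rewrite -(projK x) qinvE qmulE mulgV. Qed.

HB.instance Definition _ :=
  isGroup.Build quot qmulA qmul1x qmulx1 qmulVx qmulxV.
End Quotient.

Definition finite_index (G : groupType) (N : normal_subgroup G) :=
  finite_set [set: quot N].

Definition residually_finite (G : groupType) :=
  forall g : G, g <> 1%g -> exists2 N : normal_subgroup G, finite_index N & ~ nsub N g.

Definition free_ultrafilter (T : Type) (omega : set_system T) :=
  UltraFilter omega /\ \bigcap_(A in omega) A = set0.

Section LimitGroup.
Variable Gamma : nat -> marked_group.

Definition prod_group := forall n, Gamma n.
HB.instance Definition _ := Choice.on prod_group.

Definition pmul (a b : prod_group) : prod_group := fun n => (a n * b n)%g.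
Definition pinv (a : prod_group) : prod_group := fun n => (a n)^-1%g.
Definition pone : prod_group := fun n => 1%g.

Lemma pmulA : associative pmul.
Proof. by move=> a b c; apply: functional_extensionality_dep => n; apply: mulgA. Qed.
Lemma pmul1x : left_id pone pmul.
Proof. by move=> a; apply: functional_extensionality_dep => n; apply: mul1g. Qed.
Lemma pmulx1 : right_id pone pmul.
Proof. by move=> a; apply: functional_extensionality_dep => n; apply: mulg1. Qed.
Lemma pmulVx : left_inverse pone pinv pmul.
Proof. by move=> a; apply: functional_extensionality_dep => n; apply: mulVg. Qed.
Lemma pmulxV : right_inverse pone pinv pmul.
Proof. by move=> a; apply: functional_extensionality_dep => n; apply: mulgV. Qed.

HB.instance Definition _ :=
  isGroup.Build prod_group pmulA pmul1x pmulx1 pmulVx pmulxV.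

Definition bounded_length : {pred prod_group} := fun a =>
  `[< exists M, forall n, (wlen (gens (Gamma n)) (a n) <= M)%N >].

Lemma bounded_length_group_closed : group_closed bounded_length.
Proof.
split=> [|a b /asboolP[M aM] /asboolP[K bK]]; apply/asboolP.
  by exists 0%N => n; rewrite wlen1.
exists (M + K)%N => n; apply: leq_trans (wlenM _ _) _.
by rewrite leq_add// (leq_trans (wlenV _)).
Qed.

Definition bprod := {a : prod_group | bounded_length a}.
HB.instance Definition _ := SubChoice.on bprod.
HB.instance Definition _ :=
  SubChoice_isSubGroup.Build prod_group bounded_length bprod
    bounded_length_group_closed.

Variables (omega : set_system nat) (fomega : free_ultrafilter omega).

Definition null_length (a : bprod) :=
  (fun n => wlen (gens (Gamma n)) (val a n)) @ omega --> 0%N.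

#[local] Instance limit_filter : Filter omega.
Proof. by case: fomega => -[[]]. Qed.

Lemma null_lengthP a :
  null_length a <-> omega [set n | val a n = 1%g].
Proof.
split=> [a0|oa].
  have n0 : nbhs 0%N [set 0%N].
    by rewrite nbhs_principalE/=; apply/principal_filterP.
  have oa : omega [set n | wlen (gens (Gamma n)) (val a n) = 0%N] := a0 _ n0.
  by apply: filterS oa => n /= /wlen_eq0.
move=> U /nbhs_singleton U0.
have : omega [set n | U (wlen (gens (Gamma n)) (val a n))].
  by apply: filterS oa => n /= ->; rewrite wlen1.
exact.
Qed.

Lemma null_length1 : null_length 1%g.
Proof. by apply/null_lengthP; apply: filterE. Qed.

Lemma null_lengthM a b :
  null_length a -> null_length b -> null_length (a * b)%g.
Proof.
rewrite !null_lengthP => oa ob; apply: filterS2 oa ob => n /= an bn.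
suff: (sval a n * sval b n)%g = 1%g by [].
by rewrite an bn mulg1.
Qed.

Lemma null_lengthV a : null_length a -> null_length a^-1%g.
Proof.
rewrite !null_lengthP; apply: filterS => n /= an.
suff: (sval a n)^-1%g = 1%g by [].
by rewrite an invg1.
Qed.

Lemma null_lengthJ a b :
  null_length a -> null_length (b^-1 * a * b)%g.
Proof.
rewrite !null_lengthP; apply: filterS => n /= an.
suff: ((sval b n)^-1 * sval a n * sval b n)%g = 1%g by [].
by rewrite an mulg1 mulVg.
Qed.

Definition null_subgroup : normal_subgroup bprod :=
  NormalSubgroup null_length1 null_lengthM null_lengthV null_lengthJ.

Definition limit_group : groupType := quot null_subgroup.
End LimitGroup.

Definition sep_union (T : nat -> choiceType) : choiceType := {n : nat & T n}.

(* The pieces carry nat-valued metrics, as they are groups with word metrics or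
   quotients of such. *)
Definition sep_dist (R : realType) (T : nat -> choiceType)
    (d : forall n, T n -> T n -> nat) (x y : sep_union T) : \bar R :=
  if tag x == tag y then (d (tag x) (tagged x) (tagged_as x y))%:R%:E else +oo%E.

(* The subgroup denoted Gamma_n, n >= 1, is [fil n.-1]. *)
Record filtration (G : groupType) := Filtration {
  fil :> nat -> normal_subgroup G;
  fil_nested : forall n, nsub (fil n.+1) `<=` nsub (fil n);
  fil_finite : forall n, finite_index (fil n);
  fil_trivial : \bigcap_n nsub (fil n) = [set 1%g] }.

Definition quot_dist (G : groupType) (N : normal_subgroup G)
    (d : G -> G -> nat) (x y : quot N) : nat :=
  natmin [set k | exists g h, [/\ proj N g = x, proj N h = y & d g h = k]].

Definition union_space (Gamma : nat -> marked_group) : choiceType :=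
  sep_union (fun n => Gamma n).

Definition union_dist (R : realType) (Gamma : nat -> marked_group) :
    union_space Gamma -> union_space Gamma -> \bar R :=
  sep_dist R (fun n => wdist (gens (Gamma n))).

Definition box_space (G : groupType) (F : filtration G) : choiceType :=
  sep_union (fun n => quot (F n)).

Definition box_dist (R : realType) (G : marked_group) (F : filtration G) :
    box_space F -> box_space F -> \bar R :=
  sep_dist R (fun n => @quot_dist G (F n) (wdist (gens G))).

Section Geometric.
Variable R : realType.
Local Notation C := R[i].

Definition rnorm (V : normedZmodType C) (v : V) : R := complex.Re `|v|.

(* The norm of [v] in B / W, for a subspace W of B. *)
Definition qnorm (B : normedModType C) (W : set B) (v : B) : R :=
  inf [set rnorm (v - w) | w in W].

Definition opnorm (B : normedModType C) (f : B -> B) : R :=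
  sup [set rnorm (f v) | v in [set v | rnorm v <= 1]].

Variables (X : choiceType) (d : X -> X -> \bar R).
Implicit Types (E : set (X * X)) (T V : X -> X -> C).

Definition is_entourage E :=
  exists r : R, forall x y, E (x, y) -> (d x y <= r%:E)%E.

(* [iter n _ E] is the (n+1)-fold composition of E with itself. *)
Definition sym_gen_entourage E :=
  [/\ is_entourage E, (E^-1)%relation = E &
      forall F, is_entourage F ->
        exists n, F `<=` iter n (fun D => (E \; D)%relation) E].

Definition supp T : set (X * X) := [set xy | T xy.1 xy.2 != 0].

(* C_u[X]; its algebra operations are given by mmul, mone and pointwise linear
   combinations. *)
Definition Cu : set (X -> X -> C) := [set T |
  (exists M : R, forall x y, rnorm (T x y) <= M) /\ is_entourage (supp T)].

Definition mone : X -> X -> C := fun x y => (x == y)%:R.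

(* The sum runs over the y with nonzero summand; they are finitely many when
   S, T are in Cu and X has bounded geometry. *)
Definition mmul (S T : X -> X -> C) : X -> X -> C :=
  fun x z => \sum_(y \in [set: X]) S x y * T y z.

Definition diag (f : X -> C) : X -> X -> C := fun x y => f x * mone x y.

Definition partial_translation V :=
  [/\ Cu V,
      forall x y, V x y = 0 \/ V x y = 1,
      forall x y z, V x y != 0 -> V x z != 0 -> y = z &
      forall x y z, V x z != 0 -> V y z != 0 -> x = y].

Definition range_proj V : X -> X -> C :=
  diag (\1_[set x | exists y, V x y = 1]).

Definition linfty (f : X -> C) := exists M : R, forall x, rnorm (f x) <= M.

Definition supnorm (f : X -> C) : R := sup [set rnorm (f x) | x in setT].

Definition l1norm T : R := inf [set r | exists (n : nat) (f : 'I_n -> X -> C)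
    (V : 'I_n -> X -> X -> C),
  [/\ forall i, linfty (f i),
      forall i, partial_translation (V i),
      T = (fun x y => \sum_(i < n) mmul (diag (f i)) (V i) x y) &
      r = \sum_(i < n) supnorm (f i)]].

(* A unital homomorphism from Cu to the bounded operators of B; the values of
   rep outside Cu are irrelevant. *)
Record is_representation (B : normedModType C) (rep : (X -> X -> C) -> B -> B)
    : Prop := IsRepresentation {
  rep_linear : forall T, Cu T -> linear (rep T);
  rep_continuous : forall T, Cu T -> continuous (rep T);
  rep_lin : forall (a : C) S T, Cu S -> Cu T ->
    rep (fun x y => a * S x y + T x y) = (fun v => a *: rep S v + rep T v);
  rep_mul : forall S T, Cu S -> Cu T -> rep (mmul S T) = rep S \o rep T;
  rep_one : rep mone = id;
  rep_norm : forall T, Cu T -> opnorm (rep T) <= l1norm T }.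

Definition rep_fixed (B : normedModType C) (rep : (X -> X -> C) -> B -> B)
    : set B :=
  [set v | forall V, partial_translation V -> rep V v = rep (range_proj V) v].

Definition spectral_gap (E0 : set (X * X)) (B : normedModType C)
    (rep : (X -> X -> C) -> B -> B) :=
  exists2 c : R, 0 < c & forall v : B, qnorm (rep_fixed rep) v = 1 ->
    exists V, [/\ partial_translation V, supp V `<=` E0 &
      c <= qnorm (rep_fixed rep) (rep V v - rep (range_proj V) v)].

Definition geometric_T (E0 : set (X * X))
    (BB : completeNormedModType C -> Prop) :=
  forall B, BB B -> forall rep : (X -> X -> C) -> B -> B,
    is_representation rep -> spectral_gap E0 rep.
End Geometric.

Arguments rnorm {R V} v.

Section Group.
Variable R : realType.
Local Notation C := R[i].

Definition is_isometric_action (G : groupType) (B : normedModType C)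
    (rho : G -> B -> B) :=
  (forall g, [/\ linear (rho g), bijective (rho g) &
                 forall v, `|rho g v| = `|v|]) /\
  (forall g h, rho (g * h)%g = rho g \o rho h).

Definition act_fixed (G : groupType) (B : normedModType C) (rho : G -> B -> B)
    : set B := [set v | forall g, rho g v = v].

Definition property_T_wrt (G : groupType) (S : {fset G})
    (BB : completeNormedModType C -> Prop) :=
  forall B, BB B -> forall rho : G -> B -> B, is_isometric_action rho ->
    exists2 c : R, 0 < c & forall v : B, qnorm (act_fixed rho) v = 1 ->
      ~ (sup [set qnorm (act_fixed rho) (rho g v - v) | g in [set` S]] <= c).

(* Property (T) is independent of the finite symmetric generating set S, so it
   is required of all of them; the first conjunct makes this non-vacuous. *)
Definition property_T (G : groupType) (BB : completeNormedModType C -> Prop) :=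
  finitely_generated G /\
  forall S : {fset G}, sym_gen_set S -> property_T_wrt S BB.

Definition Lp_function (d : measure_display) (T : measurableType d)
    (mu : {measure set T -> \bar R}) (p : R) (f : T -> C) :=
  [/\ measurable_fun setT (fun t => complex.Re (f t)),
      measurable_fun setT (fun t => complex.Im (f t)) &
      ('N[mu]_(p%:E)[EFin \o rnorm \o f] < +oo)%E].

(* B is isometrically isomorphic to the complex space L^p(mu) of some measure
   space; Phi b is a function representing the class associated with b. *)
Definition is_Lp_space (p : R) (B : completeNormedModType C) :=
  exists (d : measure_display) (T : measurableType d)
    (mu : {measure set T -> \bar R}) (Phi : B -> T -> C),
  [/\ forall b, Lp_function mu p (Phi b),
      forall (a : C) b b',
        {ae mu, forall t, Phi (a *: b + b') t = a * Phi b t + Phi b' t},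
      forall b, 'N[mu]_(p%:E)[EFin \o rnorm \o Phi b]%E = (rnorm b)%:E &
      forall f, Lp_function mu p f -> exists b, {ae mu, forall t, Phi b t = f t}].
End Group.

(* Main.v *)
(* The matrices act through right translations of the space.

   From geometric property (T) to the group: let [sigma] be an isometric action
   on an L^p space B over a measure space T.  The algebra C_u[X] acts by
   convolution twisted by [sigma] on the L^p completion of B-valued functions on
   X, seminormed by the limit along a free ultrafilter of the normalized L^p
   norms over the pieces.  This completion is an L^p space: the finitely additive
   content on X x T which defines it is represented by a measure on the space of
   ultrafilters on X x T, where compactness gives countable additivity.
   Averaging over the pieces is a bounded equivariant map back to B, so a vector
   far from the invariant vectors gives a constant function far from the
   invariant functions, and the spectral gap displaces it.

   From the group to the box space: a representation of C_u[X] restricts to an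
   isometric action by translations, with the same invariant vectors.  Let [v] be
   moved little, modulo invariant vectors, by the partial translations in E0.  An
   invariant vector w can be moved off a set A by a translation without changing
   it, while the defect of a partial translation with range in A is carried by A:
   so if A is disjoint from its translate, the defect is small in norm and not
   only modulo invariant vectors.  Three such sets A cover everything that
   matters, and composing partial translations one reaches the generators. *)
Require Import Defs.
From HB Require Import structures.
From mathcomp Require Import all_boot all_order all_algebra.
From mathcomp Require Import finmap generic_quotient complex.
From mathcomp Require Import all_classical all_reals all_analysis.
From mathcomp Require Import measurable_realfun ring lra.

Set Implicit Arguments.
Unset Strict Implicit.
Unset Printing Implicit Defensive.
Import Order.TTheory GRing.Theory Num.Theory.
Import numFieldNormedType.Exports.
Local Open Scope quotient_scope.
Local Open Scope classical_set_scope.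
Local Open Scope ring_scope.

(** * Real-valued norms and separated quotients *)

(** Limits along the ultrafilter are taken on functions X -> B that are uniformly close to finitely
    valued ones. For finitely many values, averages over the pieces converge in norm as soon as the
    frequencies of the values do, and a set of X x T has finitely many slices, so that its content
    is the mean of a bounded function. The class is stable under C_u[X], whose elements are finite
    sums of bounded coefficients times translations.

    The obstacle to twisting by [sigma] is that an entry (x, y) does not determine the element
    carrying x to y. A choice is fixed once for all. On most pieces an element with a fixed point
    acts trivially on B, so there the choice is irrelevant and convolution is multiplicative up to
    functions killed by J. In (1) the group acting on X is that of bounded sequences; it acts on B
    through the limit group.

    Both gaps measure displacement modulo invariant vectors. For a group element, iteration shows
    that the invariant part of a small displacement is itself small ([drift_le]). A partial
    translation is only partially defined and has no such iterates, whence the argument with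
    disjoint sets. *)

Section Rnorm.
Variable R : realType.
Local Notation C := R[i].

Lemma ReM_real (a b : C) : 0 <= a -> complex.Re (a * b) = complex.Re a * complex.Re b.
Proof.
by case: a b => [a a'] [b b'] /ger0_Im /= ->; rewrite mul0r subr0.
Qed.

Lemma ReD (a b : C) : complex.Re (a + b) = complex.Re a + complex.Re b.
Proof. by case: a b => [a a'] [b b']. Qed.

Lemma ImD (a b : C) : complex.Im (a + b) = complex.Im a + complex.Im b.
Proof. by case: a b => [a a'] [b b']. Qed.

Section normedZmod.
Variable V : normedZmodType C.
Implicit Types v w : V.

Lemma rnormE v : `|v| = (rnorm v)%:C%C.
Proof. by rewrite /rnorm RRe_real// normr_real. Qed.

Lemma ler_rnormE v (r : R) : (`|v| <= r%:C%C) = (rnorm v <= r).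
Proof. by rewrite rnormE lecR. Qed.

Lemma ltr_rnormE v (r : R) : (`|v| < r%:C%C) = (rnorm v < r).
Proof. by rewrite rnormE ltcR. Qed.

Lemma rnorm_ge0 v : 0 <= rnorm v.
Proof. by have := normr_ge0 v; rewrite rnormE lecR. Qed.

Lemma rnorm0 : rnorm (0 : V) = 0.
Proof. by rewrite /rnorm normr0. Qed.

Lemma rnorm_eq0 v : rnorm v = 0 -> v = 0.
Proof. by move=> v0; apply/normr0_eq0; rewrite rnormE v0. Qed.

Lemma rnormD v w : rnorm (v + w) <= rnorm v + rnorm w.
Proof. by rewrite -ler_rnormE rmorphD/= -!rnormE ler_normD. Qed.

Lemma rnormN v : rnorm (- v) = rnorm v.
Proof. by rewrite /rnorm normrN. Qed.

Lemma rdistC v w : rnorm (v - w) = rnorm (w - v).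
Proof. by rewrite -rnormN opprB. Qed.

Lemma rnormB v w : rnorm (v - w) <= rnorm v + rnorm w.
Proof. by rewrite -(rnormN w) rnormD. Qed.

Lemma rdist_triangle w v u : rnorm (v - u) <= rnorm (v - w) + rnorm (w - u).
Proof. by rewrite -(subrK w v) -addrA (le_trans (rnormD _ _))// subrK. Qed.

Lemma rnorm_sum (I : Type) (r : seq I) (P : pred I) (F : I -> V) :
  rnorm (\sum_(i <- r | P i) F i) <= \sum_(i <- r | P i) rnorm (F i).
Proof.
elim/big_rec2: _ => [|i y x _ xy]; first by rewrite rnorm0.
by rewrite (le_trans (rnormD _ _))// lerD2l.
Qed.

Lemma rnorm_dist v w : `|rnorm v - rnorm w| <= rnorm (v - w).
Proof.
have h (a b : V) : rnorm a <= rnorm (a - b) + rnorm b.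
  by rewrite -{1}(subrK b a) rnormD.
by rewrite ler_norml lerNl opprB !lerBlDr h rdistC h.
Qed.

End normedZmod.

Lemma rnormC_real (x : R) : rnorm (x%:C%C : C) = `|x|.
Proof. by rewrite /rnorm normc_def/= expr0n/= addr0 sqrtr_sqr. Qed.

Lemma rnorm1 : rnorm (1 : C) = 1.
Proof. by rewrite /rnorm normr1. Qed.

Lemma rnormM (a b : C) : rnorm (a * b) = rnorm a * rnorm b.
Proof. by rewrite /rnorm normrM ReM_real. Qed.

Lemma rnormZ (V : normedModType C) (a : C) (v : V) :
  rnorm (a *: v) = rnorm a * rnorm v.
Proof. by rewrite /rnorm normrZ ReM_real. Qed.

Lemma rnorm_sqrt (a : C) :
  rnorm a = Num.sqrt (complex.Re a ^+ 2 + complex.Im a ^+ 2).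
Proof. by rewrite /rnorm normc_def. Qed.

Lemma Re_le_rnorm (a : C) : `|complex.Re a| <= rnorm a.
Proof. by have := normc_ge_Re a; rewrite rnormE lecR. Qed.

Lemma Im_le_rnorm (a : C) : `|complex.Im a| <= rnorm a.
Proof.
rewrite /rnorm normc_def/= -sqrtr_sqr ler_wsqrtr// lerDr sqr_ge0//.
Qed.

Lemma rnorm_le_ReIm (a : C) : rnorm a <= `|complex.Re a| + `|complex.Im a|.
Proof.
rewrite /rnorm normc_def/= -[leRHS]ger0_norm ?addr_ge0// -sqrtr_sqr.
rewrite ler_wsqrtr// sqrrD !real_normK ?num_real//.
by rewrite lerD2r lerDl mulrn_wge0// mulr_ge0.
Qed.

Section cvg.
Variable V : normedModType C.

Lemma cvg_rnormP (F : set_system V) (FF : Filter F) (l : V) :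
  F --> l <-> forall e : R, 0 < e -> \forall x \near F, rnorm (l - x) < e.
Proof.
split=> [/cvgrPdist_lt Fl e e0|h].
  have := Fl e%:C%C; rewrite ltcR => /(_ e0).
  by apply: filterS => x; rewrite ltr_rnormE.
apply/cvgrPdist_lt => e e0.
(* Positivity in the complex field forces [e] to be real. *)
have e0' : 0 < complex.Re e by case: e e0 => [a b]; rewrite ltcE/= => /andP[_].
have -> : e = (complex.Re e)%:C%C by rewrite RRe_real// gtr0_real.
by have := h _ e0'; apply: filterS => x; rewrite ltr_rnormE.
Qed.

End cvg.

Definition seq_complete (V : Type) (dist : V -> V -> R) :=
  forall u : nat -> V, (forall k, dist (u k.+1) (u k) <= 2^-1 ^+ k) ->
    exists l, (fun n => dist (u n) l) @ \oo --> (0 : R).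

(** Centres [u k] of balls of radius [2^-(k+1)] belonging to [F] are chosen. The balls for [k] and
    [k+1] meet, so consecutive centres are within [2^-(k+1) + 2^-(k+2) <= 2^-k], and the limit of
    the centres is a limit of [F]. *)
Lemma seq_complete_cauchy (V : normedModType C) :
  seq_complete (fun v w : V => rnorm (v - w)) ->
  forall F : set_system V, ProperFilter F -> cauchy F -> cvg F.
Proof.
move=> scV F FF /cauchy_ballP Fc.
pose e k : R := 2^-1 ^+ k.+1.
have e0 k : 0 < e k by rewrite exprn_gt0.
have /choice[u Fu] : forall k, exists x, F [set y | rnorm (x - y) < e k].
  move=> k; have /cauchy_ballP/cauchyP/(_ (e k)%:C%C) := Fc.
  rewrite ltcR => /(_ (e0 k))[x Fx]; exists x; apply: filterS Fx => y.
  by rewrite -ball_normE /ball_/= ltr_rnormE.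
have [l ul] : exists l, (fun n => rnorm (u n - l)) @ \oo --> (0 : R).
  apply: scV => k.
  have [y [/= y1 y2]] := filter_ex (filterI (Fu k) (Fu k.+1)).
  rewrite (le_trans (rdist_triangle y _ _))// [in leLHS]addrC rdistC.
  have -> : 2^-1 ^+ k = e k + e k.
    by rewrite /e exprS; lra.
  rewrite lerD ?(ltW y1) ?(le_trans (ltW y2))//.
  by rewrite /e exprS ler_piMl ?exprn_ge0// invf_le1 ?ler1n.
apply/cvg_ex; exists l; apply/cvg_rnormP => r r0.
have r20 : 0 < r / 2 by rewrite divr_gt0.
have : \forall n \near \oo, rnorm (u n - l) < r / 2 /\ e n < r / 2.
  apply: filterI.
    move/cvgrPdist_lt : ul => /(_ _ r20); apply: filterS => n.
    by rewrite sub0r normrN ger0_norm ?rnorm_ge0.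
  have /cvgrPdist_lt/(_ _ r20) : e @ \oo --> (0 : R).
    rewrite /e (cvg_shiftS (fun k => 2^-1 ^+ k : R)).
    by apply: cvg_expr; rewrite ger0_norm// invf_lt1// ltr1n.
  by apply: filterS => n; rewrite sub0r normrN ger0_norm// ltW.
move=> [n _ /(_ n (leqnn _))[un en]].
apply: filterS (Fu n) => y /= yn.
rewrite (le_lt_trans (rdist_triangle (u n) _ _))// [ltRHS]splitr ltrD//.
  by rewrite rdistC.
exact: lt_trans en.
Qed.

End Rnorm.

(* Completeness is only asked along fast Cauchy sequences; it is what makes the
   separated quotient a Banach space. *)
Record seminormed (R : realType) := Seminormed {
  sn_sort : lmodType R[i];
  sn : sn_sort -> R;
  snD : forall x y, sn (x + y) <= sn x + sn y;
  snZ : forall a x, sn (a *: x) = rnorm a * sn x;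
  sn_complete : seq_complete (fun x y => sn (x - y)) }.

Section Separation.
Variables (R : realType) (S : seminormed R).
Local Notation C := R[i].
Local Notation E := (sn_sort S).
Local Notation N := (@sn R S).

Let sn0 : N 0 = 0.
Proof. by rewrite -(scale0r 0) snZ rnorm0 mul0r. Qed.

Let snN x : N (- x) = N x.
Proof. by rewrite -scaleN1r snZ rnormN rnorm1 mul1r. Qed.

Let sn_ge0 x : 0 <= N x.
Proof.
have := snD x (- x); rewrite subrr sn0 snN => h.
by rewrite -(@pmulr_lge0 _ 2)// mulr_natr mulr2n.
Qed.

Definition sep_rel : rel E := fun x y => `[< N (x - y) = 0 >].

Lemma sep_rel_refl : reflexive sep_rel.
Proof. by move=> x; apply/asboolP; rewrite subrr. Qed.

Lemma sep_rel_sym : symmetric sep_rel.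
Proof. by move=> x y; apply/asboolP/asboolP; rewrite -snN opprB. Qed.

Lemma sep_rel_trans : transitive sep_rel.
Proof.
move=> y x z /asboolP xy /asboolP yz; apply/asboolP/eqP.
rewrite eq_le sn_ge0 andbT -(subrK y x) -addrA (le_trans (snD _ _))//.
by rewrite xy yz addr0.
Qed.

Canonical sep_equiv := EquivRel sep_rel sep_rel_refl sep_rel_sym sep_rel_trans.

Definition sep := {eq_quot sep_equiv}.
HB.instance Definition _ := Choice.on sep.
HB.instance Definition _ := EqQuotient.on sep.

Definition sep_pi (x : E) : sep := \pi_sep x.

Lemma sep_piP x y : sep_pi x = sep_pi y <-> N (x - y) = 0.
Proof.
by split=> [/eqmodP/asboolP //|xy]; apply/eqmodP/asboolP.
Qed.

Lemma sep_reprK (x : sep) : sep_pi (repr x) = x.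
Proof. exact: reprK. Qed.

Lemma sep_repr x : N (repr (sep_pi x) - x) = 0.
Proof. by apply/sep_piP; rewrite sep_reprK. Qed.

Lemma sep_piP_le x y : N (x - y) <= 0 -> sep_pi x = sep_pi y.
Proof. by move=> h; apply/sep_piP/eqP; rewrite eq_le h sn_ge0. Qed.

Definition sep_add (x y : sep) := sep_pi (repr x + repr y).
Definition sep_scale (a : C) (x : sep) := sep_pi (a *: repr x).
Definition sep_norm (x : sep) : C := (N (repr x))%:C%C.

Lemma sep_addE x y : sep_add (sep_pi x) (sep_pi y) = sep_pi (x + y).
Proof.
apply: sep_piP_le; rewrite opprD addrACA (le_trans (snD _ _))//.
by rewrite !sep_repr addr0.
Qed.

Lemma sep_scaleE a x : sep_scale a (sep_pi x) = sep_pi (a *: x).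
Proof. by apply: sep_piP_le; rewrite -scalerBr snZ sep_repr mulr0. Qed.

Lemma sep_normE x : sep_norm (sep_pi x) = (N x)%:C%C.
Proof.
congr (_%:C)%C; set x' := repr _; have h : N (x' - x) = 0 := sep_repr x.
apply/eqP; rewrite eq_le; apply/andP; split.
  by rewrite -(subrK x x') (le_trans (snD _ _))// h add0r.
by rewrite -(subrK x' x) (le_trans (snD _ _))// -snN opprB h add0r.
Qed.

Lemma sep_addA : associative sep_add.
Proof.
by move=> x y z; rewrite -(sep_reprK x) -(sep_reprK y) -(sep_reprK z) !sep_addE addrA.
Qed.
Lemma sep_addC : commutative sep_add.
Proof. by move=> x y; rewrite /sep_add addrC. Qed.
Lemma sep_add0 : left_id (sep_pi 0) sep_add.
Proof. by move=> x; rewrite -(sep_reprK x) sep_addE add0r. Qed.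
Lemma sep_addN : left_inverse (sep_pi 0) (sep_scale (-1)) sep_add.
Proof. by move=> x; rewrite -(sep_reprK x) sep_scaleE sep_addE scaleN1r addNr. Qed.

HB.instance Definition _ :=
  GRing.isZmodule.Build sep sep_addA sep_addC sep_add0 sep_addN.

Lemma sep_scaleA a b x : sep_scale a (sep_scale b x) = sep_scale (a * b) x.
Proof. by rewrite -(sep_reprK x) !sep_scaleE scalerA. Qed.
Lemma sep_scale1 : left_id 1 sep_scale.
Proof. by move=> x; rewrite -(sep_reprK x) sep_scaleE scale1r. Qed.
Lemma sep_scaleDr : right_distributive sep_scale +%R.
Proof.
move=> a x y; rewrite -(sep_reprK x) -(sep_reprK y).
by rewrite /GRing.add/= sep_addE !sep_scaleE sep_addE scalerDr.
Qed.
Lemma sep_scaleDl x : {morph sep_scale^~ x : a b / a + b}.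
Proof.
move=> a b; rewrite -(sep_reprK x).
by rewrite [RHS]/GRing.add/= !sep_scaleE sep_addE scalerDl.
Qed.

HB.instance Definition _ := GRing.Zmodule_isLmodule.Build C sep
  sep_scaleA sep_scale1 sep_scaleDr sep_scaleDl.

Lemma sep_piD x y : sep_pi (x + y) = sep_pi x + sep_pi y.
Proof. by rewrite [RHS]/GRing.add/= sep_addE. Qed.

Lemma sep_piZ a x : sep_pi (a *: x) = a *: sep_pi x.
Proof. by rewrite -sep_scaleE. Qed.

Lemma sep_pi0 : sep_pi 0 = 0.
Proof. by []. Qed.

Lemma sep_piB x y : sep_pi (x - y) = sep_pi x - sep_pi y.
Proof. by rewrite sep_piD -[in LHS](scaleN1r y) sep_piZ scaleN1r. Qed.

Lemma sep_normD x y : sep_norm (x + y) <= sep_norm x + sep_norm y.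
Proof.
rewrite -(sep_reprK x) -(sep_reprK y) -sep_piD !sep_normE -rmorphD/=.
by rewrite lecR snD.
Qed.

Lemma sep_normZ a x : sep_norm (a *: x) = `|a| * sep_norm x.
Proof.
by rewrite -(sep_reprK x) -sep_piZ !sep_normE snZ rmorphM/= -rnormE.
Qed.

Lemma sep_norm_eq0 x : sep_norm x = 0 -> x = 0.
Proof.
rewrite -(sep_reprK x) sep_normE => -[x0]; rewrite -sep_pi0.
by apply: sep_piP_le; rewrite subr0 x0.
Qed.

HB.instance Definition _ :=
  Lmodule_isNormed.Build C sep sep_normD sep_normZ sep_norm_eq0.

Lemma sep_rnormE x : rnorm (sep_pi x) = N x.
Proof. by have -> : rnorm (sep_pi x) = complex.Re (sep_norm (sep_pi x)) by [];
  rewrite sep_normE. Qed.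

Lemma sep_cauchy_cvg (F : set_system sep) : ProperFilter F -> cauchy F -> cvg F.
Proof.
apply: seq_complete_cauchy => u hu.
have [|l hl] := @sn_complete R S (repr \o u).
  by move=> k /=; rewrite -sep_rnormE sep_piB !sep_reprK.
exists (sep_pi l); under eq_fun do rewrite -(sep_reprK (u _)) -sep_piB sep_rnormE.
exact: hl.
Qed.

HB.instance Definition _ := Uniform_isComplete.Build sep sep_cauchy_cvg.

Definition sep_banach : completeNormedModType C := sep.
End Separation.

(** * Complex L^p spaces *)

#[local] Opaque rnorm.

(** Convexity of the power on [[a, M + 1]]: [b] puts weight [th = (b - a) / (M + 1 - a)] on the
    right end, and [th <= b - a] because going up to [M + 1] makes the interval at least 1 long. *)
Lemma powR_lip (R : realType) (p a b M : R) : 1 <= p -> 0 <= a -> a <= b -> b <= M ->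
  b `^ p - a `^ p <= (b - a) * (M + 1) `^ p.
Proof.
move=> p1 a0 ab bM.
have M1a : 0 < M + 1 - a by lra.
pose th := (b - a) / (M + 1 - a).
have th0 : 0 <= th by apply: divr_ge0; [rewrite subr_ge0|exact: ltW].
have th1 : th <= 1 by rewrite ler_pdivrMr// mul1r; lra.
have thba : th <= b - a.
  by rewrite ler_pdivrMr// ler_peMr ?subr_ge0//; lra.
have := @convex_powR R p p1 (Itv01 th0 th1) (M + 1) a.
rewrite !inE/= !in_itv/= !andbT => /(_ _ _)-/(_ ltac:(lra) a0).
have cE (x y : R) : conv (Itv01 th0 th1) (x : R^o) y = th * x + (1 - th) * y by rewrite convRE.
rewrite cE.
rewrite [X in X `^ _ <= _](_ : _ = th * (M + 1) + (1 - th) * a); last exact: cE.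
have -> : th * (M + 1) + (1 - th) * a = b.
  have : th * (M + 1 - a) = b - a by rewrite divfK// gt_eqF.
  by clear; move: th => c; lra.
move=> h.
have ap := powR_ge0 a p; have Mp := powR_ge0 (M + 1) p.
have h2 : th * (M + 1) `^ p <= (b - a) * (M + 1) `^ p by rewrite ler_wpM2r.
have h3 : 0 <= th * a `^ p by rewrite mulr_ge0.
move: h h2 h3; move: (b `^ p) (a `^ p) ((M + 1) `^ p) ap Mp => B A N _ _.
by rewrite mulrBl mul1r; lra.
Qed.

Lemma cvg_powR (R : realType) (p l : R) (x : nat -> R) : 1 <= p ->
  (forall n, 0 <= x n) -> 0 <= l -> x @ \oo --> l ->
  (fun n => x n `^ p) @ \oo --> l `^ p.
Proof.
move=> p1 x0 l0 xl; pose K := (l + 1 + 1) `^ p.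
have K0 : 0 < K by rewrite powR_gt0// -addrA ltr_wpDl// addr_gt0.
apply/cvgrPdist_le => e e0.
have eK : 0 < Num.min 1 (e / K) by rewrite lt_min ltr01 divr_gt0.
move/cvgrPdist_le : xl => /(_ _ eK); apply: filterS => n.
rewrite le_min => /andP[h1 h2].
have xn1 : x n <= l + 1 by move: h1; rewrite ler_norml; lra.
have l1 : l <= l + 1 by rewrite lerDl.
move: h2; rewrite ler_pdivlMr//; apply: le_trans.
have lip a b : 0 <= a -> a <= b -> b <= l + 1 -> `|b `^ p - a `^ p| <= `|b - a| * K.
  move=> a0 ab bM; have p0 : 0 <= p := le_trans ler01 p1.
  have ab' : a `^ p <= b `^ p by apply: ge0_ler_powR; rewrite ?nnegrE//; exact: le_trans ab.
  rewrite ger0_norm ?subr_ge0// ger0_norm ?subr_ge0//.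
  exact: powR_lip.
have [lx|/ltW xl'] := leP l (x n); last exact: lip.
by rewrite distrC (distrC l); exact: lip.
Qed.

Section Lp.
Variables (R : realType) (d : measure_display) (T : measurableType d).
Variables (mu : {measure set T -> \bar R}) (p : R) (p1 : 1 <= p).
Local Notation C := R[i].
Implicit Types f g : T -> C.

Let p0 : 0 < p. Proof. exact: lt_le_trans p1. Qed.
Let pn0 : p != 0. Proof. by rewrite gt_eqF. Qed.
Let pVn0 : p^-1 != 0. Proof. by rewrite invr_eq0. Qed.

Definition cmeasurable f :=
  measurable_fun setT (fun t => complex.Re (f t)) /\
  measurable_fun setT (fun t => complex.Im (f t)).

Definition Ip f : \bar R := (\int[mu]_t (rnorm (f t) `^ p)%:E)%E.
(** Since [fine] sends [+oo] to 0, this is the norm only where [Ip f] is finite. *)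
Definition lpn f : R := fine (Ip f) `^ p^-1.

Lemma IpE f : Ip f = (\int[mu]_t (rnorm (f t) `^ p)%:E)%E. Proof. by []. Qed.
Lemma lpnE f : lpn f = fine (Ip f) `^ p^-1. Proof. by []. Qed.
#[local] Opaque Ip lpn.

Lemma measurable_rnorm f : cmeasurable f -> measurable_fun setT (fun t => rnorm (f t)).
Proof.
move=> [mr mi].
under eq_fun do rewrite rnorm_sqrt -powR12_sqrt ?addr_ge0 ?sqr_ge0//.
apply: (measurableT_comp (measurable_powR 2^-1)).
by apply: measurable_funD; apply: measurable_funX.
Qed.

Lemma measurable_rnorm_pow f :
  cmeasurable f -> measurable_fun setT (fun t => (rnorm (f t) `^ p)%:E).
Proof.
move=> mf; apply/measurable_EFinP; apply: (measurableT_comp (measurable_powR p)).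
exact: measurable_rnorm.
Qed.

Lemma cmeasurable_lin (a : C) f g : cmeasurable f -> cmeasurable g ->
  cmeasurable (fun t => a * f t + g t).
Proof.
case: a => a b [f1 f2] [g1 g2].
have mM (c : R) (h : T -> R) : measurable_fun setT h -> measurable_fun setT (fun t => c * h t).
  by move=> mh; apply: measurable_funM.
split.
  rewrite (_ : (fun t => _) = fun t =>
      (a * complex.Re (f t) - b * complex.Im (f t)) + complex.Re (g t)); last first.
    by apply/funext => t; rewrite ReD; case: (f t).
  by apply: measurable_funD => //; apply: measurable_funB; apply: mM.
rewrite (_ : (fun t => _) = fun t =>
    (a * complex.Im (f t) + b * complex.Re (f t)) + complex.Im (g t)); last first.
  by apply/funext => t; rewrite ImD; case: (f t).
by apply: measurable_funD => //; apply: measurable_funD; apply: mM.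
Qed.

Lemma cmeasurable0 : cmeasurable (fun=> 0).
Proof. by split; apply: measurable_cst. Qed.

Lemma cmeasurableD f g : cmeasurable f -> cmeasurable g -> cmeasurable (fun t => f t + g t).
Proof.
move=> mf mg; have := cmeasurable_lin 1 mf mg.
by under eq_fun do rewrite mul1r.
Qed.

Lemma cmeasurableZ (a : C) f : cmeasurable f -> cmeasurable (fun t => a * f t).
Proof.
move=> mf; have := cmeasurable_lin a mf cmeasurable0.
by under eq_fun do rewrite addr0.
Qed.

Lemma cmeasurableB f g : cmeasurable f -> cmeasurable g -> cmeasurable (fun t => f t - g t).
Proof.
move=> mf mg; apply: cmeasurableD => //; have := cmeasurableZ (-1) mg.
by under eq_fun do rewrite mulN1r.
Qed.

Lemma Ip_ge0 f : (0 <= Ip f)%E.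
Proof. by rewrite IpE; apply: integral_ge0 => t _; rewrite lee_fin powR_ge0. Qed.

Lemma lpn_ge0 f : 0 <= lpn f. Proof. by rewrite lpnE; exact: powR_ge0. Qed.

Lemma LnormE (h : T -> R) : (forall t, 0 <= h t) ->
  'N[mu]_(p%:E)[EFin \o h]%E = ((\int[mu]_t (h t `^ p)%:E) `^ p^-1)%E.
Proof.
move=> h0; rewrite Lnorm.unlock /=; apply: (congr1 (fun x => poweR x p^-1));
  apply: eq_integral => t _ /=.
by rewrite ger0_norm.
Qed.

Lemma minkowski_integral (h k : T -> R) : (forall t, 0 <= h t) -> (forall t, 0 <= k t) ->
  measurable_fun setT h -> measurable_fun setT k ->
  ((\int[mu]_t ((h t + k t) `^ p)%:E) `^ p^-1 <=
   (\int[mu]_t (h t `^ p)%:E) `^ p^-1 + (\int[mu]_t (k t `^ p)%:E) `^ p^-1)%E.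
Proof.
move=> h0 k0 mh mk; have := minkowski_EFin mu mh mk p1.
rewrite (LnormE h0) (LnormE k0) (@LnormE (fun t => h t + k t))// => t.
by rewrite addr_ge0.
Qed.

Lemma Lnorm_rnormE f : 'N[mu]_(p%:E)[EFin \o rnorm \o f]%E = (Ip f `^ p^-1)%E.
Proof. by rewrite IpE; apply: (@LnormE (fun t => rnorm (f t))) => t; apply: rnorm_ge0. Qed.

Lemma Lp_functionP f : Lp_function mu p f <-> cmeasurable f /\ (Ip f < +oo)%E.
Proof.
rewrite /Lp_function Lnorm_rnormE; split=> [[mr mi h]|[[mr mi] h]]; split=> //.
  exact: lty_poweRy h.
by rewrite poweR_lty.
Qed.

Lemma Ip_fin f : (Ip f < +oo)%E -> Ip f = (fine (Ip f))%:E.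
Proof. by move=> If; rewrite fineK// ge0_fin_numE// Ip_ge0. Qed.

Lemma Ip_root f : (Ip f < +oo)%E -> (Ip f `^ p^-1)%E = (lpn f)%:E.
Proof. by move=> If; rewrite lpnE {1}(Ip_fin If). Qed.

Lemma Lnorm_lpn f : (Ip f < +oo)%E -> 'N[mu]_(p%:E)[EFin \o rnorm \o f]%E = (lpn f)%:E.
Proof. by move=> If; rewrite Lnorm_rnormE Ip_root. Qed.

Lemma lpn_pow f : lpn f `^ p = fine (Ip f).
Proof. by rewrite lpnE -powRrM mulVf// powRr1// fine_ge0// Ip_ge0. Qed.

Lemma Ip_lpn f : (Ip f < +oo)%E -> Ip f = (lpn f `^ p)%:E.
Proof. by move=> If; rewrite lpn_pow -Ip_fin. Qed.

Lemma lpn_le_Ip f (r : R) : 0 <= r -> (Ip f <= (r `^ p)%:E)%E -> (Ip f < +oo)%E /\ lpn f <= r.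
Proof.
move=> r0 h; have If : (Ip f < +oo)%E by apply: le_lt_trans h (ltry _).
split=> //; rewrite lpnE -(@powRr1 _ r)// -(mulfV pn0) powRrM.
apply: ge0_ler_powR; rewrite ?nnegrE ?invr_ge0 ?(ltW p0)// ?powR_ge0//.
  by rewrite fine_ge0// Ip_ge0.
by rewrite -lee_fin -Ip_fin.
Qed.

Lemma le_Ip f g : cmeasurable f -> cmeasurable g ->
  (\forall t \ae mu, rnorm (f t) <= rnorm (g t)) -> (Ip f <= Ip g)%E.
Proof.
move=> mf mg fg; rewrite !IpE; apply: ae_ge0_le_integral => //.
- by move=> t _; rewrite lee_fin powR_ge0.
- exact: measurable_rnorm_pow.
- by move=> t _; rewrite lee_fin powR_ge0.
- exact: measurable_rnorm_pow.
apply: filterS fg => t h _; rewrite lee_fin.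
by apply: ge0_ler_powR; rewrite ?nnegrE ?rnorm_ge0 ?(ltW p0).
Qed.

Lemma Ip_ae f g : cmeasurable f -> cmeasurable g ->
  (\forall t \ae mu, f t = g t) -> Ip f = Ip g.
Proof.
move=> mf mg fg; apply/eqP; rewrite eq_le !le_Ip//.
  by apply: filterS fg => t ->.
by apply: filterS fg => t ->.
Qed.

(** Minkowski for the real functions [rnorm (f t)] and [rnorm (g t)] bounds the root of
    [Ip (f + g)]; this one bound gives both finiteness and the triangle inequality. *)
Lemma Lp_sum f g : Lp_function mu p f -> Lp_function mu p g ->
  Lp_function mu p (fun t => f t + g t) /\ lpn (fun t => f t + g t) <= lpn f + lpn g.
Proof.
move=> /Lp_functionP[mf If] /Lp_functionP[mg Ig].
have mfg := cmeasurableD mf mg.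
have rf0 (h : T -> C) t : 0 <= rnorm (h t) by apply: rnorm_ge0.
have rfg0 t : 0 <= rnorm (f t) + rnorm (g t) by rewrite addr_ge0.
have mk : ((\int[mu]_t ((rnorm (f t) + rnorm (g t)) `^ p)%:E) `^ p^-1 <=
    (lpn f + lpn g)%:E)%E.
  have := minkowski_integral (rf0 f) (rf0 g) (measurable_rnorm mf) (measurable_rnorm mg).
  by rewrite -!IpE (Ip_root If) (Ip_root Ig).
have le_fg : (Ip (fun t => (f t + g t)%R) <=
    \int[mu]_t ((rnorm (f t) + rnorm (g t)) `^ p)%:E)%E.
  rewrite IpE.
  apply: ge0_le_integral => //.
  - by move=> t _; rewrite lee_fin powR_ge0.
  - exact: measurable_rnorm_pow.
  - apply/measurable_EFinP; apply: (measurableT_comp (measurable_powR p)).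
    by apply: measurable_funD; apply: measurable_rnorm.
  move=> t _; rewrite lee_fin; apply: ge0_ler_powR; rewrite ?nnegrE ?(ltW p0)//.
    exact: rnorm_ge0.
  exact: rnormD.
have h : (Ip (fun t => (f t + g t)%R) `^ p^-1 <= (lpn f + lpn g)%:E)%E.
  apply: le_trans mk; apply: gt0_ler_poweR => //.
  - by rewrite invr_ge0 ltW.
  - by rewrite in_itv/= Ip_ge0 leey.
  - by rewrite in_itv/= leey andbT; apply: integral_ge0 => t _; rewrite lee_fin powR_ge0.
have fin : (Ip (fun t => f t + g t)%R < +oo)%E by exact: lty_poweRy (le_lt_trans h (ltry _)).
split; first by apply/Lp_functionP; split; [exact: mfg|exact: fin].
by rewrite -lee_fin -(Ip_root fin); exact: h.
Qed.

Lemma IpZ (a : C) f : cmeasurable f -> Ip (fun t => a * f t) = ((rnorm a `^ p)%:E * Ip f)%E.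
Proof.
move=> mf; rewrite !IpE.
under eq_integral do rewrite rnormM powRM ?rnorm_ge0// EFinM.
rewrite ge0_integralZl ?lee_fin ?powR_ge0//.
  exact: measurable_rnorm_pow.
by move=> t _; rewrite lee_fin powR_ge0.
Qed.

Lemma Lp_scale (a : C) f : Lp_function mu p f ->
  Lp_function mu p (fun t => a * f t) /\ lpn (fun t => a * f t) = rnorm a * lpn f.
Proof.
move=> /Lp_functionP[mf If]; split.
  apply/Lp_functionP; split; first exact: cmeasurableZ.
  by rewrite IpZ// Ip_fin// -EFinM ltry.
rewrite !lpnE IpZ// Ip_fin// -EFinM/= powRM ?powR_ge0// ?fine_ge0 ?Ip_ge0//.
by rewrite -powRrM mulfV// powRr1// rnorm_ge0.
Qed.

Lemma Lp_zero : Lp_function mu p (fun=> 0).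
Proof.
apply/Lp_functionP; split; first exact: cmeasurable0.
rewrite IpE; under eq_integral do rewrite rnorm0 powR0//.
by rewrite integral0.
Qed.

Lemma Lp_sub f g : Lp_function mu p f -> Lp_function mu p g ->
  Lp_function mu p (fun t => f t - g t).
Proof.
move=> Lf Lg; have [+ _] := Lp_sum Lf (Lp_scale (-1) Lg).1.
by under eq_fun do rewrite mulN1r.
Qed.

Lemma lpn_eq0 f : Lp_function mu p f -> lpn f = 0 -> \forall t \ae mu, f t = 0.
Proof.
move=> Lf f0; have [mf If] := (Lp_functionP f).1 Lf.
have /Lnorm_eq0_eq0 : 'N[mu]_(p%:E)[EFin \o rnorm \o f]%E = 0%E.
  by rewrite Lnorm_lpn// f0.
have mr : measurable_fun setT (EFin \o rnorm \o f).
  by apply/measurable_EFinP; apply: measurable_rnorm.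
move=> /(_ mr); rewrite lte_fin => /(_ p0).
by apply: filterS => t /= /(_ I) [/rnorm_eq0].
Qed.

Lemma lpn_ae0 f : cmeasurable f -> (\forall t \ae mu, f t = 0) -> lpn f = 0.
Proof.
move=> mf f0; rewrite lpnE (Ip_ae mf cmeasurable0 f0) IpE.
under eq_integral do rewrite rnorm0 powR0//.
by rewrite integral0 powR0.
Qed.

Lemma Lp_rnorm f : Lp_function mu p f ->
  Lp_function mu p (fun t => (rnorm (f t))%:C%C) /\ lpn (fun t => (rnorm (f t))%:C%C) = lpn f.
Proof.
move=> /Lp_functionP[mf If].
have E : Ip (fun t => (rnorm (f t))%:C%C) = Ip f.
  by rewrite !IpE; apply: eq_integral => t _; rewrite rnormC_real ger0_norm// rnorm_ge0.
split; last by rewrite !lpnE E.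
apply/Lp_functionP; rewrite E; split=> //; split; first exact: measurable_rnorm.
exact: measurable_cst.
Qed.

(** The tail of the series of the [2^-k] from [k = n] on; the estimates below telescope through
    [geoS]. *)
Let geo n : R := 2 * 2^-1 ^+ n.

Let geoS n : geo n = 2^-1 ^+ n + geo n.+1.
Proof. by rewrite /geo exprS; lra. Qed.

Let geo_ge0 n : 0 <= geo n.
Proof. by rewrite mulr_ge0// exprn_ge0// invr_ge0. Qed.

(** * Completeness of L^p (Riesz-Fischer) *)

Section complete.
Variable u : nat -> T -> C.
Hypothesis Lu : forall k, Lp_function mu p (u k).
Hypothesis du : forall k, lpn (fun t => u k.+1 t - u k t) <= 2^-1 ^+ k.

Let udist n k : lpn (fun t => u n t - u (n + k)%N t) <= geo n - geo (n + k)%N.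
Proof.
elim: k => [|k IH].
  rewrite addn0 subrr lpn_ae0//; last by apply: filterE => t; rewrite subrr.
  by have [mu_ _] := (Lp_functionP _).1 (Lu n); apply: cmeasurableB.
have L1 := Lp_sub (Lu n) (Lu (n + k)%N).
have L2 := Lp_sub (Lu (n + k)%N) (Lu (n + k).+1).
have [_] := Lp_sum L1 L2.
under eq_fun do rewrite addrA subrK.
rewrite addnS => /le_trans; apply; rewrite (geoS (n + k)) in IH.
have h : lpn (fun t => u (n + k)%N t - u (n + k).+1 t) <= 2^-1 ^+ (n + k).
  have [_] := Lp_scale (-1) (Lp_sub (Lu (n + k).+1) (Lu (n + k)%N)).
  rewrite rnormN rnorm1 mul1r; under eq_fun do rewrite mulN1r opprB.
  by move=> ->.
apply: le_trans (lerD IH h) _.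
by rewrite opprD addrA addrAC subrK.
Qed.

(** The norms of these partial sums stay below [geo 0 = 2]. Monotone convergence makes their limit
    finite almost everywhere, and there the sequence [u] converges as an absolutely convergent
    telescoping series. *)
Let g n t : R := \sum_(k < n) rnorm (u k.+1 t - u k t).

Let Lg n : Lp_function mu p (fun t => (g n t)%:C%C) /\
  lpn (fun t => (g n t)%:C%C) <= geo 0 - geo n.
Proof.
elim: n => [|n [L1 IH]].
  under eq_fun do rewrite /g big_ord0; rewrite subrr.
  by split; [exact: Lp_zero|rewrite (lpn_ae0 cmeasurable0)//; apply: filterE].
have [L2 E2] := Lp_rnorm (Lp_sub (Lu n.+1) (Lu n)).
have [L h] := Lp_sum L1 L2.
have E : (fun t => (g n.+1 t)%:C%C) =
    (fun t => (g n t)%:C%C + (rnorm (u n.+1 t - u n t))%:C%C) :> (T -> C).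
  by apply/funext => t; rewrite /g big_ord_recr/= rmorphD.
rewrite E2 in h; rewrite E; split; first exact: L.
apply: (le_trans h).
apply: le_trans (lerD IH (du n)) _; rewrite (geoS n).
by rewrite opprD addrA addrAC subrK.
Qed.

Let g_ge0 n t : 0 <= g n t.
Proof. by apply: sumr_ge0 => k _; apply: rnorm_ge0. Qed.

Let g_nd t : {homo g^~ t : n m / (n <= m)%N >-> n <= m}.
Proof.
move=> n m /subnK <-; elim: (m - n)%N => // k IH; rewrite addSn (le_trans IH)//.
by rewrite /g big_ord_recr/= lerDl rnorm_ge0.
Qed.

Let H n t : \bar R := (g n t `^ p)%:E.

Let H_ge0 n t : (0 <= H n t)%E. Proof. by rewrite lee_fin powR_ge0. Qed.

Let mH n : measurable_fun setT (H n).
Proof.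
have [/Lp_functionP[mg _] _] := Lg n.
have := measurable_rnorm_pow mg.
by under eq_fun do rewrite rnormC_real ger0_norm//.
Qed.

Let H_nd t : {homo H^~ t : n m / (n <= m)%N >-> (n <= m)%E}.
Proof.
move=> n m nm; rewrite lee_fin; apply: ge0_ler_powR; rewrite ?nnegrE ?(ltW p0)//.
exact: g_nd.
Qed.

Let G t : \bar R := limn (H^~ t).

Let mG : measurable_fun setT G.
Proof.
apply: (emeasurable_fun_cvg H) => // t _.
by apply: ereal_nondecreasing_is_cvgn; exact: H_nd.
Qed.

Let intG : (\int[mu]_t G t <= (2 `^ p)%:E)%E.
Proof.
have hc := cvg_monotone_convergence measurableT mH (fun n t _ => H_ge0 n t)
  (fun t _ => @H_nd t) (mu := mu).
rewrite -(cvg_lim _ hc)//; apply: lime_le; first by apply/cvg_ex; eexists; exact: hc.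
apply: nearW => n.
have [/Lp_functionP[mg fg] h] := Lg n.
have -> : (\int[mu]_t H n t)%E = Ip (fun t => (g n t)%:C%C).
  by rewrite IpE; apply: eq_integral => t _; rewrite rnormC_real ger0_norm.
rewrite Ip_lpn// lee_fin; apply: ge0_ler_powR; rewrite ?nnegrE ?lpn_ge0 ?(ltW p0)//.
have -> : 2 = geo 0 by rewrite /geo expr0 mulr1.
by apply: le_trans h _; rewrite gerBl.
Qed.

Let D : set T := [set t | G t \is a fin_num].

Let mD : measurable D.
Proof. by have := emeasurable_fin_num measurableT mG; rewrite setTI. Qed.

Let G_ge0 t : (0 <= G t)%E.
Proof.
apply: lime_ge; last exact: nearW.
by apply: ereal_nondecreasing_is_cvgn; exact: H_nd.
Qed.

Let aeD : \forall t \ae mu, D t.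
Proof.
have /integrable_ae : mu.-integrable setT G.
  apply/integrableP; split=> //; apply: le_lt_trans (_ : (_ <= (2 `^ p)%:E)%E) (ltry _).
  have -> // : (\int[mu]_t `|G t| = \int[mu]_t G t)%E.
  by apply: eq_integral => t _; rewrite gee0_abs.
by move=> /(_ measurableT); apply: filterS => t /(_ I).
Qed.

Let g_bound t : D t -> exists M, forall n, g n t <= M.
Proof.
move=> Dt; exists (fine (G t) `^ p^-1) => n.
rewrite -(@powRr1 _ (g n t))// -(mulfV pn0) powRrM.
apply: ge0_ler_powR; rewrite ?nnegrE ?invr_ge0 ?(ltW p0) ?powR_ge0 ?fine_ge0//.
rewrite -lee_fin (fineK Dt); apply: lime_ge.
  by apply: ereal_nondecreasing_is_cvgn; exact: H_nd.
by exists n => // m /= nm; exact: H_nd.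
Qed.

Let cvg_part (a : nat -> R) t : D t ->
  (forall k, `|a k.+1 - a k| <= rnorm (u k.+1 t - u k t)) -> cvgn a.
Proof.
move=> /g_bound[M gM] h.
suff : cvgn (series (telescope a)).
  move=> /is_cvgD/(_ (is_cvg_cst (a 0%N))).
  by rewrite telescopeK (_ : _ + _ = a)//; apply/funext => n; rewrite /GRing.add/= subrK.
apply: normed_cvg; apply: nondecreasing_is_cvgn.
  by apply: nondecreasing_series => k _ _; exact: normr_ge0.
exists M => _ [n _ <-]; apply: le_trans (gM n).
apply: (@le_trans _ _ (\sum_(0 <= k < n) `|telescope a k|)); first by [].
by rewrite /g big_mkord; apply: ler_sum => k _; exact: h.
Qed.

Let ReB (x y : C) : complex.Re (x - y) = complex.Re x - complex.Re y.
Proof. by case: x y => [a b] [a' b']. Qed.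

Let ImB (x y : C) : complex.Im (x - y) = complex.Im x - complex.Im y.
Proof. by case: x y => [a b] [a' b']. Qed.

(** Killing the sequence off [D] makes it converge at every point and not only almost everywhere, so
    [l] is measurable as an everywhere limit. *)
Let v n t : C := (\1_D t)%:C%C * u n t.
Let l t : C := Complex (limn (fun n => complex.Re (v n t))) (limn (fun n => complex.Im (v n t))).

Let vE n t : D t -> v n t = u n t.
Proof. by move=> Dt; rewrite /v indicE mem_set// mul1r. Qed.

Let v0 n t : ~ D t -> v n t = 0.
Proof. by move=> Dt; rewrite /v indicE memNset// mul0r. Qed.

Let cvgv t : cvgn (fun n => complex.Re (v n t)) /\ cvgn (fun n => complex.Im (v n t)).
Proof.
have [Dt|Dt] := pselect (D t); last first.
  by split; under eq_fun do rewrite v0//; exact: is_cvg_cst.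
split; under eq_fun do rewrite vE//; apply: (cvg_part Dt) => k.
  by rewrite -ReB Re_le_rnorm.
by rewrite -ImB Im_le_rnorm.
Qed.

Let mv n : cmeasurable (v n).
Proof.
have [[m1 m2] _] := (Lp_functionP _).1 (Lu n).
have mI : measurable_fun setT (\1_D : T -> R) by exact: measurable_indic.
rewrite /v; split.
  under eq_fun do rewrite ReM_real ?ler0c ?indicE//=.
  by apply: measurable_funM.
rewrite (_ : (fun t => _) = fun t => \1_D t * complex.Im (u n t)).
  exact: measurable_funM.
by apply/funext => t; case: (u n t) => a b /=; rewrite mul0r addr0.
Qed.

Let ml : cmeasurable l.
Proof.
split.
  apply: (measurable_fun_cvg (h := fun n t => complex.Re (v n t))).
    by move=> n; exact: (mv n).1.
  by move=> t _; exact: (cvgv t).1.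
apply: (measurable_fun_cvg (h := fun n t => complex.Im (v n t))).
  by move=> n; exact: (mv n).2.
by move=> t _; exact: (cvgv t).2.
Qed.

Let vl t : (fun n => rnorm (l t - v n t)) @ \oo --> (0 : R).
Proof.
have [/cvgrPdist_le c1 /cvgrPdist_le c2] := cvgv t.
apply/cvgrPdist_le => e e0.
have e2 : 0 < e / 2 by rewrite divr_gt0.
apply: filterS2 (c1 _ e2) (c2 _ e2) => n h1 h2.
rewrite sub0r normrN ger0_norm ?rnorm_ge0// (le_trans (rnorm_le_ReIm _))//.
by rewrite ReB ImB [leRHS]splitr lerD.
Qed.

(** Fatou for the functions [rnorm (u n - v (n + m)) ^ p] in [m]: their limit is the integrand on
    the left, and each integral is bounded by [udist]. *)
Let Ipul n : (Ip (fun t => u n t - l t)%R <= (geo n `^ p)%:E)%E.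
Proof.
have [mun _] := (Lp_functionP _).1 (Lu n).
pose f m t : \bar R := (rnorm (u n t - v (n + m)%N t) `^ p)%:E.
have mf m : measurable_fun setT (f m).
  by apply: measurable_rnorm_pow; exact: cmeasurableB.
have f0 m t : (0 <= f m t)%E by rewrite lee_fin powR_ge0.
have lim_f t : limn_einf (f^~ t) = (rnorm (u n t - l t) `^ p)%:E.
  apply: (cvg_limn_einf_sup _).1; apply: cvg_EFin; first exact: nearW.
  apply: cvg_powR => //; first by move=> m; apply: rnorm_ge0.
    exact: rnorm_ge0.
  apply/cvgrPdist_le => e e0.
  have := vl t; rewrite -(@cvg_shiftn n) => /cvgrPdist_le/(_ _ e0).
  apply: filterS => m; rewrite sub0r normrN ger0_norm ?rnorm_ge0// addnC.
  apply: le_trans; apply: le_trans (rnorm_dist _ _) _.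
  by rewrite opprB addrC addrA subrK rdistC.
have := fatou mu measurableT mf (fun m t _ => f0 m t).
under eq_integral do rewrite lim_f.
move=> /le_trans; apply; rewrite limn_einf_lim.
apply: lime_le; first exact: is_cvg_einfs.
apply: nearW => m; apply: (@le_trans _ _ (\int[mu]_t f m t)%E).
  by apply: ereal_inf_lbound; exists m => /=.
have -> : (\int[mu]_t f m t)%E = Ip (fun t => u n t - u (n + m)%N t).
  have [mum _] := (Lp_functionP _).1 (Lu (n + m)%N).
  apply: Ip_ae; [exact: cmeasurableB|exact: cmeasurableB|].
  by apply: filterS aeD => t Dt; rewrite vE.
have /Lp_functionP[_ fin] := Lp_sub (Lu n) (Lu (n + m)%N).
rewrite Ip_lpn// lee_fin; apply: ge0_ler_powR; rewrite ?nnegrE ?lpn_ge0 ?(ltW p0)//.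
by apply: le_trans (udist _ _) _; rewrite gerBl.
Qed.

Lemma Lp_complete : exists2 l : T -> C, Lp_function mu p l &
  forall n, lpn (fun t => u n t - l t) <= 2 * 2^-1 ^+ n.
Proof.
have L n : Lp_function mu p (fun t => u n t - l t).
  apply/Lp_functionP; split; last exact: le_lt_trans (Ipul n) (ltry _).
  by have [mun _] := (Lp_functionP _).1 (Lu n); apply: cmeasurableB.
exists l => [|n]; last exact: (lpn_le_Ip _ (Ipul n)).2.
(* [l] is recovered as [u 0 - (u 0 - l)], a difference of two functions of L^p. *)
have := Lp_sub (Lu 0%N) (L 0%N).
by under eq_fun do rewrite opprB addrC subrK.
Qed.

End complete.

End Lp.

(** * The Banach space of L^p functions modulo null functions *)

Section LpBanach.
Variables (R : realType) (d : measure_display) (T : measurableType d).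
Variables (mu : {measure set T -> \bar R}) (p : R) (p1 : 1 <= p).
Local Notation C := R[i].

Definition Lp_pred : {pred T -> C^o} := fun f => `[< Lp_function mu p f >].

Lemma Lp_submod : submod_closed Lp_pred.
Proof.
split; first by apply/asboolP; exact: Lp_zero.
move=> a f g /asboolP Lf /asboolP Lg; apply/asboolP.
exact: (Lp_sum p1 (Lp_scale p1 a Lf).1 Lg).1.
Qed.

HB.instance Definition _ := GRing.isSubmodClosed.Build C (T -> C^o) Lp_pred Lp_submod.

Definition Lp_fun := {f : T -> C^o | Lp_pred f}.
HB.instance Definition _ := SubChoice.on Lp_fun.
HB.instance Definition _ := [SubChoice_isSubLmodule of Lp_fun by <:].

Definition lp_norm (f : Lp_fun) : R := lpn mu p (val f).

Lemma Lp_valP (f : Lp_fun) : Lp_function mu p (val f).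
Proof. by apply/asboolP; exact: (valP f). Qed.

Lemma lp_normD f g : lp_norm (f + g) <= lp_norm f + lp_norm g.
Proof. exact: (Lp_sum p1 (Lp_valP f) (Lp_valP g)).2. Qed.

Lemma lp_normZ a f : lp_norm (a *: f) = rnorm a * lp_norm f.
Proof. exact: (Lp_scale p1 a (Lp_valP f)).2. Qed.

Lemma lp_complete : seq_complete (fun f g : Lp_fun => lp_norm (f - g)).
Proof.
move=> u du.
have [l Ll ul] := Lp_complete p1 (fun k => Lp_valP (u k)) du.
have Ll' : Lp_pred l by apply/asboolP.
exists (Sub l Ll' : Lp_fun).
have h0 : (fun n => 2 * 2^-1 ^+ n : R) @ \oo --> (0 : R).
  rewrite -[X in _ --> X](mulr0 2); apply: cvgM; first exact: cvg_cst.
  by apply: cvg_expr; rewrite ger0_norm// invf_lt1// ltr1n.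
apply: (squeeze_cvgr _ (cvg_cst 0) h0).
by apply: nearW => n; rewrite lpn_ge0/=; exact: ul.
Qed.

Definition Lp_seminormed := Seminormed lp_normD lp_normZ lp_complete.
Definition Lp_banach : completeNormedModType C := sep_banach Lp_seminormed.

Definition Lp_repr (b : Lp_banach) : T -> C := val (repr (b : sep Lp_seminormed) : Lp_fun).

Lemma Lp_repr_Lp b : Lp_function mu p (Lp_repr b).
Proof. exact: Lp_valP. Qed.

Lemma Lp_repr_lin (a : C) b b' :
  {ae mu, forall t, Lp_repr (a *: b + b') t = a * Lp_repr b t + Lp_repr b' t}.
Proof.
rewrite /Lp_repr.
set f : Lp_fun := repr _; set g : Lp_fun := repr _; set h : Lp_fun := repr _.
have : lp_norm (f - (a *: g + h)) = 0.
  apply/(@sep_piP _ Lp_seminormed); rewrite sep_piD sep_piZ.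
  by rewrite !sep_reprK.
move=> /(lpn_eq0 p1 (Lp_valP (f - (a *: g + h)))).
by apply: filterS => t /eqP; rewrite subr_eq0 => /eqP.
Qed.

Lemma Lp_repr_norm b : 'N[mu]_(p%:E)[EFin \o rnorm \o Lp_repr b]%E = (rnorm b)%:E.
Proof.
have /Lp_functionP - /(_ p1) [_ fin] := Lp_repr_Lp b.
by rewrite (Lnorm_lpn fin) -[in RHS](sep_reprK b) sep_rnormE.
Qed.

Lemma Lp_repr_surj f : Lp_function mu p f ->
  exists b, {ae mu, forall t, Lp_repr b t = f t}.
Proof.
move=> Lf; have Lf' : Lp_pred f by apply/asboolP.
exists (sep_pi (S := Lp_seminormed) (Sub f Lf' : Lp_fun)); rewrite /Lp_repr.
have := @sep_repr _ Lp_seminormed (Sub f Lf' : Lp_fun).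
move: (repr _) => g h0; have {h0} : lp_norm (g - (Sub f Lf' : Lp_fun)) = 0 := h0.
move=> /(lpn_eq0 p1 (Lp_valP (g - (Sub f Lf' : Lp_fun)))).
by apply: filterS => t /eqP; rewrite subr_eq0 => /eqP.
Qed.

Lemma Lp_banachP : is_Lp_space p Lp_banach.
Proof.
exists d, T, mu, Lp_repr; split.
- exact: Lp_repr_Lp.
- exact: Lp_repr_lin.
- exact: Lp_repr_norm.
- exact: Lp_repr_surj.
Qed.

End LpBanach.

Import HBNNSimple.

(** * An induction principle for L^p: indicators, linear combinations, norm limits *)

Section Density.
Variables (R : realType) (d : measure_display) (T : measurableType d).
Variables (mu : {measure set T -> \bar R}) (p : R) (p1 : 1 <= p).
Local Notation C := R[i].

Definition cind (A : set T) : T -> C := fun t => (\1_A t : R)%:C%C.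

Lemma cmeasurable_cind (A : set T) : measurable A -> cmeasurable (cind A).
Proof.
move=> mA; split; last exact: measurable_cst.
exact: measurable_indic.
Qed.

Let p0 : 0 < p. Proof. exact: lt_le_trans p1. Qed.

Lemma Ip_cind (A : set T) : measurable A -> Ip mu p (cind A) = mu A.
Proof.
move=> mA; rewrite IpE -[in RHS](setIT A) -integral_indic//; apply: eq_integral => t _.
rewrite rnormC_real indicE; case: (_ \in _); rewrite ?normr1 ?normr0 ?powR1//.
by rewrite powR0 ?gt_eqF.
Qed.

Lemma Lp_cind (A : set T) : measurable A -> (mu A < +oo)%E -> Lp_function mu p (cind A).
Proof.
move=> mA fA; apply/(Lp_functionP mu p1); split; first exact: cmeasurable_cind.
by rewrite Ip_cind.
Qed.

Variable D : set (T -> C).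
Hypothesis D_ind : forall A, measurable A -> (mu A < +oo)%E -> D (cind A).
Hypothesis D_lin : forall (a : C) f g, D f -> D g -> D (fun t => a * f t + g t).
Hypothesis D_closed : forall f, Lp_function mu p f ->
  (forall e, 0 < e -> exists g, [/\ Lp_function mu p g, D g &
     lpn mu p (fun t => f t - g t) <= e]) -> D f.

Let D0 : D (fun=> 0).
Proof.
have := D_ind measurable0; rewrite measure0 => /(_ (ltry _)).
by congr D; apply/funext => t; rewrite /cind indic0.
Qed.

Let DZ (a : C) f : D f -> D (fun t => a * f t).
Proof. by move=> /(D_lin a)/(_ D0); under eq_fun do rewrite addr0. Qed.

Let D_sum (I : Type) (r : seq I) (P : pred I) (f : I -> T -> C) :
  (forall i, P i -> D (f i)) -> D (fun t => \sum_(i <- r | P i) f i t).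
Proof.
move=> Df; elim: r => [|i r IH]; first by under eq_fun do rewrite big_nil.
case Pi: (P i); under eq_fun do rewrite big_cons Pi; last by [].
by have := D_lin 1 (Df i Pi) IH; under eq_fun do rewrite mul1r.
Qed.

Section nonneg.
Variable f : T -> R.
Hypothesis f0 : forall t, 0 <= f t.
Hypothesis mf : measurable_fun setT f.
Hypothesis If : (\int[mu]_t (f t `^ p)%:E < +oo)%E.

Let mfp : measurable_fun setT (fun t => (f t `^ p)%:E).
Proof.
by apply/measurable_EFinP; apply: (measurableT_comp (measurable_powR p)).
Qed.

Let IpC (g : T -> R) : (forall t, 0 <= g t) ->
  Ip mu p (fun t => (g t)%:C%C) = (\int[mu]_t (g t `^ p)%:E)%E.
Proof.
by move=> g0; rewrite IpE; apply: eq_integral => t _; rewrite rnormC_real ger0_norm.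
Qed.

Let D_sfun (g : {nnsfun T >-> R}) : (forall t, g t <= f t) -> D (fun t => (g t)%:C%C).
Proof.
move=> gf.
have E t : (g t)%:C%C = \sum_(y <- fset_set (range g) | y != 0)
    (y%:C%C * cind (g @^-1` [set y]) t) :> C.
  rewrite fimfunE fsbig_finite//= rmorph_sum/=.
  rewrite (bigID (fun y : R => y != 0))/= [X in _ + X]big1 ?addr0.
    by apply: eq_bigr => y _; rewrite rmorphM.
  by move=> y /negPn/eqP ->; rewrite mul0r.
under eq_fun do rewrite E.
apply: D_sum => y y0; apply: DZ; set A := g @^-1` _.
have mA : measurable A by exact: measurable_sfunP.
apply: D_ind => //.
have yp : 0 < `|y| `^ p by rewrite powR_gt0// normr_gt0.
(* Chebyshev: [f] is at least [y] on the fibre [A], so the product is at most the integral of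
   [f ^ p]. Hence fibres over nonzero values have finite measure. *)
have h : ((`|y| `^ p)%:E * mu A < +oo)%E.
  apply: le_lt_trans If; rewrite -integral_cst//.
  apply: (@le_trans _ _ (\int[mu]_(t in A) (f t `^ p)%:E)%E).
    apply: ge0_le_integral => //.
    - by move=> t _; rewrite lee_fin ltW.
    - exact: measurable_funTS.
    - move=> t At; rewrite lee_fin; apply: ge0_ler_powR; rewrite ?nnegrE ?(ltW p0)//.
      by rewrite -(At : g t = y) ger0_norm.
  apply: ge0_subset_integral => // t _; rewrite lee_fin powR_ge0//.
move: h; have [|] := eqVneq (mu A) +oo%E; last by rewrite -ltey.
by move=> ->; rewrite gt0_muley ?lte_fin.
Qed.

(** Simple functions [g n] increase to [f], and [(f - g n) ^ p] tends to 0 below the integrable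
    function [f ^ p]; dominated convergence turns this into convergence in norm. *)
Lemma Lp_density_ge0 : D (fun t => (f t)%:C%C).
Proof.
have f0' t : setT t -> (0 <= (f t)%:E)%E by rewrite lee_fin.
have mf' : measurable_fun setT (EFin \o f) by exact/measurable_EFinP.
have [g [ndg gf]] := approximation measurableT mf' f0'.
have gle n t : g n t <= f t.
  have h : nondecreasing_seq (EFin \o (g ^~ t)).
    by move=> a b ab; rewrite lee_fin; apply/lefP: t; exact: ndg.
  have E : limn (EFin \o g ^~ t) = (f t)%:E by apply: cvg_lim => //; exact: gf.
  rewrite -lee_fin -E; apply: lime_ge; first exact: cvgP (gf t I).
  by exists n => // m /= nm; exact: h.
have cf : cmeasurable (fun t => (f t)%:C%C) by split; [exact: mf|exact: measurable_cst].
apply: D_closed.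
  by apply/(Lp_functionP mu p1); split; [exact: cf|rewrite (IpC f0); exact: If].
move=> e e0.
have mg n : measurable_fun setT (g n) by [].
pose h n t := ((f t - g n t) `^ p)%:E.
have mh n : measurable_fun setT (h n).
  apply/measurable_EFinP; apply: (measurableT_comp (measurable_powR p)).
  exact: measurable_funB.
have hf n t : (`|h n t| <= (f t `^ p)%:E)%E.
  rewrite gee0_abs ?lee_fin ?powR_ge0//; apply: ge0_ler_powR; rewrite ?nnegrE ?(ltW p0)//.
    by rewrite subr_ge0.
  by rewrite gerBl.
have fint : mu.-integrable setT (fun t => (f t `^ p)%:E).
  apply/integrableP; split=> //.
  by under eq_integral do rewrite gee0_abs ?lee_fin ?powR_ge0//.
have hcvg t : h^~ t @ \oo --> 0%E.
  apply: cvg_EFin; first exact: nearW.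
  rewrite -(@powR0 R p) ?gt_eqF//; apply: cvg_powR => //.
    by move=> n; rewrite subr_ge0.
  rewrite -(subrr (f t)); apply: cvgB; first exact: cvg_cst.
  have /fine_cvgP[_] := gf t I.
  exact.
have [_ _] := dominated_convergence measurableT mh (measurable_cst 0%E)
   (nearW _ (fun t _ => hcvg t)) fint (nearW _ (fun t n _ => hf n t)).
rewrite integral0 => /fine_cvgP[hfin].
move=> /cvgrPdist_le/(_ (e `^ p) (powR_gt0 _ e0)) hle.
have [n [/= hn1 hn2]] := filter_ex (filterI hfin hle).
exists (fun t => (g n t)%:C%C); split; last 1 first.
- apply: (@lpn_le_Ip _ _ _ mu p p1 _ e (ltW e0) _).2.
  have -> : (fun t => (f t)%:C%C - (g n t)%:C%C) = (fun t => (f t - g n t)%:C%C) :> (T -> C).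
    by apply/funext => t; rewrite rmorphB.
  rewrite IpC; last by move=> t; rewrite subr_ge0.
  rewrite -(fineK hn1) lee_fin; move: hn2; rewrite sub0r normrN.
  by apply: le_trans; exact: ler_norm.
- apply/(Lp_functionP mu p1); split; first by split; [exact: mg|exact: measurable_cst].
  have g0 t : 0 <= g n t by [].
  rewrite (IpC g0); apply: (le_lt_trans _ If); apply: ge0_le_integral.
  + exact: measurableT.
  + by move=> t _; rewrite lee_fin powR_ge0.
  + by apply/measurable_EFinP; apply: (measurableT_comp (measurable_powR p)).
  + exact: mfp.
  + by move=> t _; rewrite lee_fin; apply: ge0_ler_powR; rewrite ?nnegrE ?(ltW p0).
- exact: D_sfun.
Qed.

End nonneg.

(** Real and imaginary parts, then positive and negative parts, are dominated by [rnorm (f t)] and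
    so fall under the nonnegative case. *)
Lemma Lp_density f : Lp_function mu p f -> D f.
Proof.
move=> /(Lp_functionP mu p1)[mf If].
have key (h : T -> R) : measurable_fun setT h -> (forall t, `|h t| <= rnorm (f t)) ->
    D (fun t => (h t)%:C%C).
  move=> mh hle.
  have aux (k : T -> R) : measurable_fun setT k -> (forall t, 0 <= k t) ->
      (forall t, k t <= `|h t|) -> D (fun t => (k t)%:C%C).
    move=> mk k0 kh; apply: (Lp_density_ge0 k0 mk); apply: (le_lt_trans _ If); rewrite IpE.
    apply: ge0_le_integral.
    - exact: measurableT.
    - by move=> t _; rewrite lee_fin powR_ge0.
    - by apply/measurable_EFinP; apply: (measurableT_comp (measurable_powR p)).
    - exact: measurable_rnorm_pow.
    - move=> t _; rewrite lee_fin; apply: ge0_ler_powR; rewrite ?nnegrE ?(ltW p0)//.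
        exact: rnorm_ge0.
      exact: le_trans (kh t) (hle t).
  have D1 : D (fun t => (Num.max (h t) 0)%:C%C).
    apply: aux => [|t|t]; first exact: measurable_maxr.
      by rewrite le_max lexx orbT.
    by rewrite ge_max normr_ge0 ler_norm.
  have D2 : D (fun t => (Num.max (- h t) 0)%:C%C).
    apply: aux => [|t|t]; first by apply: measurable_maxr => //; exact: measurableT_comp.
      by rewrite le_max lexx orbT.
    by rewrite ge_max normr_ge0 andbT -normrN ler_norm.
  have := D_lin (-1) D2 D1; congr D; apply/funext => t.
  rewrite mulN1r -rmorphN -rmorphD/=; congr (_%:C)%C.
  by rewrite /Num.max; do 2 case: ifPn => //; lra.
have D1 := key _ mf.1 (fun t => Re_le_rnorm _).
have D2 := key _ mf.2 (fun t => Im_le_rnorm _).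
have := D_lin 'i%C D2 D1; congr D; apply/funext => t.
by rewrite addrC; case: (f t) => a b; apply/eqP;
  rewrite eq_complex/= !mulr0 !mul0r mul1r !(add0r, addr0, subr0) !eqxx.
Qed.

End Density.

(** * Representing contents by measures on spaces of ultrafilters *)

(* Representation of a finitely additive content on a ring of subsets of [Y] by
   a measure on the space of ultrafilters on [Y]: there compactness makes the
   content countably additive. *)
Record ring_content (R : realType) (Y : Type) := RingContent {
  rc_ring : set (set Y);
  rc_ring0 : rc_ring set0;
  rc_ringU : forall E F, rc_ring E -> rc_ring F -> rc_ring (E `|` F);
  rc_ringD : forall E F, rc_ring E -> rc_ring F -> rc_ring (E `\` F);
  rc : set Y -> R;
  rc_ge0 : forall E, rc_ring E -> 0 <= rc E;
  rcU : forall E F, rc_ring E -> rc_ring F -> E `&` F = set0 -> rc (E `|` F) = rc E + rc F }.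

Section Stone.
Variables (R : realType) (Y : Type) (c : ring_content R Y).
Local Notation ring := (rc_ring c).
Implicit Types E F : set Y.

(** The points are all set systems on [Y]; those that are not ultrafilters lie in no [stone_set], so
    they belong to no set of the ring below. *)
Definition stone : Type := set_system Y.
HB.instance Definition _ := Pointed.on stone.

Definition stone_set E : set stone := [set U | UltraFilter U /\ U E].

Lemma ultra_notC (U : set_system Y) E : UltraFilter U -> U (~` E) <-> ~ U E.
Proof.
move=> uU; have pU := @ultra_proper _ _ uU; split=> [UC UE|nUE].
  by apply: (@filter_not_empty _ U); rewrite -(setICr E); exact: filterI.
by have [//|] := in_ultra_setVsetC E uU.
Qed.

Lemma stone_set0 : stone_set set0 = set0.
Proof.
rewrite -subset0 => U [uU U0]; have pU := @ultra_proper _ _ uU.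
exact: (@filter_not_empty _ U).
Qed.

Lemma stone_setD E F : stone_set (E `\` F) = stone_set E `\` stone_set F.
Proof.
apply/seteqP; split=> U.
  move=> [uU UEF]; have pU := @ultra_proper _ _ uU; split.
    by split=> //; apply: filterS UEF => y [].
  by case=> _; apply/(ultra_notC _ uU).1; apply: filterS UEF => y [].
move=> [[uU UE] nUF]; have pU := @ultra_proper _ _ uU; split=> //.
rewrite setDE; apply: filterI => //; apply/(ultra_notC _ uU) => UF; exact: nUF.
Qed.

Lemma stone_setU E F : stone_set (E `|` F) = stone_set E `|` stone_set F.
Proof.
apply/seteqP; split=> U.
  move=> [uU UEF]; have pU := @ultra_proper _ _ uU.
  have [UE|UE] := in_ultra_setVsetC E uU; first by left.
  by right; split=> //; apply: filterS (filterI UEF UE) => y [[|//]] /[swap].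
by case=> -[uU UE]; have pU := @ultra_proper _ _ uU; split=> //; apply: filterS UE => y;
  [left|right].
Qed.

Lemma stone_setI E F : stone_set (E `&` F) = stone_set E `&` stone_set F.
Proof.
apply/seteqP; split=> U.
  by move=> [uU UEF]; have pU := @ultra_proper _ _ uU; split; split=> //;
    apply: filterS UEF => y [].
by move=> [[uU UE] [_ UF]]; have pU := @ultra_proper _ _ uU; split=> //; apply: filterI.
Qed.

Lemma stone_setS E F : E `<=` F -> stone_set E `<=` stone_set F.
Proof. by move=> EF U [uU UE]; have pU := @ultra_proper _ _ uU; split=> //; apply: filterS UE. Qed.

(** If no finite union of the [F k] covers [E], the decreasing nonempty differences generate a
    proper filter; an ultrafilter refining it contains [E] and no [F k], so it escapes the cover. *)
Lemma stone_compact E (F : nat -> set Y) :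
  stone_set E `<=` \bigcup_k stone_set (F k) ->
  exists n, E `<=` \bigcup_(k in `I_n) F k.
Proof.
move=> EF; apply: contrapT => /forallNP nE.
pose G n := E `\` \bigcup_(k in `I_n) F k.
have G0 n : G n !=set0.
  by apply/set0P/negP => /eqP; rewrite setD_eq0 => EFn; apply: (nE n).
have Gd m n : (m <= n)%N -> G n `<=` G m.
  move=> mn y [Ey nF]; split=> // -[k /= km Fk]; apply: nF; exists k => //=.
  exact: leq_trans mn.
pose B : set_system Y := filter_from [set: nat] G.
have pB : ProperFilter B.
  apply: filter_from_proper => //; apply: filter_from_filter; first by exists 0%N.
  move=> m n _ _; exists (maxn m n) => // y Gy.
  by split; apply: Gd Gy; rewrite (leq_maxl, leq_maxr).
have [U [uU BU]] := ultraFilterLemma pB.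
have pU := @ultra_proper _ _ uU.
have UG n : U (G n) by apply: BU; exists n.
have UE : stone_set E U by split=> //; apply: filterS (UG 0%N) => y [].
have [k _ [_ UF]] := EF _ UE.
apply: ((ultra_notC (F k) uU).1 _ UF); apply: filterS (UG k.+1) => y [_ nF] Fk.
by apply: nF; exists k => /=.
Qed.

(** Compactness for the cover constantly equal to [F]. *)
Lemma stone_set_sub E F : stone_set E `<=` stone_set F -> E `<=` F.
Proof.
move=> EF; have [|n En] := @stone_compact E (fun=> F).
  by move=> U /EF UF; exists 0%N.
by move=> y /En[].
Qed.

Lemma stone_set_inj : injective stone_set.
Proof. by move=> E F EF; apply/seteqP; split; apply: stone_set_sub; rewrite EF. Qed.

Definition stone_ring : set (set stone) := [set stone_set E | E in ring].

Lemma stone_ring0 : stone_ring set0.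
Proof. by exists set0; [exact: rc_ring0|exact: stone_set0]. Qed.
Lemma stone_ringU : setU_closed stone_ring.
Proof.
by move=> _ _ [E rE <-] [F rF <-]; exists (E `|` F); [exact: rc_ringU|exact: stone_setU].
Qed.
Lemma stone_ringD : setD_closed stone_ring.
Proof.
by move=> _ _ [E rE <-] [F rF <-]; exists (E `\` F); [exact: rc_ringD|exact: stone_setD].
Qed.

HB.instance Definition _ := isRingOfSets.Build default_measure_display stone
  stone_ring0 stone_ringU stone_ringD.

Lemma stone_measurable E : ring E -> measurable (stone_set E).
Proof. by exists E. Qed.

(** The chosen representative is unique by [stone_set_inj]; off the ring the value 0 is a
    default. *)
Definition stone_content (A : set stone) : \bar R :=
  if pselect (exists2 E, ring E & stone_set E = A) is left e then (rc c (s2val (cid2 e)))%:E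
  else 0%E.

Lemma stone_contentE E : ring E -> stone_content (stone_set E) = (rc c E)%:E.
Proof.
move=> rE; rewrite /stone_content; case: pselect => [e|[]]; last by exists E.
by case: cid2 => F /= rF /stone_set_inj ->.
Qed.

Lemma rc0 : rc c set0 = 0.
Proof.
have r0 := rc_ring0 c; have := rcU r0 r0 (setI0 _); rewrite setU0 => h.
by apply: (@addrI _ (rc c set0)); rewrite -h addr0.
Qed.

Lemma stone_content0 : stone_content set0 = 0%E.
Proof. by rewrite -stone_set0 stone_contentE ?rc0//; exact: rc_ring0. Qed.

Lemma stone_content_ge0 A : (0 <= stone_content A)%E.
Proof.
by rewrite /stone_content; case: pselect => // e; case: cid2 => E /= rE _; rewrite lee_fin rc_ge0.
Qed.

Lemma stone_contentU E F : ring E -> ring F -> E `&` F = set0 ->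
  stone_content (stone_set (E `|` F)) =
  (stone_content (stone_set E) + stone_content (stone_set F))%E.
Proof.
by move=> rE rF EF; rewrite !stone_contentE ?rcU//; exact: rc_ringU.
Qed.

(** By compactness a disjoint sequence whose union lies in the ring has only finitely many nonempty
    terms, so finite additivity is enough. *)
Lemma stone_content_semi_sigma_additive : semi_sigma_additive stone_content.
Proof.
move=> A mA tA [E rE EA].
have /choice[F /all_and2[rF FA]] : forall k, exists F, ring F /\ stone_set F = A k.
  by move=> k; have [F rF FA] := mA k; exists F.
have dF i j : i != j -> F i `&` F j = set0.
  move=> ij; apply: stone_set_inj; rewrite stone_set0 stone_setI !FA.
  by move/trivIsetP : tA => /(_ i j I I ij).
have [n En] : exists n, E `<=` \bigcup_(k in `I_n) F k.
  by apply: stone_compact; rewrite EA => U [k _ AU]; exists k => //; rewrite FA.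
have FE k : F k `<=` E.
  by apply: stone_set_sub; rewrite FA EA => U AU; exists k.
have Fn0 k : (n <= k)%N -> F k = set0.
  move=> nk; rewrite -subset0 => y Fky; have [j /= jn Fjy] := En _ (FE _ _ Fky).
  have : (F j `&` F k) y by [].
  by rewrite dF//; apply: contraTneq jn => ->; rewrite -leqNgt.
have part k : ring (\bigcup_(i in `I_k) F i) /\
    stone_content (stone_set (\bigcup_(i in `I_k) F i)) = (\sum_(0 <= i < k) stone_content (A i))%E.
  elim: k => [|k [rk IH]].
    by rewrite II0 bigcup_set0 big_nil stone_set0 stone_content0; split=> //; exact: rc_ring0.
  have -> : \bigcup_(i in `I_k.+1) F i = (\bigcup_(i in `I_k) F i) `|` F k.
    by rewrite IIS bigcup_setU bigcup_set1.
  split; first exact: rc_ringU.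
  rewrite big_nat_recr//= stone_contentU// ?IH ?FA//.
  rewrite -subset0 => y [[j /= jk Fjy] Fky].
  have : (F j `&` F k) y by [].
  by rewrite dF//; apply: contraTneq jk => ->; rewrite ltnn.
have -> : \bigcup_k A k = stone_set (\bigcup_(i in `I_n) F i).
  rewrite -EA; congr stone_set; apply/seteqP; split=> // y [k _]; exact: FE.
rewrite (part n).2; apply: cvg_near_cst.
exists n => // m /= nm; rewrite (@big_cat_nat _ _ _ n 0 m)//=.
suff -> : \sum_(n <= i < m) stone_content (A i) = 0%E by rewrite addr0.
rewrite big_nat_cond big1// => i /andP[/andP[ni _] _].
by rewrite -FA Fn0// stone_set0 stone_content0.
Qed.

HB.instance Definition _ := isMeasure.Build _ stone R stone_content
  stone_content0 stone_content_ge0 stone_content_semi_sigma_additive.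

Definition stoneT : measurableType _ := g_sigma_algebraType (@measurable _ stone).

Definition stone_measure : {measure set stoneT -> \bar R} :=
  [the measure _ _ of measure_extension stone_content].

Lemma stone_set_measurable E : ring E -> measurable (stone_set E : set stoneT).
Proof. by move=> rE; apply: sub_sigma_algebra; exact: stone_measurable. Qed.

Lemma stone_measureE E : ring E -> stone_measure (stone_set E) = (rc c E)%:E.
Proof.
move=> rE; rewrite -stone_contentE//; apply: measurable_mu_extE.
exact: stone_measurable.
Qed.

(** The measure is an outer measure, so some countable cover by ring sets has a union [U] exceeding
    [A] by at most [e / 2]. By continuity from below a finite part of the cover exhausts [U] up to
    [e / 2], and it lies in the ring. *)
Lemma stone_approx (A : set stoneT) (e : R) : measurable A -> (stone_measure A < +oo)%E ->
  0 < e -> exists2 E, ring E & (stone_measure (A `\` stone_set E) +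
    stone_measure (stone_set E `\` A) <= e%:E)%E.
Proof.
move=> mA fA e0; have e20 : 0 < e / 2 by rewrite divr_gt0.
have finA : stone_measure A \is a fin_num by rewrite ge0_fin_numE.
have [_ [F [mF AF] <-] hF] := lb_ereal_inf_adherent e20 finA.
have /choice[E /all_and2[rE EF]] : forall k, exists E, ring E /\ stone_set E = F k.
  by move=> k; have [E rE EF] := mF k; exists E.
pose V n := \bigcup_(k in `I_n) E k.
have rV n : ring (V n).
  elim: n => [|n IH]; first by rewrite /V II0 bigcup_set0; exact: rc_ring0.
  by rewrite /V IIS bigcup_setU bigcup_set1; apply: rc_ringU.
pose U : set stoneT := \bigcup_k F k.
have mFk k : measurable (F k : set stoneT) by rewrite -EF; exact: stone_set_measurable.
have mU : measurable U by apply: bigcup_measurable.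
have UV : U = \bigcup_n stone_set (V n).
  apply/seteqP; split=> x [k _ xk].
    exists k.+1 => //; rewrite /= -EF in xk; apply: stone_setS xk => y Ey.
    by exists k => /=.
  elim: k xk => [|k IH]; first by rewrite /V II0 bigcup_set0 stone_set0.
  rewrite /V IIS bigcup_setU bigcup_set1 stone_setU => -[//|].
  by rewrite EF => xk; exists k.
have hU : (stone_measure U < stone_measure A + (e / 2)%:E)%E.
  apply: le_lt_trans hF;
    apply: (@le_trans _ _ (\sum_(0 <= k <oo) stone_measure (F k : set stoneT))%E).
    exact: measure_sigma_subadditive.
  apply: lee_nneseries => [k _ _|k _]; first exact: measure_ge0.
  have -> : stone_measure (F k) = (rc c (E k))%:E by rewrite -EF stone_measureE.
  suff h : stone_content (F k) = (rc c (E k))%:E by rewrite -h.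
  by rewrite -EF stone_contentE.
have fU : (stone_measure U < +oo)%E by apply: lt_trans hU _; rewrite lte_add_pinfty// ltry.
have UA : (stone_measure (U `\` A) <= (e / 2)%:E)%E.
  by rewrite measureD//= (setIidr AF) leeBlDl// ltW.
have cvV : (stone_measure \o (fun n => stone_set (V n) : set stoneT)) @ \oo --> stone_measure U.
  rewrite UV; apply: nondecreasing_cvg_mu.
  - by move=> n; exact: stone_set_measurable.
  - by rewrite -UV.
  - move=> m n mn; apply/subsetPset; apply: stone_setS => y [k /= km Ey].
    by exists k => //=; exact: leq_trans mn.
have finU : stone_measure U \is a fin_num by rewrite ge0_fin_numE.
have [n hn] : exists n, (stone_measure U - (e / 2)%:E < stone_measure (stone_set (V n)))%E.
  apply: contrapT => /forallNP h.
  have : (stone_measure U <= stone_measure U - (e / 2)%:E)%E.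
    rewrite -{1}(cvg_lim _ cvV)//; apply: lime_le; first exact: cvgP cvV.
    by apply: nearW => n /=; rewrite leNgt; apply/negP/h.
  by rewrite -(fineK finU) -EFinB lee_fin; move: (fine _) => r; lra.
exists (V n) => //.
have VU : stone_set (V n) `<=` U by rewrite UV => x xV; exists n.
have mV := stone_set_measurable (rV n).
have h1 : (stone_measure (A `\` stone_set (V n)) <= (e / 2)%:E)%E.
  apply: (@le_trans _ _ (stone_measure (U `\` stone_set (V n)))).
    by apply: le_measure; rewrite ?inE; [exact: measurableD|exact: measurableD|exact: setSD].
  rewrite measureD//= (setIidr VU).
  by rewrite leeBlDr ?leeBlDl//; [rewrite addeC -leeBlDr// ltW|rewrite stone_measureE].
have h2 : (stone_measure (stone_set (V n) `\` A) <= (e / 2)%:E)%E.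
  apply: le_trans UA; apply: le_measure; rewrite ?inE;
    [exact: measurableD|exact: measurableD|exact: setSD].
by rewrite [e]splitr EFinD leeD.
Qed.

End Stone.

(** * Extension of bounded linear maps from a dense subspace *)

Section Extension.
Variable R : realType.
Local Notation C := R[i].

Lemma complete_rcvg (B : completeNormedModType C) (u : nat -> B) :
  (forall e : R, 0 < e -> exists N, forall m n, (N <= m)%N -> (N <= n)%N ->
     rnorm (u m - u n) <= e) ->
  exists l, forall e : R, 0 < e -> exists N, forall n, (N <= n)%N -> rnorm (l - u n) <= e.
Proof.
move=> hu.
have /cauchy_cvg/cvg_ex[l /cvg_rnormP ul] : cauchy (u @ \oo).
  apply/cauchyP => /= e e0.
  have e0' : 0 < complex.Re e by case: e e0 => [a b]; rewrite ltcE/= => /andP[_].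
  have eE : e = (complex.Re e)%:C%C by rewrite RRe_real// gtr0_real.
  have e2 : 0 < complex.Re e / 2 by rewrite divr_gt0.
  have [N hN] := hu _ e2; exists (u N).
  exists N => // n /= Nn; rewrite -ball_normE /ball_/= eE ltr_rnormE.
  by rewrite (le_lt_trans (hN _ _ _ _))// ltr_pdivrMr// mulr_natr mulr2n ltrDl.
exists l => e /ul[N _ hN]; exists N => n Nn; apply/ltW; exact: hN.
Qed.

Variables (S V : lmodType C) (B : completeNormedModType C).
Variables (P : set S) (Q : set V) (iota : S -> V) (f : S -> B) (N : V -> R) (K : R).
Hypothesis K0 : 0 <= K.
Hypothesis P0 : P 0.
Hypothesis P_lin : forall a u v, P u -> P v -> P (a *: u + v).
Hypothesis Q_lin : forall a u v, Q u -> Q v -> Q (a *: u + v).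
Hypothesis iotaP : forall u, P u -> Q (iota u).
Hypothesis iota_lin : forall a u v, P u -> P v -> iota (a *: u + v) = a *: iota u + iota v.
Hypothesis f_lin : forall a u v, P u -> P v -> f (a *: u + v) = a *: f u + f v.
Hypothesis ND : forall u v, Q u -> Q v -> N (u + v) <= N u + N v.
Hypothesis NZ : forall a u, Q u -> N (a *: u) = rnorm a * N u.
Hypothesis dense : forall v, Q v -> forall e : R, 0 < e -> exists2 u, P u & N (v - iota u) <= e.
Hypothesis f_le : forall u, P u -> rnorm (f u) <= K * N (iota u).

Let Q_add u v : Q u -> Q v -> Q (u + v).
Proof. by move=> Qu Qv; rewrite -(scale1r u); exact: Q_lin. Qed.

Let Q0 : Q 0.
Proof. by have := Q_lin (-1) (iotaP P0) (iotaP P0); rewrite scaleN1r addNr. Qed.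

Let Q_scale a u : Q u -> Q (a *: u).
Proof. by move=> Qu; rewrite -(addr0 (a *: u)); exact: Q_lin. Qed.

Let Q_opp u : Q u -> Q (- u).
Proof. by move=> Qu; rewrite -scaleN1r; exact: Q_scale. Qed.

Let Q_sub u v : Q u -> Q v -> Q (u - v).
Proof. by move=> Qu Qv; apply: Q_add => //; apply: Q_opp. Qed.

Let NN u : Q u -> N (- u) = N u.
Proof. by move=> Qu; rewrite -scaleN1r NZ// rnormN rnorm1 mul1r. Qed.

Let P_sub u v : P u -> P v -> P (u - v).
Proof. by move=> Pu Pv; rewrite addrC -scaleN1r; exact: P_lin. Qed.

Let iotaB u v : P u -> P v -> iota (u - v) = iota u - iota v.
Proof. by move=> Pu Pv; rewrite addrC -scaleN1r iota_lin// scaleN1r addrC. Qed.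

Let fB u v : P u -> P v -> f (u - v) = f u - f v.
Proof. by move=> Pu Pv; rewrite addrC -scaleN1r f_lin// scaleN1r addrC. Qed.

Let fdist v u u' e e' : Q v -> P u -> P u' -> N (v - iota u) <= e -> N (v - iota u') <= e' ->
  rnorm (f u - f u') <= K * (e + e').
Proof.
move=> Qv Pu Pu' h h'; rewrite -fB//.
apply: (le_trans (f_le (P_sub Pu Pu'))); rewrite ler_wpM2l// iotaB//.
have -> : iota u - iota u' = - (v - iota u) + (v - iota u') by rewrite opprB addrA subrK.
have Qa : Q (v - iota u) by apply: Q_sub => //; exact: iotaP.
have Qb : Q (v - iota u') by apply: Q_sub => //; exact: iotaP.
by apply: (le_trans (ND (Q_opp Qa) Qb)); rewrite NN// lerD.
Qed.

(** The closure of the graph of [f] over [iota]. Boundedness of [f] makes it single-valued on [Q];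
    density and completeness make it total there. *)
Let G v b := forall e : R, 0 < e ->
  exists u, [/\ P u, N (v - iota u) <= e & rnorm (b - f u) <= e].

Let G_uniq v b b' : Q v -> G v b -> G v b' -> b = b'.
Proof.
move=> Qv Gb Gb'; apply/eqP; rewrite -subr_eq0; apply/eqP/rnorm_eq0/eqP.
rewrite eq_le rnorm_ge0 andbT; apply/ler_addgt0Pl => e e0; rewrite addr0.
(* The path from [b] through [f u] and [f u'] to [b'] costs [r + K * (r + r) + r], which is [e]. *)
pose r := e / (2 * (K + 1)).
have K1 : 0 < K + 1 by rewrite ltr_wpDl.
have r0 : 0 < r by rewrite divr_gt0// mulr_gt0.
have [u [Pu Nu bu]] := Gb _ r0; have [u' [Pu' Nu' bu']] := Gb' _ r0.
have h := fdist Qv Pu Pu' Nu Nu'.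
apply: (le_trans (rdist_triangle (f u) _ _)).
apply: (le_trans (lerD (lexx _) (rdist_triangle (f u') _ _))).
rewrite (rdistC (f u') b'); apply: (le_trans (lerD bu (lerD h bu'))).
have -> : e = r * (2 * (K + 1)) by rewrite divfK// gt_eqF// mulr_gt0.
by move: r {r0 Nu bu Nu' bu' h} => r; lra.
Qed.

Let G_ex v : Q v -> exists b, G v b.
Proof.
move=> Qv.
have h0 k : 0 < 2^-1 ^+ k :> R by rewrite exprn_gt0.
have /choice[u /all_and2[Pu Nu]] : forall k, exists u, P u /\ N (v - iota u) <= 2^-1 ^+ k.
  by move=> k; have [u Pu Nu] := dense Qv (h0 k); exists u.
have small (e : R) : 0 < e -> exists n, forall m, (n <= m)%N -> 2^-1 ^+ m <= e.
  move=> e0; have /cvgrPdist_le/(_ _ e0)[n _ hn] : (fun k => 2^-1 ^+ k : R) @ \oo --> (0 : R).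
    by apply: cvg_expr; rewrite ger0_norm// invf_lt1// ltr1n.
  exists n => m nm; have := hn m nm; rewrite sub0r normrN; apply: le_trans.
  exact: ler_norm.
have K1 : 0 < 2 * (K + 1) by rewrite mulr_gt0// ltr_wpDl.
have [|b hb] := @complete_rcvg B (f \o u).
  move=> e e0; have [n hn] := small (e / (2 * (K + 1))) (divr_gt0 e0 K1).
  exists n => m m' nm nm' /=.
  apply: (le_trans (fdist Qv (Pu m) (Pu m') (le_trans (Nu m) (hn _ nm)) (le_trans (Nu m')
    (hn _ nm')))).
  have -> : K * (e / (2 * (K + 1)) + e / (2 * (K + 1))) = K / (K + 1) * e.
    by field; rewrite gt_eqF// ltr_wpDl.
  rewrite ler_piMl// ?(ltW e0)// ler_pdivrMr ?mul1r ?lerDl// ltr_wpDl//.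
exists b => e e0.
have [n hn] := small e e0; have [n' hn'] := hb e e0.
exists (u (maxn n n')); split; [exact: Pu| |].
  by apply: (le_trans (Nu _)); apply: hn; rewrite leq_maxl.
by apply: hn'; rewrite leq_maxr.
Qed.

(** The subspaces are given by predicates because the intended domains, functions of a restricted
    kind on X, sit inside plain function spaces; [N] only has to behave as a seminorm on [Q]. *)
Lemma extension : exists F : V -> B,
  [/\ forall u, P u -> F (iota u) = f u,
      forall a u v, Q u -> Q v -> F (a *: u + v) = a *: F u + F v &
      forall v, Q v -> rnorm (F v) <= K * N v].
Proof.
have /choice[F hF] : forall v, exists b, Q v -> G v b.
  move=> v; have [Qv|nQv] := pselect (Q v); last by exists 0.
  by have [b Gb] := G_ex Qv; exists b.
exists F; split.
- move=> u Pu; apply: (G_uniq (iotaP Pu) (hF _ (iotaP Pu))) => e e0.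
  exists u; split=> //; last by rewrite subrr rnorm0 ltW.
  by rewrite subrr -(scale0r 0) NZ// rnorm0 mul0r ltW.
- move=> a u v Qu Qv; have Quv := Q_lin a Qu Qv.
  apply: (G_uniq Quv (hF _ Quv)) => e e0.
  pose r := e / (rnorm a + 1).
  have a1 : 0 < rnorm a + 1 by rewrite ltr_wpDl// rnorm_ge0.
  have r0 : 0 < r by rewrite divr_gt0.
  have er : e = rnorm a * r + r by rewrite -{2}[r]mul1r -mulrDl mulrC divfK// gt_eqF.
  have [u' [Pu' Nu bu]] := hF u Qu _ r0; have [v' [Pv' Nv bv]] := hF v Qv _ r0.
  exists (a *: u' + v'); split; first exact: P_lin.
    rewrite iota_lin// opprD addrACA -scalerBr.
    have Qa : Q (u - iota u') by apply: Q_sub => //; exact: iotaP.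
    have Qb : Q (v - iota v') by apply: Q_sub => //; exact: iotaP.
    apply: (le_trans (ND (Q_scale a Qa) Qb)); rewrite NZ// er lerD//.
    by rewrite ler_wpM2l// rnorm_ge0.
  rewrite f_lin// opprD addrACA -scalerBr.
  apply: (le_trans (rnormD _ _)); rewrite rnormZ er lerD//.
  by rewrite ler_wpM2l// rnorm_ge0.
- move=> v Qv; apply/ler_addgt0Pl => e e0.
  pose r := e / (K + 1).
  have K1 : 0 < K + 1 by rewrite ltr_wpDl.
  have r0 : 0 < r by rewrite divr_gt0.
  have [u [Pu Nu bu]] := hF v Qv _ r0.
  have -> : F v = (F v - f u) + f u by rewrite subrK.
  apply: (le_trans (rnormD _ _)).
  have h : N (iota u) <= N v + r.
    have -> : iota u = v + - (v - iota u) by rewrite opprB addrC subrK.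
    have Qa : Q (v - iota u) by apply: Q_sub => //; exact: iotaP.
    by apply: (le_trans (ND Qv (Q_opp Qa))); rewrite NN// lerD2l.
  apply: (le_trans (lerD bu (le_trans (f_le Pu) (ler_wpM2l K0 h)))).
  have -> : e = r * (K + 1) by rewrite divfK// gt_eqF.
  by move: (N v) r {r0 Nu bu h} => n r; lra.
Qed.

End Extension.

(** * Simple functions *)

Section Simple.
Variables (R : realType) (d : measure_display) (T : measurableType d).
Variables (nu : {measure set T -> \bar R}) (p : R) (p1 : 1 <= p).
Local Notation C := R[i].
Implicit Types k : T -> C.

Let p0 : 0 < p. Proof. exact: lt_le_trans p1. Qed.

(** With a finite range it costs nothing to ask for measurable preimages of arbitrary sets, and no
    sigma-algebra on the complex numbers has to be chosen. *)
Definition simple k :=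
  [/\ finite_set (range k), forall A : set C, measurable (k @^-1` A) &
      (nu [set t | (k t != 0)%R] < +oo)%E].

Lemma simple0 : simple (fun=> 0).
Proof.
split.
- by apply: (@sub_finite_set _ _ [set 0]) => // _ [t _ <-].
- by move=> A; rewrite preimage_cst; case: ifP.
by rewrite (_ : [set _ | _] = set0) ?measure0 ?ltry//; apply/seteqP; split=> t //=; rewrite eqxx.
Qed.

Lemma simple_lin (a : C) k k' : simple k -> simple k' -> simple (fun t => a * k t + k' t).
Proof.
move=> [fk mk nk] [fk' mk' nk'].
have fin2 : finite_set (range k `*` range k') by exact: finite_setX.
have E (A : set C) : (fun t => a * k t + k' t) @^-1` A =
    \bigcup_(c in (range k `*` range k') `&` [set c | A (a * c.1 + c.2)])
      (k @^-1` [set c.1] `&` k' @^-1` [set c.2]).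
  apply/seteqP; split=> [t At|t [[c c'] /= [_ Ac] [kc kc']]]; last by rewrite /preimage/= kc kc'.
  by exists (k t, k' t) => //; split.
split.
- apply: (@sub_finite_set _ _ ((fun c => a * c.1 + c.2) @` (range k `*` range k'))).
    by move=> _ [t _ <-]; exists (k t, k' t) => //; split.
  exact: finite_image.
- move=> A; rewrite E; apply: fin_bigcup_measurable; first exact: finite_setIl.
  by move=> c _; apply: measurableI; [exact: mk|exact: mk'].
have mN : measurable [set t | k t != 0] by apply: (mk [set c | c != 0]).
have mN' : measurable [set t | k' t != 0] by apply: (mk' [set c | c != 0]).
apply: (@le_lt_trans _ _ (nu ([set t | k t != 0%R] `|` [set t | k' t != 0%R]))).
  apply: le_measure; rewrite ?inE.
  - rewrite (_ : [set _ | _] = (fun t => a * k t + k' t) @^-1` [set c | c != 0])// E.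
    apply: fin_bigcup_measurable; first exact: finite_setIl.
    by move=> c _; apply: measurableI; [exact: mk|exact: mk'].
  - exact: measurableU.
  move=> t /=; have [->|] := eqVneq (k t) 0; last by left.
  by rewrite mulr0 add0r; right.
by apply: (le_lt_trans (measureU2 nu mN mN')); rewrite lte_add_pinfty.
Qed.

Lemma simple_cmeasurable k : simple k -> cmeasurable k.
Proof.
move=> [_ mk _]; split=> _ Y mY; rewrite setTI.
  exact: (mk [set c | Y (complex.Re c)]).
exact: (mk [set c | Y (complex.Im c)]).
Qed.

Lemma simple_fiber k c : simple k -> c != 0 ->
  measurable (k @^-1` [set c]) /\ (nu (k @^-1` [set c]) < +oo)%E.
Proof.
move=> [_ mk nk] c0; split; first exact: mk.
apply: le_lt_trans nk; apply: le_measure; rewrite ?inE; first exact: mk.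
  exact: (mk [set c | c != 0]).
by move=> t /= ->.
Qed.

(** Only nonzero values are summed: the fibre of 0 may have infinite measure, where [fine] would be
    meaningless. The list [r] may be larger than the range, so that one list can serve a whole
    family of functions. *)
Lemma Ip_simple (r : seq C) k : uniq r -> (forall t, k t \in r) -> simple k ->
  Ip nu p k = (\sum_(c <- r | c != 0) (rnorm c `^ p * fine (nu (k @^-1` [set c]))))%:E.
Proof.
move=> ur kr sk; rewrite IpE.
have E t : (rnorm (k t) `^ p)%:E =
    (\sum_(c <- r | c != 0%R) ((rnorm c `^ p)%:E * (\1_(k @^-1` [set c]) t)%:E))%E.
  have ind0 c : k t != c -> \1_(k @^-1` [set c]) t = 0 :> R.
    by move=> kc; rewrite indicE memNset// => /= kc'; rewrite kc' eqxx in kc.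
  have [kt0|kt0] := eqVneq (k t) 0.
    rewrite kt0 rnorm0 powR0 ?gt_eqF// big1// => c c0; rewrite ind0 ?mule0//.
    by rewrite kt0 eq_sym.
  rewrite -big_filter (bigD1_seq (k t)) ?mem_filter ?kt0 ?kr ?filter_uniq//=.
  rewrite big1 ?addr0; first by rewrite indicE mem_set// mule1.
  by move=> c ck; rewrite ind0 ?mule0// eq_sym.
under eq_integral do rewrite E -big_filter.
have mi c : c != 0 -> measurable_fun setT (fun t => (rnorm c `^ p)%:E * (\1_(k @^-1` [set c])
  t)%:E)%E.
  move=> c0; apply/measurable_EFinP; apply: measurable_funM => //.
  by apply: measurable_indic; exact: (simple_fiber sk c0).1.
have i0 c t : (0 <= (rnorm c `^ p)%:E * (\1_(k @^-1` [set c]) t)%:E :> \bar R)%E.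
  by rewrite mule_ge0// lee_fin ?powR_ge0.
pose g c t := if c != 0 then ((rnorm c `^ p)%:E * (\1_(k @^-1` [set c]) t)%:E)%E else 0%E.
have Eg t : (\sum_(c <- [seq c <- r | c != 0%R])
  ((rnorm c `^ p)%:E * (\1_(k @^-1` [set c]) t)%:E))%E
   = (\sum_(c <- r) g c t)%E.
  by rewrite big_filter big_mkcond.
under eq_integral do rewrite Eg.
rewrite ge0_integral_sum//; last 2 first.
- by move=> c; rewrite /g; case: eqP => [//|/eqP]; exact: mi.
- by move=> c t _; rewrite /g; case: ifP => // _; exact: i0.
rewrite -sumEFin [RHS]big_mkcond/=; apply: eq_bigr => c _; rewrite /g.
case: ifP => c0; last by rewrite integral0.
have [mc fc] := simple_fiber sk c0.
rewrite ge0_integralZl//; last 2 first.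
- by apply/measurable_EFinP; exact: measurable_indic.
- by rewrite lee_fin powR_ge0.
by rewrite integral_indic// setIT EFinM fineK// ge0_fin_numE.
Qed.

Lemma simple_range k : simple k -> exists2 r : seq C, uniq r & forall t, k t \in r.
Proof.
move=> [fk _ _]; exists (fset_set (range k)); first exact: fset_uniq.
by move=> t; rewrite in_fset_set// inE; exists t.
Qed.

Lemma simple_Lp k : simple k -> Lp_function nu p k.
Proof.
move=> sk; apply/(Lp_functionP nu p1); split; first exact: simple_cmeasurable.
by have [r ur kr] := simple_range sk; rewrite (Ip_simple ur kr sk) ltry.
Qed.

Lemma simple_cind (A : set T) : measurable A -> (nu A < +oo)%E -> simple (cind R A).
Proof.
move=> mA fA; split.
- apply: (@sub_finite_set _ _ [set 0; 1]) => // _ [t _ <-].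
  by rewrite /cind indicE; case: (_ \in _); [right|left].
- move=> D; rewrite (_ : cind R A @^-1` D =
    (if 1 \in D then A else set0) `|` (if 0 \in D then ~` A else set0)).
    by apply: measurableU; case: ifP => // _; exact: measurableC.
  apply/seteqP; split=> t.
    rewrite /preimage/= /cind indicE; have [tA|tA] := boolP (t \in A) => /= Dt.
      by left; rewrite mem_set//; exact/set_mem.
    by right; rewrite mem_set//= => /mem_set tA'; rewrite tA' in tA.
  rewrite /preimage/= /cind indicE => -[]; case: ifPn => // /set_mem Dc.
    by move=> At; rewrite mem_set.
  by move=> nAt; rewrite memNset.
rewrite (_ : [set _ | _] = A)//; apply/seteqP; split=> t /=; rewrite /cind indicE.
  by have [/set_mem//|_] := boolP (t \in A); rewrite eqxx.
by move=> At; rewrite mem_set// oner_eq0.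
Qed.

Lemma lpn_ae (f g : T -> C) : cmeasurable f -> cmeasurable g ->
  {ae nu, forall t, f t = g t} -> lpn nu p f = lpn nu p g.
Proof. by move=> mf mg fg; rewrite !lpnE (Ip_ae p1 mf mg fg). Qed.

Section LpSpace.
Variables (B : completeNormedModType C) (Phi : B -> T -> C).
Hypothesis Phi_Lp : forall b, Lp_function nu p (Phi b).
Hypothesis Phi_lin : forall (a : C) b b',
  {ae nu, forall t, Phi (a *: b + b') t = a * Phi b t + Phi b' t}.
Hypothesis Phi_norm : forall b, 'N[nu]_(p%:E)[EFin \o rnorm \o Phi b]%E = (rnorm b)%:E.
Hypothesis Phi_surj : forall f, Lp_function nu p f ->
  exists b, {ae nu, forall t, Phi b t = f t}.

Let lpn_Phi b : lpn nu p (Phi b) = rnorm b.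
Proof.
have [_ fin] := (Lp_functionP nu p1 _).1 (Phi_Lp b).
by have := Phi_norm b; rewrite (Lnorm_lpn fin) => -[].
Qed.

Let cm b : cmeasurable (Phi b).
Proof. by have [] := (Lp_functionP nu p1 _).1 (Phi_Lp b). Qed.

Lemma Phi_dist b (f : T -> C) b' : cmeasurable f -> {ae nu, forall t, Phi b t = f t} ->
  rnorm (b' - b) = lpn nu p (fun t => Phi b' t - f t).
Proof.
move=> mf bf; rewrite -lpn_Phi; apply: lpn_ae => //; first exact: cmeasurableB.
have := Phi_lin (-1) b b'; rewrite scaleN1r addrC; apply: filterS2 bf => t bt ->.
by rewrite mulN1r addrC bt.
Qed.

(** The inverse of [Phi] on classes of functions, with default 0 off L^p; by [Phi_inj] there is at
    most one candidate. *)
Definition emb (f : T -> C) : B := xget 0 [set b | {ae nu, forall t, Phi b t = f t}].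

Lemma embP f : Lp_function nu p f -> {ae nu, forall t, Phi (emb f) t = f t}.
Proof. by move=> /Phi_surj[b bf]; rewrite /emb; case: xgetP => [_ -> //|/(_ b)]. Qed.

Lemma Phi_inj b b' : {ae nu, forall t, Phi b t = Phi b' t} -> b = b'.
Proof.
move=> bb'; apply/eqP; rewrite -subr_eq0; apply/eqP/rnorm_eq0.
rewrite (Phi_dist b (cm b')); last by apply: filterE.
by rewrite lpn_ae0//; [exact: cmeasurableB|apply: filterS bb' => t ->; rewrite subrr].
Qed.

Lemma emb_lin (a : C) f g : Lp_function nu p f -> Lp_function nu p g ->
  emb (fun t => a * f t + g t) = a *: emb f + emb g.
Proof.
move=> Lf Lg; apply: Phi_inj.
have h1 := embP (Lp_sum p1 (Lp_scale p1 a Lf).1 Lg).1.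
have h2 := embP Lf; have h3 := embP Lg; have h4 := Phi_lin a (emb f) (emb g).
by apply: filterS2 (filterI h1 h4) (filterI h2 h3) => t [-> ->] [-> ->].
Qed.

Lemma emb_norm f : Lp_function nu p f -> rnorm (emb f) = lpn nu p f.
Proof.
move=> Lf; rewrite -lpn_Phi; have [mf _] := (Lp_functionP nu p1 _).1 Lf.
by apply: lpn_ae => //; exact: embP.
Qed.

(** [Lp_density] is applied to the class of L^p functions approximable by simple ones. *)
Lemma simple_dense b (e : R) : 0 < e -> exists2 k, simple k & rnorm (b - emb k) <= e.
Proof.
pose D f := Lp_function nu p f /\ forall e : R, 0 < e ->
  exists2 k, simple k & lpn nu p (fun t => f t - k t) <= e.
suff [_ h] : D (Phi b).
  move=> e0; have [k sk bk] := h e e0; exists k => //.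
  have [mk _] := (Lp_functionP nu p1 _).1 (simple_Lp sk).
  by rewrite (Phi_dist b mk)//; exact: embP (simple_Lp sk).
apply: (Lp_density p1 (D := D)) (Phi_Lp b) => [A mA fA|a f g [Lf Df] [Lg Dg]|f Lf hf].
- split=> [|r r0]; first exact: Lp_cind.
  exists (cind R A); first exact: simple_cind.
  have mA' := cmeasurable_cind R mA.
  rewrite (lpn_ae0 p1 (cmeasurableB mA' mA')); first exact: ltW.
  by apply: filterE => t; rewrite subrr.
- split=> [|r r0]; first exact: (Lp_sum p1 (Lp_scale p1 a Lf).1 Lg).1.
  pose r' := r / (rnorm a + 1).
  have a1 : 0 < rnorm a + 1 by rewrite ltr_wpDl// rnorm_ge0.
  have r'0 : 0 < r' by rewrite divr_gt0.
  have [k sk fk] := Df _ r'0; have [k' sk' gk'] := Dg _ r'0.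
  exists (fun t => a * k t + k' t); first exact: simple_lin.
  have Lfk := Lp_sub p1 Lf (simple_Lp sk).
  have Lgk := Lp_sub p1 Lg (simple_Lp sk').
  have [_] := Lp_sum p1 (Lp_scale p1 a Lfk).1 Lgk.
  rewrite (Lp_scale p1 a Lfk).2.
  under eq_fun do rewrite mulrBr addrACA -opprD.
  move=> /le_trans; apply.
  have -> : r = rnorm a * r' + r' by rewrite -{2}[r']mul1r -mulrDl mulrC divfK// gt_eqF.
  exact: (lerD (ler_wpM2l (rnorm_ge0 a) fk) gk').
- split=> // r r0; have r2 : 0 < r / 2 by rewrite divr_gt0.
  have [g [Lg [_ Dg] fg]] := hf _ r2; have [k sk gk] := Dg _ r2.
  exists k => //; have Lk := simple_Lp sk.
  have [_] := Lp_sum p1 (Lp_sub p1 Lf Lg) (Lp_sub p1 Lg Lk).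
  under eq_fun do rewrite addrA subrK.
  by move=> /le_trans; apply; rewrite [r]splitr; exact: (lerD fg gk).
Qed.

End LpSpace.
End Simple.

(** * Means along an ultrafilter *)

Section Ulim.
Variables (R : realType) (omega : set_system nat) (uomega : UltraFilter omega).

Let pF : ProperFilter omega. Proof. exact: ultra_proper. Qed.
#[local] Existing Instance pF.

Definition ulim (u : nat -> R) : R := lim (u @ omega).

(** The image of an ultrafilter is an ultrafilter; this one contains the compact segment [[-M, M]],
    so it converges. *)
Lemma ulim_cvg (u : nat -> R) (M : R) : (forall n, `|u n| <= M) -> u @ omega --> ulim u.
Proof.
move=> uM; have cM := @segment_compact R (- M) M.
have uF : UltraFilter (u @ omega).
  apply: Build_UltraFilter => G pG sG; apply/seteqP; split=> [A GA|]; last exact: sG.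
  have [//|nA] := in_ultra_setVsetC (u @^-1` A) uomega.
  exfalso; apply: (@filter_not_empty _ G pG); rewrite -(setICr A).
  by apply: filterI => //; apply: sG; exact: nA.
have FM : (u @ omega) `[- M, M]%classic.
  apply: (@filterE _ omega) => n; rewrite /preimage/= in_itv/=.
  by have := uM n; rewrite ler_norml.
have : `[- M, M]%classic `&` [set p | u @ omega --> p] !=set0.
  by move: cM; rewrite compact_ultra; apply.
case=> l [_ ul]; rewrite /ulim; apply: cvgP; exact: ul.
Qed.

Section bounded.
Variables (u v : nat -> R) (M K : R).
Hypothesis uM : forall n, `|u n| <= M.
Hypothesis vK : forall n, `|v n| <= K.

Lemma ulimD : ulim (fun n => u n + v n) = ulim u + ulim v.
Proof. by apply: cvg_lim => //; apply: cvgD; [exact: ulim_cvg uM|exact: ulim_cvg vK]. Qed.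

Lemma ulimZ a : ulim (fun n => a * u n) = a * ulim u.
Proof. by apply: cvg_lim => //; apply: cvgM; [exact: cvg_cst|exact: ulim_cvg uM]. Qed.

Lemma ulim_le : (\forall n \near omega, u n <= v n) -> ulim u <= ulim v.
Proof. by apply: ler_cvg_to; [exact: ulim_cvg uM|exact: ulim_cvg vK]. Qed.

End bounded.

Lemma ulim_cst c : ulim (fun=> c) = c.
Proof. by apply: cvg_lim => //; exact: cvg_cst. Qed.

End Ulim.

Section Mean.
Variables (R : realType) (omega : set_system nat) (uomega : UltraFilter omega).
Variables (X : choiceType) (tg : X -> nat) (en : nat -> seq X).
Hypothesis en_uniq : forall n, uniq (en n).
Hypothesis en_mem : forall n x, (x \in en n) = (tg x == n).
Hypothesis en_ne : forall n, (0 < size (en n))%N.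

Let pF : ProperFilter omega. Proof. exact: ultra_proper. Qed.
#[local] Existing Instance pF.
Implicit Types phi psi : X -> R.

Definition most (P : X -> Prop) := \forall n \near omega, forall x, tg x = n -> P x.

Definition bdd phi := exists M : R, forall x, `|phi x| <= M.

Definition avg phi n : R := (size (en n))%:R^-1 * \sum_(x <- en n) phi x.

Definition mean phi : R := ulim omega (avg phi).

Let en_size n : 0 < (size (en n))%:R :> R.
Proof. by rewrite ltr0n. Qed.

Lemma avg_bound phi (M : R) n : (forall x, `|phi x| <= M) -> `|avg phi n| <= M.
Proof.
move=> pM; rewrite normrM ger0_norm ?invr_ge0 ?ler0n// ler_pdivrMl//.
apply: (le_trans (ler_norm_sum _ _ _)); apply: (le_trans (ler_sum _ (fun x _ => pM x))).
by rewrite big_const_seq count_predT iter_addr_0 mulr_natl.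
Qed.

Lemma mean_lin a phi psi : bdd phi -> bdd psi ->
  mean (fun x => a * phi x + psi x) = a * mean phi + mean psi.
Proof.
move=> [M pM] [K pK]; rewrite /mean.
have hM n := avg_bound n pM; have hK n := avg_bound n pK.
have haM n : `|a * avg phi n| <= `|a| * M by rewrite normrM ler_wpM2l.
rewrite -(ulimZ uomega hM) -(ulimD uomega haM hK); congr ulim; apply/funext => n.
by rewrite /avg big_split/= mulrDr -mulr_sumr mulrCA.
Qed.

Lemma mean_le phi psi : bdd phi -> bdd psi -> most (fun x => phi x <= psi x) ->
  mean phi <= mean psi.
Proof.
move=> [M pM] [K pK] h; apply: (ulim_le uomega (fun n => avg_bound n pM) (fun n => avg_bound n pK)).
apply: (@filterS _ omega _ _ _ _ h) => n hn; rewrite /avg ler_wpM2l ?invr_ge0 ?ler0n//.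
rewrite big_seq [leRHS]big_seq; apply: ler_sum => x.
by rewrite en_mem => /eqP; exact: hn.
Qed.

Lemma mean_cst c : mean (fun=> c) = c.
Proof.
rewrite /mean (_ : avg _ = fun=> c) ?ulim_cst//; apply/funext => n.
rewrite /avg big_const_seq count_predT iter_addr_0 -[c *+ _]mulr_natl mulKf//.
by rewrite gt_eqF.
Qed.

Lemma mean_ge0 phi : bdd phi -> (forall x, 0 <= phi x) -> 0 <= mean phi.
Proof.
move=> bphi p0; rewrite -(mean_cst 0); apply: mean_le => //.
  by exists 0 => x; rewrite normr0.
by apply: (@filterE _ omega) => n x _.
Qed.

Lemma mean_sum (I : Type) (r : seq I) (P : pred I) (F : I -> X -> R) :
  (forall i, P i -> bdd (F i)) ->
  bdd (fun x => \sum_(i <- r | P i) F i x) /\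
  mean (fun x => \sum_(i <- r | P i) F i x) = \sum_(i <- r | P i) mean (F i).
Proof.
move=> bF; elim: r => [|i r [IH1 IH2]].
  under eq_fun do rewrite big_nil; rewrite big_nil mean_cst; split=> //.
  by exists 0 => x; rewrite normr0.
under eq_fun do rewrite big_cons; rewrite big_cons; case Pi : (P i) => //.
split.
  have [M hM] := bF i Pi; have [K hK] := IH1; exists (M + K) => x.
  by rewrite (le_trans (ler_normD _ _))// lerD.
have := mean_lin 1 (bF i Pi) IH1; rewrite mul1r IH2 => <-.
by congr mean; apply/funext => x; rewrite mul1r.
Qed.

Lemma bddZ a phi : bdd phi -> bdd (fun x => a * phi x).
Proof. by move=> [M pM]; exists (`|a| * M) => x; rewrite normrM ler_wpM2l. Qed.

Lemma meanZ a phi : bdd phi -> mean (fun x => a * phi x) = a * mean phi.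
Proof.
move=> [M pM]; rewrite /mean -(ulimZ uomega (fun n => avg_bound n pM)).
by congr ulim; apply/funext => n; rewrite /avg -mulr_sumr mulrCA.
Qed.

(** On each piece the left-hand sum runs over the distinct points [f x], hence over part of the
    right-hand sum. This is what makes partial translations contractive in the limit space. *)
Lemma mean_inj (A : set X) (f : X -> X) phi : (forall x, 0 <= phi x) -> bdd phi ->
  (forall x, A x -> tg (f x) = tg x) ->
  (forall x y, A x -> A y -> f x = f y -> x = y) ->
  mean (fun x => \1_A x * phi (f x)) <= mean phi.
Proof.
move=> p0 bphi ft finj.
have b1 : bdd (fun x => \1_A x * phi (f x)).
  have [M pM] := bphi; exists M => x; rewrite normrM indicE.
  by case: (_ \in _); rewrite ?normr1 ?mul1r// normr0 mul0r (le_trans _ (pM x)).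
have [M pM] := bphi; have [K pK] := b1.
apply: (ulim_le uomega (fun n => avg_bound n pK) (fun n => avg_bound n pM)).
apply: filterE => n; rewrite /avg ler_wpM2l ?invr_ge0 ?ler0n//.
rewrite (eq_bigr (fun x => if x \in A then phi (f x) else 0)); last first.
  by move=> x _; rewrite indicE; case: (_ \in _); rewrite ?mul1r ?mul0r.
rewrite -big_mkcond -big_filter -(big_map f predT phi).
set s := map f _.
have us : uniq s.
  rewrite map_inj_in_uniq ?filter_uniq// => x y; rewrite !mem_filter.
  by move=> /andP[/set_mem Ax _] /andP[/set_mem Ay _]; exact: finj.
have ss : {subset s <= en n}.
  move=> _ /mapP[x + ->]; rewrite mem_filter !en_mem => /andP[/set_mem Ax /eqP <-].
  by rewrite ft.
rewrite [leRHS](bigID (mem s))/= -[X in _ <= X + _]big_filter.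
have h : perm_eq [seq x <- en n | x \in s] s.
  apply: uniq_perm => //; first exact: filter_uniq.
  by move=> x; rewrite mem_filter; case: (boolP (x \in s)) => // /ss ->.
by rewrite (perm_big _ h)/= lerDl sumr_ge0.
Qed.

End Mean.

(** * The space of vector-valued functions modulo null functions *)

Lemma powR_lip_abs (R : realType) (p a b M : R) : 1 <= p -> 0 <= a -> 0 <= b ->
  a <= M -> b <= M -> `|a `^ p - b `^ p| <= `|a - b| * (M + 1) `^ p.
Proof.
move=> p1; have p0 : 0 <= p := le_trans ler01 p1.
have lip x y : 0 <= x -> x <= y -> y <= M -> `|y `^ p - x `^ p| <= `|y - x| * (M + 1) `^ p.
  move=> x0 xy yM.
  have xy' : x `^ p <= y `^ p by apply: ge0_ler_powR; rewrite ?nnegrE//; exact: le_trans xy.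
  by rewrite ger0_norm ?subr_ge0// ger0_norm ?subr_ge0//; exact: powR_lip.
move=> a0 b0 aM bM; have [ab|/ltW ab] := leP a b; last exact: lip.
by rewrite distrC (distrC a); exact: lip.
Qed.

Lemma finite_range2 (A B1 B2 D : Type) (op : B1 -> B2 -> D) (f : A -> B1) (g : A -> B2) :
  finite_set (range f) -> finite_set (range g) -> finite_set (range (fun x => op (f x) (g x))).
Proof.
move=> ff fg; apply: (@sub_finite_set _ _ ((fun z => op z.1 z.2) @` (range f `*` range g))).
  by move=> _ [x _ <-]; exists (f x, g x) => //; split.
by apply: finite_image; exact: finite_setX.
Qed.

Lemma finite_range1 (A B D : Type) (op : B -> D) (f : A -> B) :
  finite_set (range f) -> finite_set (range (fun x => op (f x))).
Proof.
move=> ff; apply: (@sub_finite_set _ _ (op @` (range f))); last exact: finite_image.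
by move=> _ [x _ <-]; exists (f x).
Qed.

Lemma bdd_finite (R : realType) (X : choiceType) (phi : X -> R) :
  finite_set (range phi) -> bdd phi.
Proof.
move=> fphi; exists (\sum_(y <- fset_set (range phi)) `|y|) => x.
have : phi x \in fset_set (range phi) by rewrite in_fset_set// inE; exists x.
by move=> px; rewrite (bigD1_seq (phi x)) ?fset_uniq//= lerDl sumr_ge0.
Qed.

Lemma ultra_finite (Y : Type) (C : choiceType) (U : set_system Y) (g : Y -> C) (r : seq C) :
  UltraFilter U -> (forall y, g y \in r) -> exists2 c, c \in r & U [set y | g y = c].
Proof.
move=> uU gr; have pU := @ultra_proper _ _ uU.
have : U [set y | g y \in r] by apply: filterE.
elim: r {gr} => [|c r IH] h.
  by exfalso; apply: (@filter_not_empty _ U); apply: filterS h => y.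
have [Uc|Unc] := in_ultra_setVsetC [set y | g y = c] uU.
  by exists c; rewrite ?mem_head.
have [|c' cr Uc'] := IH.
  by apply: filterS (filterI h Unc) => y /= []; rewrite inE => /orP[/eqP|].
by exists c'; rewrite // inE cr orbT.
Qed.

Section BochnerSpace.
Variables (R : realType) (p : R) (p1 : 1 <= p).
Variables (omega : set_system nat) (uomega : UltraFilter omega).
Variables (X : choiceType) (tg : X -> nat) (en : nat -> seq X).
Hypothesis en_uniq : forall n, uniq (en n).
Hypothesis en_mem : forall n x, (x \in en n) = (tg x == n).
Hypothesis en_ne : forall n, (0 < size (en n))%N.
Local Notation C := R[i].
Local Notation mean := (mean omega en).

Let p0 : 0 < p. Proof. exact: lt_le_trans p1. Qed.

Section unif_simple.
Variable B : normedModType C.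
Implicit Types xi eta : X -> B.

(** The uniform closure of the finitely valued functions: finite values alone would be lost on
    multiplying by the coefficients of elements of C_u[X], which may take infinitely many values. *)
Definition unif_simple xi := forall e : R, 0 < e ->
  exists2 s : X -> B, finite_set (range s) & forall x, rnorm (xi x - s x) <= e.

Lemma unif_simple_finite xi : finite_set (range xi) -> unif_simple xi.
Proof. by move=> fxi e e0; exists xi => // x; rewrite subrr rnorm0 ltW. Qed.

Lemma unif_simple_bdd xi : unif_simple xi -> bdd (fun x => rnorm (xi x)).
Proof.
move=> /(_ 1 ltr01)[s fs hs].
have [M hM] : bdd (fun x => rnorm (s x)) by apply: bdd_finite; exact: finite_range1.
exists (1 + M) => x; rewrite ger0_norm ?rnorm_ge0// -(subrK (s x) (xi x)).
apply: (le_trans (rnormD _ _)); apply: lerD => //.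
by apply: le_trans (hM x); exact: ler_norm.
Qed.

Lemma unif_simple_lin a xi eta : unif_simple xi -> unif_simple eta ->
  unif_simple (fun x => a *: xi x + eta x).
Proof.
move=> Sxi Seta e e0.
pose r := e / (rnorm a + 1).
have a1 : 0 < rnorm a + 1 by rewrite ltr_wpDl// rnorm_ge0.
have r0 : 0 < r by rewrite divr_gt0.
have [s fs hs] := Sxi r r0; have [s' fs' hs'] := Seta r r0.
exists (fun x => a *: s x + s' x).
  by apply: (@finite_range2 _ _ _ _ (fun u v => a *: u + v)).
move=> x; rewrite opprD addrACA -scalerBr (le_trans (rnormD _ _))// rnormZ.
have -> : e = rnorm a * r + r by rewrite -{2}[r]mul1r -mulrDl mulrC divfK// gt_eqF.
by rewrite lerD// ler_wpM2l// rnorm_ge0.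
Qed.

Definition supn xi : R := sup (range (fun x => rnorm (xi x))).

Let X0 : exists x : X, True.
Proof.
have := en_ne 0; case E : (en 0) => [//|x s] _; by exists x.
Qed.

Lemma supn_ub xi x : bdd (fun x => rnorm (xi x)) -> rnorm (xi x) <= supn xi.
Proof.
move=> [M hM]; apply: ub_le_sup; last by exists x.
by exists M => _ [y _ <-]; apply: le_trans (hM y); exact: ler_norm.
Qed.

Lemma supn_le xi M : (forall x, rnorm (xi x) <= M) -> supn xi <= M.
Proof.
move=> h; apply: ge_sup; last by move=> _ [y _ <-].
by have [x _] := X0; exists (rnorm (xi x)), x.
Qed.

Lemma supn_ge0 xi : bdd (fun x => rnorm (xi x)) -> 0 <= supn xi.
Proof. by have [x _] := X0 => /(supn_ub x); apply: le_trans; exact: rnorm_ge0. Qed.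

End unif_simple.

(** * Realizing the space of vector-valued functions as an L^p space *)

Section Representation.
Variables (d : measure_display) (T : measurableType d) (nu : {measure set T -> \bar R}).
Variables (B : completeNormedModType C) (Phi : B -> T -> C).
Hypothesis Phi_Lp : forall b, Lp_function nu p (Phi b).
Hypothesis Phi_lin : forall (a : C) b b',
  {ae nu, forall t, Phi (a *: b + b') t = a * Phi b t + Phi b' t}.
Hypothesis Phi_norm : forall b, 'N[nu]_(p%:E)[EFin \o rnorm \o Phi b]%E = (rnorm b)%:E.
Hypothesis Phi_surj : forall f, Lp_function nu p f ->
  exists b, {ae nu, forall t, Phi b t = f t}.

Definition slice (E : set (X * T)) (x : X) : set T := [set t | E (x, t)].

(** Finitely many distinct slices, each of finite measure, make the measure of the slice at [x] a
    bounded function of [x], to which [mean] applies additively. *)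
Definition slice_ring (E : set (X * T)) := finite_set (range (slice E)) /\
  forall x, measurable (slice E x) /\ (nu (slice E x) < +oo)%E.

Definition XT_content (E : set (X * T)) : R := mean (fun x => fine (nu (slice E x))).

Lemma slice_ring_op (op : set T -> set T -> set T) (E F G : set (X * T)) :
  (forall x, slice G x = op (slice E x) (slice F x)) ->
  (forall A B, measurable A -> measurable B -> measurable (op A B) /\ op A B `<=` A `|` B) ->
  slice_ring E -> slice_ring F -> slice_ring G.
Proof.
move=> HG Hop [fE rE] [fF rF]; split.
  rewrite (_ : slice G = fun x => op (slice E x) (slice F x)); last exact/funext.
  exact: finite_range2.
move=> x; rewrite HG; have [mE nE] := rE x; have [mF nF] := rF x.
have [mG sG] := Hop _ _ mE mF; split=> //.
apply: (@le_lt_trans _ _ (nu (slice E x `|` slice F x))).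
  by apply: le_measure; rewrite ?inE//; exact: measurableU.
by apply: (le_lt_trans (measureU2 nu mE mF)); rewrite lte_add_pinfty.
Qed.

Lemma slice_ring0 : slice_ring set0.
Proof.
split; last by move=> x; rewrite (_ : slice _ _ = set0)// measure0.
by apply: (@sub_finite_set _ _ [set set0]) => // _ [x _ <-].
Qed.

Lemma slice_ringU E F : slice_ring E -> slice_ring F -> slice_ring (E `|` F).
Proof.
apply: (@slice_ring_op (fun A B => A `|` B)) => // A A' mA mA'; split=> //.
exact: measurableU.
Qed.

Lemma slice_ringD E F : slice_ring E -> slice_ring F -> slice_ring (E `\` F).
Proof.
apply: (@slice_ring_op (fun A B => A `\` B)) => // A A' mA mA'; split.
  exact: measurableD.
by move=> t [At _]; left.
Qed.

Let bdd_nu E : slice_ring E -> bdd (fun x => fine (nu (slice E x))).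
Proof. by move=> [fE _]; apply: bdd_finite; exact: (finite_range1 (fun A => fine (nu A))). Qed.

Lemma XT_content_ge0 E : slice_ring E -> 0 <= XT_content E.
Proof.
by move=> rE; apply: (mean_ge0 uomega en_mem en_ne (bdd_nu rE)) => x; rewrite fine_ge0.
Qed.

Lemma XT_contentU E F : slice_ring E -> slice_ring F -> E `&` F = set0 ->
  XT_content (E `|` F) = XT_content E + XT_content F.
Proof.
move=> rE rF EF; rewrite -[in RHS](mul1r (XT_content E)) -mean_lin//; try exact: bdd_nu.
congr mean; apply/funext => x; rewrite mul1r.
have [mE nE] := rE.2 x; have [mF nF] := rF.2 x.
have -> : slice (E `|` F) x = slice E x `|` slice F x by [].
rewrite measureU// ?fineD ?ge0_fin_numE//.
by rewrite -subset0 => t [Et Ft]; have : (E `&` F) (x, t) by []; rewrite EF.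
Qed.

Definition XT : ring_content R (X * T) :=
  RingContent slice_ring0 slice_ringU slice_ringD XT_content_ge0 XT_contentU.

Local Notation Om := (stoneT XT).
Local Notation lam := (stone_measure XT).
Implicit Types h : X -> T -> C.

Definition slice_simple h := finite_set (range h) /\ forall x, simple nu (h x).

Definition fib h (c : C) : set (X * T) := [set y | h y.1 y.2 = c].

Lemma slice_simple_range h : slice_simple h -> exists2 r : seq C, uniq r & forall x t, h x t \in r.
Proof.
move=> [fh sh].
have fr : finite_set (\bigcup_(k in range h) range k).
  by apply: bigcup_finite => // _ [x _ <-]; have [] := sh x.
exists (fset_set (\bigcup_(k in range h) range k)); first exact: fset_uniq.
move=> x t; rewrite in_fset_set// inE; exists (h x); first by exists x.
by exists t.
Qed.

Lemma slice_simple_fib h c : slice_simple h -> c != 0 -> slice_ring (fib h c).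
Proof.
move=> [fh sh] c0; split; first exact: (finite_range1 (fun k => [set t | k t = c]) fh).
by move=> x; exact: (simple_fiber (sh x) c0).
Qed.

(** The limit of [h] along the ultrafilter [U], that is, the value [h] takes on a set of [U]; 0 at
    points that are not ultrafilters. *)
Definition jfun h : Om -> C := fun U => xget 0 [set c | UltraFilter U /\ U (fib h c)].

Lemma jfunP h U : slice_simple h -> UltraFilter U -> U (fib h (jfun h U)).
Proof.
move=> Sh uU; have [r _ hr] := slice_simple_range Sh.
have [c _ Uc] := @ultra_finite _ _ _ (fun y : X * T => h y.1 y.2) r uU (fun y => hr _ _).
by rewrite /jfun; case: xgetP => [_ -> []//|/(_ c)[]].
Qed.

Lemma jfunE h U c : slice_simple h -> UltraFilter U -> U (fib h c) -> jfun h U = c.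
Proof.
move=> Sh uU Uc; have pU := @ultra_proper _ _ uU.
have [y [/= <- <-//]] := filter_ex (filterI Uc (jfunP Sh uU)).
Qed.

Lemma jfun_nultra h U : ~ UltraFilter U -> jfun h U = 0.
Proof. by move=> nu'; rewrite /jfun; case: xgetP => // c _ []. Qed.

Lemma jfun_fib h c : slice_simple h -> c != 0 -> jfun h @^-1` [set c] = stone_set (fib h c).
Proof.
move=> Sh c0; apply/seteqP; split=> U.
  move=> /= jc; have [uU|nU] := pselect (UltraFilter U).
    by split=> //; rewrite -jc; exact: jfunP.
  by move: c0; rewrite -jc jfun_nultra// eqxx.
by move=> [uU Uc]; exact: jfunE.
Qed.

Lemma slice_simple_lin (a : C) h h' : slice_simple h -> slice_simple h' ->
  slice_simple (fun x t => a * h x t + h' x t).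
Proof.
move=> [fh sh] [fh' sh']; split.
  exact: (finite_range2 (fun k k' : T -> C => fun t => a * k t + k' t)).
by move=> x; exact: simple_lin.
Qed.

Lemma jfun_lin (a : C) h h' : slice_simple h -> slice_simple h' ->
  jfun (fun x t => a * h x t + h' x t) = fun U => a * jfun h U + jfun h' U.
Proof.
move=> Sh Sh'; apply/funext => U.
have [uU|nU] := pselect (UltraFilter U); last by rewrite !jfun_nultra// mulr0 addr0.
apply: jfunE => //; first exact: slice_simple_lin.
have pU := @ultra_proper _ _ uU.
by apply: filterS (filterI (jfunP Sh uU) (jfunP Sh' uU)) => y [/= <- <-].
Qed.

Lemma jfun_range h (r : seq C) : slice_simple h -> (forall x t, h x t \in r) -> 0 \in r ->
  forall U, jfun h U \in r.
Proof.
move=> Sh hr r0 U; have [uU|nU] := pselect (UltraFilter U); last by rewrite jfun_nultra.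
have pU := @ultra_proper _ _ uU.
by have [y <-] := filter_ex (jfunP Sh uU); exact: hr.
Qed.

Lemma slice_simple_range0 h : slice_simple h -> exists r : seq C,
  [/\ uniq r, forall x t, h x t \in r & 0 \in r].
Proof.
move=> /slice_simple_range[r _ hr]; exists (undup (0 :: r)); rewrite undup_uniq mem_undup mem_head.
by split=> // x t; rewrite mem_undup inE hr orbT.
Qed.

(** Fibres over nonzero values come from the ring. The fibre of 0 also contains the points that are
    not ultrafilters, and is obtained as the complement of the finitely many others. *)
Lemma jfun_simple h : slice_simple h -> simple lam (jfun h).
Proof.
move=> Sh; have [r [ur hr r0]] := slice_simple_range0 Sh; have jr := jfun_range Sh hr r0.
have mfib c : measurable (jfun h @^-1` [set c] : set Om).
  have [->|c0] := eqVneq c 0; last first.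
    by rewrite jfun_fib//; apply: stone_set_measurable; exact: slice_simple_fib.
  rewrite (_ : _ @^-1` _ = ~` \bigcup_(c in [set c | c \in r /\ c != 0]) (jfun h @^-1` [set c])).
    apply: measurableC; apply: fin_bigcup_measurable.
      apply: (@sub_finite_set _ _ [set` r]); last exact: finite_seq.
      by move=> c' [].
    move=> c' [_ c'0]; rewrite jfun_fib//.
    by apply: stone_set_measurable; exact: slice_simple_fib.
  apply/seteqP; split=> U /=.
    by move=> j0 [c' [_ c'0] /= jc']; rewrite -jc' j0 eqxx in c'0.
  by move=> nj; apply/eqP/negPn/negP => j0; apply: nj; exists (jfun h U).
split.
- apply: (@sub_finite_set _ _ [set` r]); last exact: finite_seq.
  by move=> _ [U _ <-] /=.
- move=> A; rewrite (_ : _ @^-1` A = \bigcup_(c in [set c | c \in r /\ A c])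
  (jfun h @^-1` [set c])).
    apply: fin_bigcup_measurable; last by move=> c _.
    by apply: (@sub_finite_set _ _ [set` r]); [move=> c []|exact: finite_seq].
  apply/seteqP; split=> [U AU|U [c [_ Ac] jc]]; last by rewrite /preimage/= (jc : jfun h U = c).
  by exists (jfun h U).
have -> : [set U | jfun h U != 0] = stone_set (\bigcup_(c in [set c | c \in r /\ c != 0]) fib h c).
  apply/seteqP; split=> U /=.
    move=> j0; have [uU|nU] := pselect (UltraFilter U); last by rewrite jfun_nultra// eqxx in j0.
    have pU := @ultra_proper _ _ uU; split=> //.
    by apply: filterS (jfunP Sh uU) => y hy; exists (jfun h U).
  move=> [uU Uc]; apply/eqP => j0; have pU := @ultra_proper _ _ uU.
  have [y [[c [_ c0] hc] h0]] := filter_ex (filterI Uc (jfunP Sh uU)).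
  by move: c0; rewrite -hc h0 j0 eqxx.
rewrite stone_measureE ?ltry//.
have -> : [set c | c \in r /\ c != 0] = [set` [seq c <- r | c != 0]].
  apply/seteqP; split=> c /=; rewrite mem_filter; first by move=> [-> ->].
  by move=> /andP[].
elim: (r) => [|c s IH].
  rewrite (_ : \bigcup_(_ in _) _ = set0); first exact: slice_ring0.
  by rewrite -subset0 => y [].
rewrite /=; case: ifPn => // c0.
rewrite (_ : \bigcup_(_ in _) _ = fib h c `|` \bigcup_(c in [set` [seq c <- s | c != 0]]) fib h c).
  by apply: slice_ringU => //; exact: slice_simple_fib.
apply/seteqP; split=> y.
  by move=> [c' /=]; rewrite inE => /predU1P[->|c's hc']; [left|right; exists c'].
by move=> [hc|[c' c's hc']]; [exists c; rewrite //= mem_head|exists c'; rewrite //= inE c's orbT].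
Qed.

Let fineIp h x : slice_simple h -> fine (Ip nu p (h x)) = rnorm (emb nu Phi (h x)) `^ p.
Proof.
move=> [_ sh]; rewrite (emb_norm p1 Phi_Lp Phi_norm Phi_surj (simple_Lp p1 (sh x))).
by rewrite lpn_pow.
Qed.

Definition Q0 h : X -> B := fun x => emb nu Phi (h x).

(** Both sides are sums over the nonzero values [c] of [rnorm c ^ p] times a size of [fib h c]: its
    measure on the left, the mean measure of its slices on the right. These agree by construction of
    the measure. *)
Lemma Ip_jfun h : slice_simple h -> fine (Ip lam p (jfun h)) = mean (fun x => rnorm (Q0 h x) `^ p).
Proof.
move=> Sh; have [r [ur hr r0]] := slice_simple_range0 Sh; have jr := jfun_range Sh hr r0.
rewrite (Ip_simple p1 ur jr (jfun_simple Sh))/=.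
have E x : rnorm (Q0 h x) `^ p =
    \sum_(c <- r | c != 0) (rnorm c `^ p * fine (nu (slice (fib h c) x))).
  by rewrite -fineIp// (Ip_simple p1 ur (hr x) (Sh.2 x)).
under [in RHS]eq_fun do rewrite E.
have bc c : c != 0 -> bdd (fun x => fine (nu (slice (fib h c) x))).
  by move=> c0; apply: bdd_nu; exact: slice_simple_fib.
have [_ ->] := mean_sum uomega en_ne (P := fun c => c != 0) (F := fun c x =>
  rnorm c `^ p * fine (nu (slice (fib h c) x))) r (fun c c0 => bddZ (rnorm c `^ p) (bc c c0)).
apply: eq_bigr => c c0; rewrite meanZ//; last exact: bc.
congr (_ * _); rewrite jfun_fib// stone_measureE//; exact: slice_simple_fib.
Qed.

Let BB : completeNormedModType C := Lp_banach lam p1.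
Let embL : (Om -> C) -> BB := emb lam (Lp_repr (mu := lam) (p1 := p1)).
Let J0 h : BB := embL (jfun h).

Let J0_norm h : slice_simple h -> rnorm (J0 h) `^ p = mean (fun x => rnorm (Q0 h x) `^ p).
Proof.
move=> Sh; rewrite -Ip_jfun// /J0 /embL.
rewrite (emb_norm p1 (@Lp_repr_Lp _ _ _ lam p p1) (@Lp_repr_norm _ _ _ lam p p1)
  (@Lp_repr_surj _ _ _ lam p p1) (simple_Lp p1 (jfun_simple Sh))).
by rewrite lpn_pow.
Qed.

Let J0_lin (a : C) h h' : slice_simple h -> slice_simple h' ->
  J0 (fun x t => a * h x t + h' x t) = a *: J0 h + J0 h'.
Proof.
move=> Sh Sh'; rewrite /J0 jfun_lin//.
by apply: (emb_lin p1 (@Lp_repr_Lp _ _ _ lam p p1) (@Lp_repr_lin _ _ _ lam p p1)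
  (@Lp_repr_norm _ _ _ lam p p1) (@Lp_repr_surj _ _ _ lam p p1) a
  (simple_Lp p1 (jfun_simple Sh)) (simple_Lp p1 (jfun_simple Sh'))).
Qed.

Let Q0_lin (a : C) h h' : slice_simple h -> slice_simple h' ->
  Q0 (fun x t => a * h x t + h' x t) = (fun x => a *: Q0 h x + Q0 h' x).
Proof.
move=> Sh Sh'; apply/funext => x.
exact: (emb_lin p1 Phi_Lp Phi_lin Phi_norm Phi_surj a
  (simple_Lp p1 (Sh.2 x)) (simple_Lp p1 (Sh'.2 x))).
Qed.

Let Q0_SS h : slice_simple h -> unif_simple (Q0 h).
Proof. by move=> [fh _]; apply: unif_simple_finite; exact: (finite_range1 (emb nu Phi)). Qed.

Let Q0_dense xi : unif_simple xi -> forall e : R, 0 < e ->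
  exists2 h, slice_simple h & forall x, rnorm (xi x - Q0 h x) <= e.
Proof.
move=> Sxi e e0; have e2 : 0 < e / 2 by rewrite divr_gt0.
have [s fs hs] := Sxi _ e2.
have /choice[k /all_and2[sk hk]] : forall b :
  B, exists k, simple nu k /\ rnorm (b - emb nu Phi k) <= e / 2.
  move=> b; have [k sk hk] := simple_dense p1 Phi_Lp Phi_lin Phi_norm Phi_surj b e2.
  by exists k.
exists (fun x => k (s x)); first by split=> //; exact: finite_range1.
move=> x; apply: (le_trans (rdist_triangle (s x) _ _)); rewrite [e]splitr.
exact: (lerD (hs x) (hk (s x))).
Qed.

Let pow_bdd (phi : X -> R) : (forall x, 0 <= phi x) -> bdd phi -> bdd (fun x => phi x `^ p).
Proof.
move=> phi0 [M hM]; exists (M `^ p) => x; rewrite ger0_norm ?powR_ge0//.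
apply: ge0_ler_powR; rewrite ?nnegrE ?(ltW p0)//.
  exact: le_trans (hM x).
by apply: le_trans (hM x); exact: ler_norm.
Qed.

Let pow_le (a b : R) : 0 <= a -> 0 <= b -> a `^ p <= b `^ p -> a <= b.
Proof.
move=> a0 b0 ab; rewrite leNgt; apply/negP => ba.
have := gt0_ltr_powR p0 _ _ ba; rewrite !nnegrE => /(_ b0 a0).
by rewrite ltNge ab.
Qed.

Let jfun_cind E : slice_ring E ->
  slice_simple (fun x => cind R (slice E x)) /\
  jfun (fun x => cind R (slice E x)) = cind R (stone_set E : set Om).
Proof.
move=> rE; set h := fun x => _.
have Sh : slice_simple h.
  split; first by have /(finite_range1 (fun A : set T => cind R A)) := rE.1.
  by move=> x; have [mE nE] := rE.2 x; exact: simple_cind.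
split=> //; apply/funext => U; have [uU|nU] := pselect (UltraFilter U); last first.
  by rewrite jfun_nultra// /cind indicE memNset// => -[].
have pU := @ultra_proper _ _ uU.
have [UE|UnE] := in_ultra_setVsetC E uU.
  rewrite /cind indicE mem_set//; apply: jfunE => //.
  by apply: filterS UE => -[x t] /= Ext; rewrite /fib/= /h /cind indicE mem_set.
rewrite /cind indicE memNset; last by move=> [_ UE]; exact: ((ultra_notC _ uU).1 UnE UE).
apply: jfunE => //; apply: filterS UnE => -[x t] /= Ext.
by rewrite /fib/= /h /cind indicE memNset.
Qed.

(** [Lp_density] reduces to indicators of sets of finite measure. [stone_approx] replaces such a set
    by one of the ring, up to measure [r ^ p], which is a distance [r] between the indicators. *)
Let J0_dense (b : BB) (e : R) : 0 < e -> exists2 h, slice_simple h & rnorm (b - J0 h) <= e.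
Proof.
pose D f := Lp_function lam p f /\ forall e : R, 0 < e ->
  exists2 h, slice_simple h & lpn lam p (fun t => f t - jfun h t) <= e.
have Lj h : slice_simple h -> Lp_function lam p (jfun h).
  by move=> Sh; apply: simple_Lp => //; exact: jfun_simple.
suff [_ h] : D (Lp_repr b).
  move=> e0; have [k sk bk] := h e e0; exists k; first exact: sk.
  have [mk _] := (Lp_functionP lam p1 _).1 (Lj _ sk).
  rewrite (Phi_dist p1 (@Lp_repr_Lp _ _ _ lam p p1) (@Lp_repr_lin _ _ _ lam p p1)
    (@Lp_repr_norm _ _ _ lam p p1) b mk).
    exact: bk.
  exact: (embP (@Lp_repr_surj _ _ _ lam p p1) (Lj _ sk)).
apply: (Lp_density p1 (D := D)) (Lp_repr_Lp b) => [A mA fA|a f g [Lf Df] [Lg Dg]|f Lf hf].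
- split=> [|r r0]; first exact: Lp_cind.
  have [E rE hE] := stone_approx mA fA (powR_gt0 p r0).
  have [Sh jE] := jfun_cind rE; exists (fun x => cind R (slice E x)) => //; rewrite jE.
  have mE := stone_set_measurable rE.
  have m1 : measurable (A `\` stone_set E) by exact: measurableD.
  have m2 : measurable ((stone_set E : set Om) `\` A) by exact: measurableD.
  pose D' : set Om := (A `\` stone_set E) `|` (stone_set E `\` A).
  have mD' : measurable D' by exact: measurableU.
  apply: (lpn_le_Ip p1 (ltW r0) _).2.
  apply: le_trans hE; apply: (le_trans _ (measureU2 lam m1 m2)).
  rewrite -[leRHS](Ip_cind lam p1 mD'); apply: (le_Ip p1).
  + by apply: cmeasurableB; exact: cmeasurable_cind.
  + exact: cmeasurable_cind.
  apply: filterE => U; rewrite /cind !indicE.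
  have [/set_mem UA|/negP UA] := boolP (U \in A);
    have [/set_mem UE|/negP UE] := boolP (U \in (stone_set E : set Om)).
  + by rewrite subrr rnorm0 rnorm_ge0.
  + by rewrite subr0 [U \in D']mem_set//; left; split=> // /mem_set.
  + by rewrite sub0r rnormN [U \in D']mem_set//; right; split=> // /mem_set.
  + by rewrite subrr rnorm0 rnorm_ge0.
- split=> [|r r0]; first exact: (Lp_sum p1 (Lp_scale p1 a Lf).1 Lg).1.
  pose r' := r / (rnorm a + 1).
  have a1 : 0 < rnorm a + 1 by rewrite ltr_wpDl// rnorm_ge0.
  have r'0 : 0 < r' by rewrite divr_gt0.
  have [k sk fk] := Df _ r'0; have [k' sk' gk'] := Dg _ r'0.
  exists (fun x t => a * k x t + k' x t); first exact: slice_simple_lin.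
  have Lfk := Lp_sub p1 Lf (Lj _ sk).
  have Lgk := Lp_sub p1 Lg (Lj _ sk').
  have [_] := Lp_sum p1 (Lp_scale p1 a Lfk).1 Lgk.
  rewrite (Lp_scale p1 a Lfk).2 jfun_lin//.
  under eq_fun do rewrite mulrBr addrACA -opprD.
  move=> /le_trans; apply.
  have -> : r = rnorm a * r' + r' by rewrite -{2}[r']mul1r -mulrDl mulrC divfK// gt_eqF.
  exact: (lerD (ler_wpM2l (rnorm_ge0 a) fk) gk').
- split=> // r r0; have r2 : 0 < r / 2 by rewrite divr_gt0.
  have [g [Lg [_ Dg] fg]] := hf _ r2; have [k sk gk] := Dg _ r2.
  exists k => //; have Lk := Lj _ sk.
  have [_] := Lp_sum p1 (Lp_sub p1 Lf Lg) (Lp_sub p1 Lg Lk).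
  under eq_fun do rewrite addrA subrK.
  by move=> /le_trans; apply; rewrite [r]splitr; exact: (lerD fg gk).
Qed.

Let SSV : set (X -> B) := @unif_simple B.
Let SS0V : set (X -> T -> C^o) := slice_simple.

(** A mean of p-th powers is at most the p-th power of the supremum, so [J0] is bounded by 1 for the
    sup norm of [Q0 h]. Functions [Q0 h] are dense for that norm, hence [J0] extends, and the norm
    formula passes to the limit since the power is Lipschitz on bounded sets. *)
Lemma bochner_space : exists (D : completeNormedModType C) (J : (X -> B) -> D),
  [/\ is_Lp_space p D,
      forall (a : C) xi eta, unif_simple xi -> unif_simple eta ->
        J (fun x => a *: xi x + eta x) = a *: J xi + J eta,
      forall xi, unif_simple xi -> rnorm (J xi) `^ p = mean (fun x => rnorm (xi x) `^ p) &
      forall b (e : R), 0 < e -> exists2 xi, unif_simple xi & rnorm (b - J xi) <= e].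
Proof.
have fin_cst (b : B) : finite_set (range (fun _ : X => b)).
  by apply: (@sub_finite_set _ _ [set b]) => // _ [x _ <-].
have SS00 : SS0V 0.
  split; last by move=> x; exact: simple0.
  by apply: (@sub_finite_set _ _ [set (fun=> 0)]) => // _ [x _ <-].
have ND u v : SSV u -> SSV v -> supn (u + v) <= supn u + supn v.
  move=> Su Sv; apply: supn_le => x; apply: (le_trans (rnormD _ _)).
  by apply: lerD; apply: supn_ub; exact: unif_simple_bdd.
have le1 (a : C) u : SSV u -> supn (a *: u) <= rnorm a * supn u.
  move=> Su; apply: supn_le => x; rewrite rnormZ ler_wpM2l ?rnorm_ge0//.
  by apply: supn_ub; exact: unif_simple_bdd.
have SSZ (a : C) u : SSV u -> SSV (a *: u).
  move=> Su; have := unif_simple_lin a Su (unif_simple_finite (fin_cst 0)); congr unif_simple.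
  by apply/funext => x; rewrite addr0.
have NZ (a : C) u : SSV u -> supn (a *: u) = rnorm a * supn u.
  move=> Su; apply/eqP; rewrite eq_le le1//=.
  have [->|a0] := eqVneq a 0.
    by rewrite rnorm0 mul0r; apply: supn_ge0; apply: unif_simple_bdd; exact: SSZ.
  have ra : 0 < rnorm a.
    by rewrite lt_def rnorm_ge0 andbT; apply: contra_neq a0; exact: rnorm_eq0.
  rewrite -ler_pdivlMl//; have := le1 a^-1 (a *: u) (SSZ a u Su).
  rewrite scalerA mulVf// scale1r => /le_trans; apply.
  suff -> : rnorm a^-1 = (rnorm a)^-1 by [].
  by apply: (mulIf (lt0r_neq0 ra)); rewrite -rnormM mulVf// rnorm1 mulVf// gt_eqF.
have dns v : SSV v -> forall e : R, 0 < e -> exists2 u, SS0V u & supn (v - Q0 u) <= e.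
  move=> Sv e e0; have [h Sh hv] := Q0_dense Sv e0; exists h => //.
  exact: supn_le.
have fle u : SS0V u -> rnorm (J0 u) <= 1 * supn (Q0 u).
  move=> Su; rewrite mul1r; have bu := unif_simple_bdd (Q0_SS Su).
  apply: pow_le; [exact: rnorm_ge0|exact: supn_ge0|].
  rewrite J0_norm// -(mean_cst uomega en_ne (supn (Q0 u) `^ p)).
  apply: (mean_le uomega en_mem en_ne).
  - exact: (@pow_bdd (fun x => rnorm (Q0 u x)) (fun x => rnorm_ge0 _) bu).
  - by exists `|supn (Q0 u) `^ p|.
  apply: (@filterE _ omega) => n x _; apply: ge0_ler_powR; rewrite ?nnegrE ?(ltW p0) ?rnorm_ge0//.
    exact: supn_ge0.
  exact: supn_ub.
have [J [JE J_lin J_le]] := @extension R (X -> T -> C^o) (X -> B) BB SS0V SSV (@Q0 : (X ->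
  T -> C^o) -> (X -> B))
  (J0 : (X -> T -> C^o) -> BB)
    (@supn B) 1 ler01 SS00 slice_simple_lin (@unif_simple_lin B) Q0_SS Q0_lin J0_lin
  ND NZ dns fle.
exists BB, J; split.
- exact: Lp_banachP.
- exact: J_lin.
- move=> xi Sxi; apply/eqP; rewrite -subr_eq0 -normr_le0; apply/ler_addgt0Pl => e e0.
  have bxi := unif_simple_bdd Sxi; pose M := supn xi.
  have M0 : 0 <= M by exact: supn_ge0.
  (* The Lipschitz constant of the power on [[0, M + 1]] given by [powR_lip_abs]. The bound [r <= 1]
     keeps all norms below [M + 1], and the error [r * K] is spent twice: for [J xi] against [J0 h],
     and for the two means. *)
  pose K := (M + 1 + 1) `^ p.
  have K0 : 0 < K by rewrite powR_gt0// -addrA ltr_wpDl.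
  pose r := Num.min 1 (e / (2 * K)).
  have r0 : 0 < r by rewrite lt_min ltr01 divr_gt0// mulr_gt0.
  have r1 : r <= 1 by rewrite ge_min lexx.
  have rK : r * K + r * K <= e.
    have : r <= e / (2 * K) by rewrite ge_min lexx orbT.
    by rewrite ler_pdivlMr ?mulr_gt0//; lra.
  have [h Sh hxi] := Q0_dense Sxi r0.
  have bQ := unif_simple_bdd (Q0_SS Sh).
  have xiM x : rnorm (xi x) <= M + 1 by apply: (le_trans (supn_ub x bxi)); rewrite lerDl.
  have QM x : rnorm (Q0 h x) <= M + 1.
    rewrite -(subrK (xi x) (Q0 h x)) (le_trans (rnormD _ _))// addrC lerD//.
      exact: supn_ub.
    by rewrite rdistC (le_trans (hxi x)).
  have JM : rnorm (J xi) <= M + 1.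
    by apply: (le_trans (J_le _ Sxi)); rewrite mul1r lerDl.
  have JQ : rnorm (J0 h) <= M + 1.
    by apply: (le_trans (fle _ Sh)); rewrite mul1r; apply: supn_le.
  have Jd : rnorm (J xi - J0 h) <= r.
    rewrite -(JE _ Sh); have -> : J xi - J (Q0 h) = J (- 1 *: Q0 h + xi).
      by rewrite (J_lin _ _ _ (Q0_SS Sh) Sxi) scaleN1r addrC.
    apply: (le_trans (J_le _ (unif_simple_lin _ (Q0_SS Sh) Sxi))).
    by rewrite mul1r; apply: supn_le => x; rewrite scaleN1r addrC.
  have h1 : `|rnorm (J xi) `^ p - rnorm (J0 h) `^ p| <= r * K.
    apply: (le_trans (powR_lip_abs p1 (rnorm_ge0 _) (rnorm_ge0 _) JM JQ)).
    by apply: ler_wpM2r; [exact: ltW|exact: le_trans (rnorm_dist _ _) Jd].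
  have d2 x : `|rnorm (xi x) `^ p - rnorm (Q0 h x) `^ p| <= r * K.
    apply: (le_trans (powR_lip_abs p1 (rnorm_ge0 _) (rnorm_ge0 _) (xiM x) (QM x))).
    by apply: ler_wpM2r; [exact: ltW|exact: le_trans (rnorm_dist _ _) (hxi x)].
  have b1 : bdd (fun x => rnorm (xi x) `^ p) := pow_bdd (fun x => rnorm_ge0 _) bxi.
  have b2 : bdd (fun x => rnorm (Q0 h x) `^ p) := pow_bdd (fun x => rnorm_ge0 _) bQ.
  have bc : bdd (fun _ : X => r * K) by exists `|r * K|.
  have ms (phi psi : X -> R) : bdd phi -> bdd psi ->
      (forall x, `|phi x - psi x| <= r * K) -> mean phi <= mean psi + r * K.
    move=> bphi bpsi hd.
    rewrite -[X in _ + X](mean_cst uomega en_ne) -[mean psi]mul1r -mean_lin//.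
    apply: (mean_le uomega en_mem en_ne) => //.
      have [a ha] := bpsi; exists (a + `|r * K|) => x; rewrite mul1r.
      by rewrite (le_trans (ler_normD _ _))// lerD.
    apply: (@filterE _ omega) => n x _; rewrite mul1r -lerBlDl.
    exact: le_trans (ler_norm _) (hd x).
  have h2 : `|mean (fun x => rnorm (Q0 h x) `^ p) - mean (fun x => rnorm (xi x) `^ p)| <= r * K.
    have d2' x : `|rnorm (Q0 h x) `^ p - rnorm (xi x) `^ p| <= r * K by rewrite distrC.
    have := ms _ _ b1 b2 d2; have := ms _ _ b2 b1 d2'.
    by rewrite ler_norml lerBlDl => ->; rewrite lerNl opprB lerBlDl => ->.
  rewrite addr0; apply: le_trans rK.
  rewrite -(subrK (rnorm (J0 h) `^ p) (rnorm (J xi) `^ p)) -addrA.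
  by apply: (le_trans (ler_normD _ _)); rewrite lerD// J0_norm.
- move=> b e e0; have [h Sh hb] := J0_dense b e0.
  by exists (Q0 h); [exact: Q0_SS|rewrite JE].
Qed.

End Representation.
End BochnerSpace.

(** * Matrices of partial maps *)

Lemma sum_seq1 (V : nmodType) (I : eqType) (r : seq I) (i : I) (F : I -> V) :
  uniq r -> (forall j, j != i -> F j = 0) -> (i \notin r -> F i = 0) ->
  \sum_(j <- r) F j = F i.
Proof.
move=> ur Fj; have [ir _|ir /(_ isT) ->] := boolP (i \in r).
  by rewrite (bigD1_seq i)//= big1 ?addr0// => j /Fj.
rewrite big_seq big1// => j jr; apply: Fj; apply: contraNneq ir => <-; exact: jr.
Qed.

(* A space cut into finite pieces, with a right action of [P] preserving the
   pieces, whose entourages are the sets covered by finitely many graphs of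
   elements of [P]. *)
Record translation_space (R : realType) (X : choiceType) (d : X -> X -> \bar R)
    (P : groupType) := TranslationSpace {
  act : P -> X -> X;
  piece : X -> nat;
  enum_piece : nat -> seq X;
  act1 : forall x, act 1%g x = x;
  actM : forall a b x, act (a * b)%g x = act b (act a x);
  enum_piece_uniq : forall n, uniq (enum_piece n);
  mem_enum_piece : forall n x, (x \in enum_piece n) = (piece x == n);
  enum_piece_gt0 : forall n, (0 < size (enum_piece n))%N;
  act_piece : forall a x, piece (act a x) = piece x;
  entourageP : forall E, is_entourage d E <->
    exists F : seq P, forall x y, E (x, y) -> exists2 a, a \in F & y = act a x }.

Section Translations.
Variables (R : realType) (X : choiceType) (d : X -> X -> \bar R) (P : groupType).
Variable M : translation_space d P.
Local Notation C := R[i].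
Local Notation tau := (act M).
Local Notation tg := (piece M).
Local Notation en := (enum_piece M).
Implicit Types (S T V : X -> X -> C) (A B : set X) (f g : X -> X).

Lemma act_inj a : injective (tau a).
Proof. by move=> x y xy; rewrite -(act1 M x) -(mulgV a) actM xy -actM mulgV act1. Qed.

Lemma actK a : cancel (tau a) (tau a^-1%g).
Proof. by move=> x; rewrite -actM mulgV act1. Qed.

Lemma actVK a : cancel (tau a^-1%g) (tau a).
Proof. by move=> x; rewrite -actM mulVg act1. Qed.

Lemma CuP T : Cu d T <-> (exists K : R, forall x y, rnorm (T x y) <= K) /\
  exists F : seq P, forall x y, T x y != 0 -> exists2 a, a \in F & y = tau a x.
Proof.
split=> -[bT eT]; split => //; first by have /(entourageP M)[F hF] := eT; exists F => x y;
  exact: hF.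
by apply/(entourageP M); have [F hF] := eT; exists F => x y /=; exact: hF.
Qed.

Lemma Cu_cover T : Cu d T ->
  exists F : seq P, forall x y, T x y != 0 -> exists2 a, a \in F & y = tau a x.
Proof. by move=> /CuP[]. Qed.

Lemma Cu_piece T x y : Cu d T -> T x y != 0 -> tg y = tg x.
Proof. by move=> /Cu_cover[F hF] /hF[a _ ->]; rewrite act_piece. Qed.

Lemma mem_en x : x \in en (tg x).
Proof. by rewrite mem_enum_piece. Qed.

Lemma mmulE S T x z : Cu d S -> mmul S T x z = \sum_(y <- en (tg x)) S x y * T y z.
Proof.
move=> CS; rewrite /mmul [RHS]fsbig_seq ?enum_piece_uniq//; symmetry; apply: fsbig_widen => //.
move=> y [_ /= ny]; have [->|/(Cu_piece CS) yx] := eqVneq (S x y) 0; first by rewrite mul0r.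
by case: ny; rewrite mem_enum_piece yx.
Qed.

(** Entries stay bounded because a row of [S] has at most as many nonzero entries as there are
    elements in the list covering its support. *)
Lemma Cu_mmul S T : Cu d S -> Cu d T -> Cu d (mmul S T).
Proof.
move=> CS CT; have /CuP[[K hK] [F hF]] := CS; have /CuP[[L hL] [G hG]] := CT.
apply/CuP; split; last first.
  exists [seq (a * b)%g | a <- F, b <- G] => x z; rewrite mmulE// => n0.
  have [y _] : exists2 y, y \in en (tg x) & S x y * T y z != 0.
    apply/hasP; apply: contra_neqT n0 => /hasPn h.
    by rewrite big_seq big1// => y /h /negPn/eqP.
  rewrite mulf_eq0 negb_or => /andP[/hF[a aF ->] /hG[b bG ->]].
  by exists (a * b)%g; [exact: allpairs_f|rewrite actM].
exists (\sum_(a <- F) `|K| * `|L|) => x z; rewrite mmulE//.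
have KL y : rnorm (S x y * T y z) <= `|K| * `|L|.
  by rewrite rnormM ler_pM ?rnorm_ge0// (le_trans _ (ler_norm _)).
have -> : \sum_(y <- en (tg x)) S x y * T y z =
    \sum_(y <- undup [seq tau a x | a <- F]) S x y * T y z.
  rewrite (bigID (fun y => y \in [seq tau a x | a <- F]))/= [X in _ + X]big1 ?addr0; last first.
    move=> y; have [->|/hF[a aF ->]] := eqVneq (S x y) 0; first by rewrite mul0r.
    by move=> /negP[]; exact: map_f.
  rewrite -big_filter; apply: perm_big; apply: uniq_perm.
  - by rewrite filter_uniq ?enum_piece_uniq.
  - exact: undup_uniq.
  move=> y; rewrite mem_filter mem_undup mem_enum_piece.
  by apply: andb_idr => /mapP[a _ ->]; rewrite act_piece.
apply: (le_trans (rnorm_sum _ _ _)); apply: (le_trans (ler_sum _ (fun y _ => KL y))).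
rewrite !big_const_seq !count_predT !iter_addr_0 ler_wpMn2l ?mulr_ge0//.
by rewrite (leq_trans (size_undup _))// size_map.
Qed.

Lemma Cu_lin (a : C) S T : Cu d S -> Cu d T -> Cu d (fun x y => a * S x y + T x y).
Proof.
move=> /CuP[[K hK] [F hF]] /CuP[[L hL] [G hG]]; apply/CuP; split.
  exists (rnorm a * K + L) => x y; rewrite (le_trans (rnormD _ _))// rnormM.
  by rewrite lerD// ler_wpM2l ?rnorm_ge0.
exists (F ++ G) => x y; have [S0|/hF[b bF ->] _] := eqVneq (S x y) 0; last first.
  by exists b; rewrite // mem_cat bF.
by rewrite S0 mulr0 add0r => /hG[b bG ->]; exists b; rewrite // mem_cat bG orbT.
Qed.

Definition pmat A f : X -> X -> C := fun x y => ((x \in A) && (y == f x))%:R.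

(** By [entourageP] this says that the graph of [f] over [A] is an entourage. *)
Definition covered A f := exists F : seq P, forall x, A x -> exists2 a, a \in F & f x = tau a x.

Definition inj_on A f := forall x y, A x -> A y -> f x = f y -> x = y.

Lemma pmat_neq0 A f x y : (pmat A f x y != 0) = ((x \in A) && (y == f x)).
Proof. by rewrite /pmat; case: (_ && _); rewrite ?oner_eq0 ?eqxx. Qed.

Lemma pmat_cases A f x y : pmat A f x y = 0 \/ pmat A f x y = 1.
Proof. by rewrite /pmat; case: (_ && _); [right|left]. Qed.

Lemma pmat_Cu A f : covered A f -> Cu d (pmat A f).
Proof.
move=> [F hF]; apply/CuP; split.
  by exists 1 => x y; case: (pmat_cases A f x y) => ->; rewrite ?rnorm0 ?rnorm1.
exists F => x y; rewrite pmat_neq0 => /andP[/set_mem Ax /eqP ->].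
by have [a aF ->] := hF _ Ax; exists a.
Qed.

Lemma pmat_pt A f : covered A f -> inj_on A f -> partial_translation d (pmat A f).
Proof.
move=> cf jf; split; [exact: pmat_Cu|exact: pmat_cases| |].
  by move=> x y z; rewrite !pmat_neq0 => /andP[_ /eqP ->] /andP[_ /eqP].
move=> x y z; rewrite !pmat_neq0 => /andP[/set_mem Ax /eqP ->] /andP[/set_mem Ay /eqP].
exact: jf.
Qed.

Lemma pt_pmat V : partial_translation d V ->
  exists A f, [/\ V = pmat A f, covered A f & inj_on A f].
Proof.
move=> [CV V01 Vr Vc]; pose A := [set x | exists y, V x y != 0].
have /choice[f hf] : forall x, exists y, A x -> V x y != 0.
  by move=> x; have [[y xy]|nA] := pselect (A x); [exists y|exists x].
exists A, f; split.
- apply/funext => x; apply/funext => y; rewrite /pmat.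
  have [V0|Vn0] := eqVneq (V x y) 0.
    rewrite V0; case: (boolP (x \in A)) => // /set_mem/hf fx.
    by have [yf|] := eqVneq y (f x); rewrite // -yf V0 eqxx in fx.
  have Ax : A x by exists y.
  rewrite mem_set// -(Vr _ _ _ Vn0 (hf _ Ax)) eqxx.
  by have [V0|//] := V01 x y; rewrite V0 eqxx in Vn0.
- by have [F hF] := Cu_cover CV; exists F => x /hf/hF.
by move=> x y Ax Ay fxy; apply: Vc (hf _ Ax) _; rewrite fxy; exact: hf.
Qed.

Lemma pmat_eq A f A' f' : (forall x, A x <-> A' x) -> (forall x, A x -> f x = f' x) ->
  pmat A f = pmat A' f'.
Proof.
move=> AA ff; have -> : A' = A by apply/seteqP; split => x /AA.
apply/funext => x; apply/funext => y; rewrite /pmat.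
by case: (boolP (x \in A)) => // /set_mem/ff ->.
Qed.

Lemma covered_id A : covered A id.
Proof. by exists [:: 1%g] => x _; exists 1%g; rewrite ?mem_head// act1. Qed.

Lemma covered_act A a : covered A (tau a).
Proof. by exists [:: a] => x _; exists a; rewrite ?mem_head. Qed.

Lemma covered_sub A B f : A `<=` B -> covered B f -> covered A f.
Proof. by move=> AB [F hF]; exists F => x /AB/hF. Qed.

Lemma inj_sub A B f : A `<=` B -> inj_on B f -> inj_on A f.
Proof. by move=> AB jf x y /AB Bx /AB By; exact: jf. Qed.

Lemma pmatM A f B g : covered A f ->
  mmul (pmat A f) (pmat B g) = pmat [set x | A x /\ B (f x)] (g \o f).
Proof.
move=> cf; have Cf := pmat_Cu cf; apply/funext => x; apply/funext => z.
rewrite mmulE//; have [Ax|nAx] := pselect (A x); last first.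
  rewrite big1 => [|y _]; last by rewrite /pmat memNset// mul0r.
  by rewrite /pmat memNset//= => -[].
rewrite (@sum_seq1 _ _ _ (f x)) ?enum_piece_uniq//.
- rewrite /pmat mem_set// eqxx mul1r; congr ((_ && _)%:R); apply/idP/idP.
    by move=> /set_mem Bf; rewrite mem_set.
  by move=> /set_mem[_ Bf]; rewrite mem_set.
- by move=> y yf; rewrite /pmat (negbTE yf) andbF mul0r.
rewrite mem_enum_piece => /eqP ntg; case: ntg; apply: (Cu_piece Cf).
by rewrite pmat_neq0 mem_set//= eqxx.
Qed.

Lemma pmat_diag A : pmat A id = diag \1_A.
Proof.
apply/funext => x; apply/funext => y; rewrite /pmat /diag /mone indicE eq_sym.
by case: (_ \in _); rewrite ?mul1r ?mul0r.
Qed.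

Lemma range_pmat A f : range_proj (pmat A f) = pmat A id.
Proof.
rewrite pmat_diag /range_proj; congr (diag \1_ _); apply/seteqP; split => x /=.
  move=> [y xy]; have : pmat A f x y != 0 by rewrite xy oner_eq0.
  by rewrite pmat_neq0 => /andP[/set_mem].
by move=> Ax; exists (f x); rewrite /pmat mem_set// eqxx.
Qed.

Lemma mone_pmat : @mone R X = pmat setT id.
Proof. by apply/funext => x; apply/funext => y; rewrite /pmat /mone in_setT eq_sym. Qed.

Lemma diagM (f : X -> C) T : linfty f -> mmul (diag f) T = fun x y => f x * T x y.
Proof.
move=> [K hK]; have Cf : Cu d (diag f).
  apply/CuP; split.
    exists (Num.max K 0) => x y; rewrite /diag /mone rnormM.
    by case: eqP => _; rewrite ?rnorm1 ?mulr1 ?rnorm0 ?mulr0 le_max ?hK ?lexx ?orbT.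
  exists [:: 1%g] => x y; rewrite /diag /mone; have [-> _|_] := eqVneq x y.
    by exists 1%g; rewrite ?mem_head ?act1.
  by rewrite mulr0 eqxx.
apply/funext => x; apply/funext => y; rewrite mmulE// (@sum_seq1 _ _ _ x) ?enum_piece_uniq//.
- by rewrite /diag /mone eqxx mulr1.
- by move=> z zx; rewrite /diag /mone eq_sym (negbTE zx) mulr0 mul0r.
by rewrite mem_en.
Qed.

Lemma supnorm_ub (f : X -> C) x : linfty f -> rnorm (f x) <= supnorm f.
Proof.
by move=> [K hK]; apply: ub_le_sup; [exists K => _ [y _ <-]|exists x].
Qed.

Lemma supnorm_ge0 (f : X -> C) : linfty f -> 0 <= supnorm f.
Proof.
move=> Lf; have /hasP[x _ _] : has xpredT (en 0) by rewrite has_predT (enum_piece_gt0 M).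
exact: le_trans (rnorm_ge0 _) (supnorm_ub x Lf).
Qed.

(** One partial translation with coefficient 1 is an admissible decomposition. Hence partial
    translations act as contractions in every representation. *)
Lemma l1norm_le1 A f : covered A f -> inj_on A f -> l1norm d (pmat A f) <= 1.
Proof.
move=> cf jf; have L1 : @linfty R X (fun=> 1) by exists 1 => x; rewrite rnorm1.
have s1 : @supnorm R X (fun=> 1) <= 1.
  apply: ge_sup; last by move=> _ [x _ <-]; rewrite rnorm1.
  have /hasP[x _ _] : has xpredT (en 0) by rewrite has_predT (enum_piece_gt0 M).
  by exists (rnorm (1 : C)), x.
apply: le_trans s1; apply: ge_inf.
  exists 0 => _ [n [h [V [Lh _ _ ->]]]]; apply: sumr_ge0 => i _; exact: supnorm_ge0.
exists 1%N, (fun=> (fun=> 1)), (fun=> pmat A f); split => //; last by rewrite big_ord1.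
  by move=> _; exact: pmat_pt.
by apply/funext => x; apply/funext => y; rewrite big_ord1 diagM// mul1r.
Qed.

End Translations.

(** * Uniform limits of finitely valued functions *)

(** The nonnegative function [phi + K] is rounded down to a multiple of [e]. *)
Lemma bounded_approx (R : realType) (X : Type) (phi : X -> R) (K e : R) :
  (forall x, `|phi x| <= K) -> 0 < e ->
  exists2 s : X -> R, finite_set (range s) & forall x, `|phi x - s x| <= e.
Proof.
move=> hK e0; pose g x := Num.trunc ((phi x + K) / e).
have pK x : 0 <= phi x + K by have := hK x; rewrite ler_norml => /andP[+ _]; rewrite -lerBlDr sub0r.
exists (fun x => e * (g x)%:R - K).
  apply: (@finite_range1 _ _ _ (fun n : nat => e * n%:R - K)).
  apply: (@sub_finite_set _ _ `I_(Num.trunc ((K + K) / e)).+1); last exact: finite_II.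
  move=> _ [x _ <-] /=; rewrite ltnS; apply: le_truncn; rewrite ler_pM2r ?invr_gt0// lerD2r.
  exact: le_trans (ler_norm _) (hK x).
move=> x; have h1 : (g x)%:R <= (phi x + K) / e by rewrite truncn_le divr_ge0// ltW.
have h2 : (phi x + K) / e < (g x).+1%:R by exact: truncnS_gt.
move: h1 h2; rewrite ler_pdivlMr// ltr_pdivrMr// -natr1 mulrDl mul1r [_ * e]mulrC.
move: (e * _) => y h1 h2; rewrite ler_norml; apply/andP; split; move: (phi x) h1 h2 e0 => z;
  clear; lra.
Qed.

Lemma bounded_approxC (R : realType) (X : Type) (c : X -> R[i]) (K e : R) :
  (forall x, rnorm (c x) <= K) -> 0 < e ->
  exists2 s : X -> R[i], finite_set (range s) & forall x, rnorm (c x - s x) <= e.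
Proof.
move=> hK e0; have e2 : 0 < e / 2 by rewrite divr_gt0.
have [s fs hs] := bounded_approx (fun x => le_trans (Re_le_rnorm (c x)) (hK x)) e2.
have [t ft ht] := bounded_approx (fun x => le_trans (Im_le_rnorm (c x)) (hK x)) e2.
exists (fun x => (s x +i* t x)%C); first exact: (@finite_range2 _ _ _ _ (fun a b => (a +i* b)%C)).
move=> x; apply: (le_trans (rnorm_le_ReIm _)); rewrite [e]splitr.
have -> : c x - (s x +i* t x)%C = ((complex.Re (c x) - s x) +i* (complex.Im (c x) - t x))%C.
  by case: (c x).
exact: lerD (hs x) (ht x).
Qed.

Section SSlemmas.
Variables (R : realType) (X : choiceType) (B : normedModType R[i]).
Implicit Types xi : X -> B.
Local Notation C := R[i].

Lemma unif_simple_comp xi (f : X -> X) : unif_simple xi -> unif_simple (fun x => xi (f x)).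
Proof.
move=> Sxi e /Sxi[s fs hs]; exists (fun x => s (f x)) => // .
by apply: sub_finite_set fs => _ [x _ <-]; exists (f x).
Qed.

Lemma unif_simple_map xi (h : B -> B) : (forall v w, rnorm (h v - h w) <= rnorm (v - w)) ->
  unif_simple xi -> unif_simple (fun x => h (xi x)).
Proof.
move=> hL Sxi e /Sxi[s fs hs]; exists (fun x => h (s x)); first exact: finite_range1.
by move=> x; exact: le_trans (hL _ _) (hs x).
Qed.

Lemma unif_simple_scale (c : X -> C) (K : R) xi : (forall x, rnorm (c x) <= K) -> unif_simple xi ->
  unif_simple (fun x => c x *: xi x).
Proof.
move=> cK Sxi e e0; have [L hL] := unif_simple_bdd Sxi.
have L0 : 0 < `|L| + 1 by rewrite ltr_wpDl.
(* [e1] is the precision for the coefficient, against vectors of norm at most [L]. Below, [e2] is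
   the precision for the vectors, against approximate coefficients of size at most [|K| + e1]. Each
   contributes [e / 2]. *)
have e1 : 0 < e / 2 / (`|L| + 1) by rewrite !divr_gt0.
have [s fs hs] := bounded_approxC cK e1.
have K1 : 0 < `|K| + e / 2 / (`|L| + 1) + 1 by rewrite ltr_wpDl// addr_ge0// ltW.
have e2 : 0 < e / 2 / (`|K| + e / 2 / (`|L| + 1) + 1) by rewrite !divr_gt0.
have [t ft ht] := Sxi _ e2.
exists (fun x => s x *: t x); first exact: (@finite_range2 _ _ _ _ (fun a (b : B) => a *: b)).
move=> x; apply: (le_trans (rdist_triangle (s x *: xi x) _ _)); rewrite [e]splitr.
rewrite -scalerBl -scalerBr !rnormZ; apply: lerD.
  rewrite -[leRHS](divfK (lt0r_neq0 L0)) ler_pM ?rnorm_ge0//.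
  by have := hL x; rewrite ger0_norm ?rnorm_ge0// => /le_trans; apply; rewrite ler_wpDr// ler_norm.
rewrite -[leRHS](divfK (lt0r_neq0 K1)) mulrC ler_pM ?rnorm_ge0//.
rewrite -(subrK (c x) (s x)) (le_trans (rnormD _ _))// rdistC.
apply: (@le_trans _ _ (e / 2 / (`|L| + 1) + `|K|)); last by rewrite addrC ler_wpDr.
by apply: lerD => //; exact: le_trans (cK x) (ler_norm _).
Qed.

Lemma unif_simple_cst (v : B) : unif_simple (fun _ : X => v).
Proof.
by apply: unif_simple_finite; apply: (@sub_finite_set _ _ [set v]) => // _ [x _ <-].
Qed.

Lemma unif_simple_sum (I : Type) (r : seq I) (F : I -> X -> B) :
  (forall i, unif_simple (F i)) -> unif_simple (fun x => \sum_(i <- r) F i x).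
Proof.
move=> SF; elim: r => [|i r IH].
  by have := unif_simple_cst 0; congr unif_simple; apply/funext => x; rewrite big_nil.
have := unif_simple_lin 1 (SF i) IH; congr unif_simple; apply/funext => x.
by rewrite big_cons scale1r.
Qed.

End SSlemmas.

(** * The twisted regular representation *)

(** One choice must serve all entourages and yet take finitely many values on each. [F k] covers the
    pairs at distance at most [k], and the element is taken from the first [F j] that works, so
    pairs at distance at most [k] only use [F 0] to [F k]. *)
Lemma uniform_choice (R : realType) (X : choiceType) (d : X -> X -> \bar R) (P : groupType)
    (M : translation_space d P) : exists ch : X -> X -> P,
  forall E, is_entourage d E -> exists2 F : seq P, uniq F &
    forall x y, E (x, y) -> ch x y \in F /\ y = act M (ch x y) x.
Proof.
have /choice[F hF] : forall k : nat, exists F : seq P,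
    forall x y, (d x y <= k%:R%:E)%E -> exists2 a, a \in F & y = act M a x.
  by move=> k; apply/(entourageP M [set xy | (d xy.1 xy.2 <= k%:R%:E)%E]); exists k%:R.
pose G x y k := exists2 a, a \in F k & y = act M a x.
have /choice[ch1 hch1] : forall xy, exists a, forall k, G xy.1 xy.2 k ->
    exists2 j, (j <= k)%N & a \in F j /\ xy.2 = act M a xy.1.
  move=> [x y] /=; have [[k Gk]|nG] := pselect (exists k, G x y k); last first.
    by exists 1%g => k Gk; case: nG; exists k.
  have [a aF ya] := @natminP [set k | G x y k] (ex_intro _ k Gk).
  by exists a => j Gj; exists (natmin [set k | G x y k]) => //; exact: natmin_le.
exists (fun x y => ch1 (x, y)) => E [r hr].
(* Indices run up to [trunc r + 1], the first integer certain to exceed [r]. *)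
exists (undup (flatten [seq F j | j <- iota 0 (Num.trunc r).+2])); first exact: undup_uniq.
move=> x y /hr dxy; have [|j jk [aF yE]] := hch1 (x, y) (Num.trunc r).+1.
  by apply: hF; apply: (le_trans dxy); rewrite lee_fin ltW// truncnS_gt.
split; last exact: yE.
rewrite mem_undup; apply/flatten_mapP; exists j => //.
by rewrite mem_iota add0n ltnS.
Qed.

Lemma rnorm_le_eq0 (R : realType) (V : normedModType R[i]) (v : V) : rnorm v <= 0 -> v = 0.
Proof. by move=> v0; apply/rnorm_eq0/eqP; rewrite eq_le v0 rnorm_ge0. Qed.

Section Representation.
Variables (R : realType) (p : R) (p1 : 1 <= p).
Variables (omega : set_system nat) (uomega : UltraFilter omega).
Variables (X : choiceType) (d : X -> X -> \bar R) (P : groupType).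
Variable M : translation_space d P.
Local Notation C := R[i].
Local Notation tau := (act M).
Local Notation tg := (piece M).
Local Notation en := (enum_piece M).
Local Notation mean := (mean omega en).
Local Notation most := (most omega tg).
Variables (B : completeNormedModType C) (sigma : P -> B -> B).
Hypothesis sigma_lin : forall a, linear (sigma a).
Hypothesis sigma_norm : forall a v, rnorm (sigma a v) = rnorm v.
Hypothesis sigmaM : forall a b v, sigma (a * b)%g v = sigma a (sigma b v).
Hypothesis sigma_fix : forall a, most (fun x => tau a x = x -> forall v, sigma a v = v).
Variables (D : completeNormedModType C) (J : (X -> B) -> D).
Hypothesis J_lin : forall (a : C) xi eta, unif_simple xi -> unif_simple eta ->
  J (fun x => a *: xi x + eta x) = a *: J xi + J eta.
Hypothesis J_norm : forall xi, unif_simple xi ->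
  rnorm (J xi) `^ p = mean (fun x => rnorm (xi x) `^ p).
Hypothesis J_dense : forall b (e : R), 0 < e -> exists2 xi, unif_simple xi & rnorm (b - J xi) <= e.
Variable ch : X -> X -> P.
Hypothesis chP : forall E, is_entourage d E -> exists2 F : seq P, uniq F &
    forall x y, E (x, y) -> ch x y \in F /\ y = tau (ch x y) x.

Implicit Types (xi eta : X -> B) (S T V : X -> X -> C).

Let pF : ProperFilter omega. Proof. exact: ultra_proper. Qed.
#[local] Existing Instance pF.
Let p0 : 0 < p. Proof. exact: lt_le_trans p1. Qed.

Lemma most_all (I : eqType) (r : seq I) (Q : I -> X -> Prop) :
  (forall i, i \in r -> most (Q i)) -> most (fun x => forall i, i \in r -> Q i x).
Proof.
elim: r => [|i r IH] h; first by apply: (@filterE _ omega) => n x _ i.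
have h1 := h i (mem_head _ _); have h2 : most (fun x => forall i, i \in r -> Q i x).
  by apply: IH => j jr; apply: h; rewrite inE jr orbT.
apply: (@filterS2 _ omega _ _ _ _ _ h1 h2) => n /= q1 q2 x xn j.
by rewrite inE => /orP[/eqP ->|jr]; [exact: q1|exact: q2].
Qed.

Lemma mostS (Q Q' : X -> Prop) : (forall x, Q x -> Q' x) -> most Q -> most Q'.
Proof. by move=> QQ; apply: (@filterS _ omega) => n /= h x xn; apply: QQ; exact: h. Qed.

Lemma mostI (Q Q' : X -> Prop) : most Q -> most Q' -> most (fun x => Q x /\ Q' x).
Proof.
by apply: (@filterS2 _ omega) => n /= h h' x xn; split; [exact: h|exact: h'].
Qed.

Lemma most_piece (Q : X -> Prop) : most Q -> most (fun x => forall y, tg y = tg x -> Q y).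
Proof. by apply: (@filterS _ omega) => n /= h x xn y yx; apply: h; rewrite yx. Qed.

Lemma sigmaB a v w : sigma a (v - w) = sigma a v - sigma a w.
Proof. by rewrite -[v - w]addrC -scaleN1r sigma_lin scaleN1r addrC. Qed.

Lemma sigma0 a : sigma a 0 = 0.
Proof. by have := sigmaB a 0 0; rewrite !subrr. Qed.

Lemma sigma1 v : sigma 1%g v = v.
Proof.
have h : sigma 1%g (sigma 1%g v - v) = 0 by rewrite sigmaB -sigmaM mulg1 subrr.
by apply/eqP; rewrite -subr_eq0; apply/eqP/rnorm_eq0; rewrite -(sigma_norm 1%g) h rnorm0.
Qed.

Definition transport x y : B -> B := sigma (ch x y).

(** The chosen element [b = ch x (tau a x)] lies in a finite list, and [a * b^-1] fixes [x]. By
    [sigma_fix], applied to these finitely many quotients, [sigma a] and [sigma b] agree on most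
    pieces. *)
Lemma transport_most a : most (fun x => forall v, transport x (tau a x) v = sigma a v).
Proof.
have [F _ hF] : exists2 F : seq P, uniq F &
    forall x y, y = tau a x -> ch x y \in F /\ y = tau (ch x y) x.
  have [|F uF hF] := chP (E := [set xy | xy.2 = tau a xy.1]).
    by apply/(entourageP M); exists [:: a] => x y /= ->; exists a; rewrite ?mem_head.
  by exists F => // x y yx; exact: hF.
have h : most (fun x => forall b, b \in F -> tau (a * b^-1)%g x = x ->
    forall v, sigma (a * b^-1)%g v = v).
  by apply: most_all => b _; exact: sigma_fix.
apply: mostS h => x h v; have [cF cE] := hF x _ erefl.
rewrite /transport; have := h _ cF; move: (ch x (tau a x)) cE => b cE.
rewrite actM cE actK => /(_ erefl) h1; by rewrite -(h1 (sigma _ v)) -sigmaM divgK.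
Qed.

(* [sigma (ch x y)] transports the fibre at [y] to the fibre at [x]; it is a
   cocycle on the pieces of a set of [omega], which makes [conv] multiplicative
   modulo functions of mean zero. *)
Definition conv (T : X -> X -> C) (xi : X -> B) : X -> B :=
  fun x => \sum_(y <- en (tg x)) T x y *: transport x y (xi y).

(** The support of [T] is split by the value of [ch]. An entry may be reached by several elements of
    [F]; the cutoff in [c] attributes it to the chosen one alone. *)
Lemma conv_form T : Cu d T -> exists (F : seq P) (c : P -> X -> C),
  [/\ uniq F, exists K : R, forall a x, rnorm (c a x) <= K,
      (forall x y, T x y = \sum_(a <- F) c a x * pmat R setT (tau a) x y) &
      forall xi x, conv T xi x = \sum_(a <- F) c a x *: sigma a (xi (tau a x))].
Proof.
move=> CT; have [[K hK] eT] := CT; have [F uF hF] := chP eT.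
pose c a x := if ch x (tau a x) == a then T x (tau a x) else 0.
have cE x y a : T x y != 0 -> y = tau a x -> c a x = if a == ch x y then T x y else 0.
  by move=> _ ->; rewrite /c eq_sym.
have sumE (W : lmodType C) (h : P -> X -> W) x y : T x y *: h (ch x y) y =
    \sum_(a <- F) (if y == tau a x then c a x *: h a y else 0).
  have [T0|Tn0] := eqVneq (T x y) 0.
    rewrite T0 scale0r big1// => a _; case: eqP => // yE.
    by rewrite /c -yE T0 if_same scale0r.
  have [cF yE] := hF _ _ Tn0; rewrite (@sum_seq1 _ _ _ (ch x y))//.
  - by rewrite -yE eqxx (cE _ _ _ Tn0 yE) eqxx.
  - move=> a ac; case: eqP => // yE'; by rewrite (cE _ _ _ Tn0 yE') (negbTE ac) scale0r.
  - by rewrite cF.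
exists F, c; split => //.
- exists (Num.max K 0) => a x; rewrite /c; case: eqP => _.
    by rewrite le_max hK.
  by rewrite rnorm0 le_max lexx orbT.
- move=> x y; have := sumE C^o (fun _ _ => 1) x y; rewrite [LHS]mulr1 => ->.
  apply: eq_bigr => a _; rewrite /pmat in_setT/=.
  by case: eqP => _; rewrite ?mulr1 ?mulr0 //; exact: mulr1.
move=> xi x; rewrite /conv (eq_bigr _ (fun y _ => sumE B (fun a y => sigma a (xi y)) x y)).
rewrite exchange_big/=; apply: eq_bigr => a _.
rewrite (@sum_seq1 _ _ _ (tau a x)) ?enum_piece_uniq//; first by rewrite eqxx.
  by move=> y /negbTE ->.
by rewrite mem_enum_piece act_piece eqxx.
Qed.

Lemma unif_simple_conv T xi : Cu d T -> unif_simple xi -> unif_simple (conv T xi).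
Proof.
move=> CT Sxi; have [F [c [_ [K hK] _ cE]]] := conv_form CT.
rewrite (_ : conv T xi = fun x => \sum_(a <- F) c a x *: sigma a (xi (tau a x))); last exact/funext.
apply: unif_simple_sum => a; apply: (unif_simple_scale (hK a)).
apply: unif_simple_map; last exact: unif_simple_comp.
by move=> v w; rewrite -sigmaB sigma_norm.
Qed.

Lemma conv_lin_l a S T xi x :
  conv (fun x y => a * S x y + T x y) xi x = a *: conv S xi x + conv T xi x.
Proof.
rewrite /conv scaler_sumr -big_split/=; apply: eq_bigr => y _.
by rewrite scalerDl scalerA.
Qed.

Lemma conv_lin_r T a xi eta x :
  conv T (fun x => a *: xi x + eta x) x = a *: conv T xi x + conv T eta x.
Proof.
rewrite /conv scaler_sumr -big_split/=; apply: eq_bigr => y _.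
by rewrite /transport sigma_lin scalerDr !scalerA [a * _]mulrC.
Qed.

Lemma conv_pmat A f xi x : covered M A f ->
  conv (pmat R A f) xi x = if x \in A then transport x (f x) (xi (f x)) else 0.
Proof.
move=> cf; rewrite /conv; case: ifPn => [/set_mem Ax|xA]; last first.
  by rewrite big1// => y _; rewrite /pmat (negbTE xA) scale0r.
rewrite (@sum_seq1 _ _ _ (f x)) ?enum_piece_uniq//.
- by rewrite /pmat mem_set// eqxx scale1r.
- by move=> y /negbTE yf; rewrite /pmat yf andbF scale0r.
rewrite mem_enum_piece => /eqP ntg; case: ntg; apply: (Cu_piece M (pmat_Cu (R := R) cf)).
by rewrite pmat_neq0 mem_set//= eqxx.
Qed.

Lemma bdd_pow xi : unif_simple xi -> bdd (fun x => rnorm (xi x) `^ p).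
Proof.
move=> /unif_simple_bdd[K hK]; exists (K `^ p) => x; rewrite ger0_norm ?powR_ge0//.
have h : rnorm (xi x) <= K by apply: le_trans (hK x); exact: ler_norm.
by apply: ge0_ler_powR; rewrite ?nnegrE ?(ltW p0) ?rnorm_ge0//; exact: le_trans (rnorm_ge0 _) h.
Qed.

Lemma pow_le (a b : R) : 0 <= a -> 0 <= b -> a `^ p <= b `^ p -> a <= b.
Proof.
move=> a0 b0 ab; rewrite leNgt; apply/negP => ba.
have := gt0_ltr_powR p0 _ _ ba; rewrite !nnegrE => /(_ b0 a0).
by rewrite ltNge ab.
Qed.

Lemma J_le_cst xi (K : R) : unif_simple xi -> most (fun x => rnorm (xi x) <= K) -> 0 <= K ->
  rnorm (J xi) <= K.
Proof.
move=> Sxi h K0; apply: pow_le => //; first exact: rnorm_ge0.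
rewrite J_norm// -(mean_cst uomega (enum_piece_gt0 M) (K `^ p)).
apply: (mean_le uomega (mem_enum_piece M) (enum_piece_gt0 M)); first exact: bdd_pow.
  by exists `|K `^ p|.
apply: mostS h => x h; apply: ge0_ler_powR; rewrite ?nnegrE ?(ltW p0) ?rnorm_ge0//.
Qed.

Lemma J_most xi eta : unif_simple xi -> unif_simple eta -> most (fun x => xi x = eta x) ->
  J xi = J eta.
Proof.
move=> Sxi Seta h; apply/eqP; rewrite -subr_eq0; apply/eqP/rnorm_le_eq0.
rewrite -scaleN1r addrC -J_lin//; apply: J_le_cst => //; first exact: unif_simple_lin.
by apply: mostS h => x ->; rewrite scaleN1r addNr rnorm0.
Qed.

Lemma J_zero : J (fun=> 0) = 0.
Proof. by apply: rnorm_le_eq0; apply: J_le_cst (unif_simple_cst _ _) _ _ => //;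
  apply: (@filterE _ omega) => n x _; rewrite rnorm0. Qed.

Lemma J_sum (I : Type) (r : seq I) (F : I -> X -> B) : (forall i, unif_simple (F i)) ->
  J (fun x => \sum_(i <- r) F i x) = \sum_(i <- r) J (F i).
Proof.
move=> SF; elim: r => [|i r IH].
  by rewrite big_nil -[RHS]J_zero; congr J; apply/funext => x; rewrite big_nil.
rewrite big_cons -IH -[J (F i)]scale1r -J_lin//; last exact: unif_simple_sum.
by congr J; apply/funext => x; rewrite big_cons scale1r.
Qed.

(** The twist is isometric and disappears from the norms; what remains is composition with an
    injective partial map, which [mean_inj] controls. *)
Lemma J_pt V h xi : partial_translation d V -> linfty h -> unif_simple xi ->
  [/\ Cu d (fun x y => h x * V x y), unif_simple (conv (fun x y => h x * V x y) xi) &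
      rnorm (J (conv (fun x y => h x * V x y) xi)) <= supnorm h * rnorm (J xi)].
Proof.
move=> ptV Lh Sxi; have [CV _ _ _] := ptV; have [A [f [VE cf jf]]] := pt_pmat M ptV.
have s0 := supnorm_ge0 M Lh.
have Ch : Cu d (fun x y => h x * V x y).
  have /(CuP M)[[K hK] [F hF]] := CV; apply/(CuP M); split.
    exists (supnorm h * K) => x y; rewrite rnormM ler_pM ?rnorm_ge0//; exact: supnorm_ub.
  by exists F => x y; rewrite mulf_eq0 negb_or => /andP[_]; exact: hF.
have Sc := unif_simple_conv Ch Sxi; split=> //.
apply: pow_le; rewrite ?mulr_ge0 ?rnorm_ge0//.
rewrite powRM ?rnorm_ge0// !J_norm//.
have bxi := bdd_pow Sxi; have f_tg x : A x -> tg (f x) = tg x.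
  by have [F hF] := cf; move=> /hF[a _ ->]; rewrite act_piece.
have bf : bdd (fun x => \1_A x * rnorm (xi (f x)) `^ p).
  have [K hK] := bxi; exists K => x; rewrite normrM indicE.
  by case: (_ \in _); rewrite ?normr1 ?mul1r// normr0 mul0r (le_trans _ (hK x)).
apply: (@le_trans _ _ (supnorm h `^ p * mean (fun x => \1_A x * rnorm (xi (f x)) `^ p)));
  last first.
  rewrite ler_wpM2l ?powR_ge0//;
    apply: (mean_inj uomega (enum_piece_uniq M) (mem_enum_piece M)) => //.
    exact: (enum_piece_gt0 M).
  by move=> x; rewrite powR_ge0.
rewrite -(meanZ uomega (enum_piece_gt0 M) _ bf);
  apply: (mean_le uomega (mem_enum_piece M) (enum_piece_gt0 M)); first exact: bdd_pow.
  have [K hK] := bf; exists (`|supnorm h `^ p| * K) => x; rewrite normrM ler_wpM2l//.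
apply: (@filterE _ omega) => n x _.
have -> : conv (fun x y => h x * V x y) xi x = h x *: conv V xi x.
  by rewrite /conv scaler_sumr; apply: eq_bigr => y _; rewrite scalerA.
rewrite VE conv_pmat// indicE; case: ifPn => [/set_mem Ax|_]; last first.
  by rewrite scaler0 rnorm0 powR0 ?gt_eqF// mul0r mulr0.
rewrite mul1r -powRM ?rnorm_ge0// rnormZ sigma_norm.
apply: ge0_ler_powR; rewrite ?nnegrE ?(ltW p0) ?mulr_ge0 ?rnorm_ge0//.
by rewrite ler_wpM2r ?rnorm_ge0//; exact: supnorm_ub.
Qed.

Let decomp T := [set r : R | exists (n : nat) (f : 'I_n -> X -> C)
    (V : 'I_n -> X -> X -> C),
  [/\ forall i, linfty (f i),
      forall i, partial_translation d (V i),
      T = (fun x y => \sum_(i < n) mmul (diag (f i)) (V i) x y) &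
      r = \sum_(i < n) supnorm (f i)]].

(** Nonemptiness makes [l1norm] a genuine infimum rather than the default value of [inf]. *)
Let decomp_ex T : Cu d T -> decomp T !=set0.
Proof.
move=> CT; have [F [c [uF [K hK] TE _]]] := conv_form CT.
pose a i := tnth (in_tuple F) i.
exists (\sum_(i < size F) supnorm (c (a i))), (size F), (fun i => c (a i)),
  (fun i => pmat R setT (tau (a i))); split => //.
- by move=> i; exists K.
- by move=> i; apply: (pmat_pt (M := M)); [exact: covered_act|move=> x y _ _; exact: act_inj].
apply/funext => x; apply/funext => y; rewrite TE (big_tnth _ _ F).
by apply: eq_bigr => i _; rewrite (diagM M)//; exists K.
Qed.

Let decomp_bound T r xi : decomp T r -> unif_simple xi -> rnorm (J (conv T xi)) <= r * rnorm (J xi).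
Proof.
move=> [n [f [V [Lf ptV -> ->]]]] Sxi.
have h i := J_pt (ptV i) (Lf i) Sxi.
have -> : conv (fun x y => \sum_(i < n) mmul (diag (f i)) (V i) x y) xi =
    fun x => \sum_(i <- index_enum 'I_n) conv (fun x y => f i x * V i x y) xi x.
  apply/funext => x; rewrite /conv exchange_big/=; apply: eq_bigr => y _.
  rewrite -scaler_suml; congr (_ *: _).
  by apply: eq_bigr => i _; rewrite (diagM M).
rewrite J_sum; last by move=> i; have [] := h i.
rewrite (le_trans (rnorm_sum _ _ _))// mulr_suml.
by apply: ler_sum => i _; have [] := h i.
Qed.

Lemma J_conv_le T xi : Cu d T -> unif_simple xi ->
  0 <= l1norm d T /\ rnorm (J (conv T xi)) <= l1norm d T * rnorm (J xi).
Proof.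
move=> CT Sxi; have [r0 Dr0] := decomp_ex CT.
have dge r : decomp T r -> 0 <= r.
  by move=> [n [f [V [Lf _ _ ->]]]]; apply: sumr_ge0 => i _; exact: (supnorm_ge0 M).
split; first by apply: lb_le_inf; [exists r0|move=> r; exact: dge].
have [J0'|Jn0] := eqVneq (rnorm (J xi)) 0.
  by have := decomp_bound Dr0 Sxi; rewrite J0' !mulr0.
have Jp : 0 < rnorm (J xi) by rewrite lt_def Jn0 rnorm_ge0.
rewrite -ler_pdivrMr//; apply: lb_le_inf; first by exists r0.
by move=> r Dr; rewrite ler_pdivrMr//; exact: decomp_bound.
Qed.

(** The bound [J_conv_le] shows that [J xi |-> J (conv T xi)] is well defined and bounded on the
    dense image of [J], so [extension] applies with [iota = J]. *)
Lemma op_ex T : exists G : D -> D, Cu d T ->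
  [/\ linear G, forall xi, unif_simple xi -> G (J xi) = J (conv T xi) &
      forall b, rnorm (G b) <= l1norm d T * rnorm b].
Proof.
have [CT|nCT] := pselect (Cu d T); last by exists id.
have [l0 _] := J_conv_le CT (unif_simple_cst X (0 : B)).
pose SB : set (X -> B) := @unif_simple R X B.
have [|||||||||G [GE Gl Gn]] := @extension R (X -> B) D D SB setT J (fun xi => J (conv T xi))
    (@rnorm R D) (l1norm d T) l0 (unif_simple_cst X 0).
- by move=> a u v; exact: unif_simple_lin.
- by [].
- by [].
- exact: J_lin.
- move=> a u v Su Sv; rewrite -J_lin; [|exact: unif_simple_conv|exact: unif_simple_conv].
  by congr J; apply/funext => x; rewrite -conv_lin_r.
- by move=> u v _ _; exact: rnormD.
- by move=> a u _; exact: rnormZ.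
- by move=> v _ e /(J_dense v).
- by move=> u Su; have [] := J_conv_le CT Su.
by exists G => _; split => [a u v|xi|b]; [exact: Gl|exact: GE|exact: Gn].
Qed.

Lemma lin_dense_eq (B' : normedModType C) (G H : D -> B') (K L : R) :
  linear G -> linear H -> (forall b, rnorm (G b) <= K * rnorm b) ->
  (forall b, rnorm (H b) <= L * rnorm b) ->
  (forall xi, unif_simple xi -> G (J xi) = H (J xi)) -> G =1 H.
Proof.
move=> lG lH GK HL GH b; apply/eqP; rewrite -subr_eq0; apply/eqP/rnorm_le_eq0.
apply/ler_addgt0Pl => e e0; rewrite addr0.
have KL : 0 < `|K| + `|L| + 1 by rewrite ltr_wpDl// addr_ge0.
have [xi Sxi bxi] := J_dense b (divr_gt0 e0 KL).
have lB (F : D -> B') : linear F -> forall v w, F v = F (v - w) + F w.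
  by move=> lF v w; have := lF 1 (v - w) w; rewrite !scale1r subrK.
rewrite (lB G lG b (J xi)) (lB H lH b (J xi)) GH// opprD addrACA subrr addr0.
apply: (le_trans (rnormB _ _)).
have h1 : rnorm (G (b - J xi)) <= `|K| * (e / (`|K| + `|L| + 1)).
  apply: (le_trans (GK _)); apply: (@le_trans _ _ (`|K| * rnorm (b - J xi))).
    by rewrite ler_wpM2r ?rnorm_ge0// ler_norm.
  by rewrite ler_wpM2l.
have h2 : rnorm (H (b - J xi)) <= `|L| * (e / (`|K| + `|L| + 1)).
  apply: (le_trans (HL _)); apply: (@le_trans _ _ (`|L| * rnorm (b - J xi))).
    by rewrite ler_wpM2r ?rnorm_ge0// ler_norm.
  by rewrite ler_wpM2l.
apply: (le_trans (lerD h1 h2)); rewrite -mulrDl mulrCA.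
by rewrite ler_piMr ?(ltW e0)// ler_pdivrMr// mul1r lerDl.
Qed.

Lemma lin_bounded_continuous (G : D -> D) (K : R) : linear G ->
  (forall b, rnorm (G b) <= K * rnorm b) -> continuous G.
Proof.
move=> lG GK b; apply/cvg_rnormP => e e0.
have K1 : 0 < `|K| + 1 by rewrite ltr_wpDl.
have /cvg_rnormP/(_ _ (divr_gt0 e0 K1)) h := @cvg_id _ (nbhs b).
apply: (@filterS _ (nbhs b) _ _ _ _ h) => x /= bx.
have -> : G b - G x = G (b - x) by have := lG (-1) x b;
  rewrite !scaleN1r [- x + b]addrC [- G x + _]addrC.
apply: (le_lt_trans (GK _)); apply: (@le_lt_trans _ _ (`|K| * rnorm (b - x))).
  by rewrite ler_wpM2r ?rnorm_ge0// ler_norm.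
apply: (@le_lt_trans _ _ ((`|K| + 1) * rnorm (b - x))).
  by rewrite ler_wpM2r ?rnorm_ge0// lerDl.
by rewrite mulrC -ltr_pdivlMr.
Qed.

(** All identities are checked on the dense vectors [J xi]. Multiplicativity and the unit hold there
    because the corresponding functions agree on most pieces, which [J] cannot distinguish from
    equality. *)
Lemma rep_ex : exists rep : (X -> X -> C) -> D -> D, is_representation d rep /\
  forall T xi, Cu d T -> unif_simple xi -> rep T (J xi) = J (conv T xi).
Proof.
have /choice[rep hrep] := op_ex; exists rep; split; last first.
  by move=> T xi CT; have [_ h _] := hrep T CT; exact: h.
have CM : Cu d (@mone R X) by rewrite mone_pmat; apply: (pmat_Cu (M := M)); exact: covered_id.
split.
- by move=> T /hrep[].
- by move=> T /hrep[lT _ bT]; exact: (lin_bounded_continuous lT bT).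
- move=> a S T CS CT; apply/funext => b.
  have Cl := Cu_lin M a CS CT; have [lL hL bL] := hrep _ Cl.
  have [lS hS bS] := hrep _ CS; have [lT hT bT] := hrep _ CT.
  apply: (@lin_dense_eq _ _ (fun v => a *: rep S v + rep T v) _ (rnorm a * l1norm d S + l1norm d
    T) lL _ bL).
  + move=> c u v; rewrite lS lT !scalerDr !scalerA [a * c]mulrC.
    by rewrite addrACA -!scalerA.
  + move=> v; rewrite mulrDl -mulrA (le_trans (rnormD _ _))// rnormZ lerD//.
    by rewrite ler_wpM2l ?rnorm_ge0.
  move=> xi Sxi; rewrite hL// hS// hT// -J_lin; [|exact: unif_simple_conv|exact: unif_simple_conv].
  by congr J; apply/funext => x; rewrite conv_lin_l.
- move=> S T CS CT; apply/funext => b.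
  have Cm := Cu_mmul M CS CT; have [lm hm bm] := hrep _ Cm.
  have [lS hS bS] := hrep _ CS; have [lT hT bT] := hrep _ CT.
  have [l0 _] := J_conv_le CS (unif_simple_cst X (0 : B)).
  apply: (@lin_dense_eq _ _ (rep S \o rep T) _ (l1norm d S * l1norm d T) lm _ bm).
  + by move=> c u v /=; rewrite lT lS.
  + by move=> v /=; rewrite -mulrA (le_trans (bS _))// ler_wpM2l.
  move=> xi Sxi /=; have STxi := unif_simple_conv CT Sxi; rewrite hm// hT// hS//.
  apply: J_most; [exact: unif_simple_conv|exact: unif_simple_conv|].
  have [F hF] := Cu_cover M CS; have [G hG] := Cu_cover M CT.
  have h1 : most (fun x => forall a, a \in F -> forall v, transport x (tau a x) v = sigma a v).
    by apply: most_all => a _; exact: transport_most.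
  (* Transports from the intermediate point [y] are involved, so the agreement is needed at all
     points of the piece of [x]. With [h1] and [h3] it gives the cocycle identity: from [x] to [z]
     through [y], by [a] then [c], both sides are [sigma (a * c)]. *)
  have h2 : most (fun x => forall y, tg y = tg x ->
      forall a, a \in G -> forall v, transport y (tau a y) v = sigma a v).
    by apply: most_piece; apply: most_all => a _; exact: transport_most.
  have h3 : most (fun x => forall c, c \in [seq (a * b)%g | a <- F, b <- G] ->
      forall v, transport x (tau c x) v = sigma c v).
    by apply: most_all => c _; exact: transport_most.
  apply: mostS (mostI h1 (mostI h2 h3)) => x [{}h1 [{}h2 {}h3]].
  rewrite /conv.
  transitivity (\sum_(z <- en (tg x)) \sum_(y <- en (tg x))
    (S x y * T y z) *: transport x z (xi z)).
    by apply: eq_bigr => z _; rewrite (mmulE M)// scaler_suml.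
  rewrite exchange_big/= [LHS]big_seq [RHS]big_seq; apply: eq_bigr => y.
  rewrite mem_enum_piece => /eqP yx; rewrite yx.
  have [S0|/hF[a aF yE]] := eqVneq (S x y) 0.
    by rewrite S0 scale0r big1// => z _; rewrite mul0r scale0r.
  have ksum : transport x y (\sum_(z <- en (tg x)) T y z *: transport y z (xi z)) =
      \sum_(z <- en (tg x)) T y z *: transport x y (transport y z (xi z)).
    elim/big_rec2: _ => [|z u v _ <-]; first exact: sigma0.
    exact: sigma_lin.
  rewrite ksum scaler_sumr; apply: eq_bigr => z _; rewrite scalerA.
  have [T0|/hG[c cG zE]] := eqVneq (T y z) 0; first by rewrite T0 mulr0 !scale0r.
  congr (_ *: _); rewrite {1}yE h1// zE h2// -sigmaM -h3; last exact: allpairs_f.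
  by rewrite actM -yE.
- apply/funext => b; have [l1 h1 b1] := hrep _ CM.
  apply: (@lin_dense_eq _ _ id _ 1 l1 _ b1) => //.
    by move=> v; rewrite mul1r.
  move=> xi Sxi; rewrite h1//; apply: J_most => //; first exact: unif_simple_conv.
  apply: mostS (transport_most 1%g) => x; rewrite act1 => kx.
  by rewrite mone_pmat conv_pmat; [rewrite in_setT kx sigma1|exact: covered_id].
- move=> T CT; have [lT _ bT] := hrep _ CT.
  have [l0 _] := J_conv_le CT (unif_simple_cst X (0 : B)).
  apply: ge_sup; first by exists (rnorm (rep T 0)), 0 => //=; rewrite rnorm0.
  move=> _ [v /= v1 <-]; apply: (le_trans (bT v)).
  by rewrite -[leRHS]mulr1 ler_wpM2l.
Qed.

End Representation.

(** * Averaging *)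

Section QNorm.
Variables (R : realType) (B : normedModType R[i]) (W : set B).
Local Notation C := R[i].

Lemma qnorm_le v w : W w -> qnorm W v <= rnorm (v - w).
Proof.
by move=> Ww; apply: ge_inf; [exists 0 => _ [u _ <-]; exact: rnorm_ge0|exists w].
Qed.

Lemma qnorm_ge v (r : R) : W !=set0 -> (forall w, W w -> r <= rnorm (v - w)) -> r <= qnorm W v.
Proof.
move=> [w0 Ww0] h; apply: lb_le_inf; first by exists (rnorm (v - w0)), w0.
by move=> _ [w Ww <-]; exact: h.
Qed.

Lemma qnorm_lt v (r : R) : W !=set0 -> qnorm W v < r -> exists2 w, W w & rnorm (v - w) < r.
Proof.
move=> [w0 Ww0] vr; have h : has_inf [set rnorm (v - w) | w in W].
  split; first by exists (rnorm (v - w0)), w0.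
  by exists 0 => _ [u _ <-]; exact: rnorm_ge0.
have e0 : 0 < r - qnorm W v by rewrite subr_gt0.
have [_ [w Ww <-] vw] := inf_adherent e0 h.
by exists w => //; apply: (lt_le_trans vw); rewrite addrC subrK.
Qed.

Lemma qnormZ v (a : R) : W !=set0 -> (forall (b : C) w, W w -> W (b *: w)) -> 0 < a ->
  qnorm W (a%:C%C *: v) = a * qnorm W v.
Proof.
move=> W0 WZ a0.
have h (u : B) (b : R) : 0 < b -> b * qnorm W u <= qnorm W (b%:C%C *: u).
  move=> b0; apply: qnorm_ge => // w Ww.
  have bn : b%:C%C != 0 :> C by rewrite -[0]/(0%:C%C) (inj_eq (@complexI _)) gt_eqF.
  have -> : w = b%:C%C *: (b%:C%C^-1 *: w) by rewrite scalerA divff// scale1r.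
  rewrite -scalerBr rnormZ rnormC_real gtr0_norm// ler_pM2l//.
  by apply: qnorm_le; exact: WZ.
apply/eqP; rewrite eq_le h// andbT -ler_pdivrMl//.
have a0' : 0 < a^-1 by rewrite invr_gt0.
have := h (a%:C%C *: v) a^-1 a0'.
by rewrite scalerA -rmorphM/= mulVf ?gt_eqF// scale1r.
Qed.

End QNorm.

Lemma le_all_pos (R : realType) (x y : R) : (forall e, 0 < e -> x <= y + e) -> x <= y.
Proof. by move=> h; apply/ler_addgt0Pl => e e0; rewrite addrC; exact: h. Qed.

Section Averaging.
Variables (R : realType) (p : R) (p1 : 1 <= p).
Variables (omega : set_system nat) (uomega : UltraFilter omega).
Variables (X : choiceType) (d : X -> X -> \bar R) (P : groupType).
Variable M : translation_space d P.
Local Notation C := R[i].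
Local Notation tau := (act M).
Local Notation tg := (piece M).
Local Notation en := (enum_piece M).
Local Notation mean := (mean omega en).
Variables (B : completeNormedModType C) (sigma : P -> B -> B).
Hypothesis sigma_lin : forall a, linear (sigma a).
Hypothesis sigma_norm : forall a v, rnorm (sigma a v) = rnorm v.
Variables (D : completeNormedModType C) (J : (X -> B) -> D).
Hypothesis J_lin : forall (a : C) xi eta, unif_simple xi -> unif_simple eta ->
  J (fun x => a *: xi x + eta x) = a *: J xi + J eta.
Hypothesis J_norm : forall xi, unif_simple xi ->
  rnorm (J xi) `^ p = mean (fun x => rnorm (xi x) `^ p).
Hypothesis J_dense : forall b (e : R), 0 < e -> exists2 xi, unif_simple xi & rnorm (b - J xi) <= e.
Implicit Types (xi eta : X -> B).

Let pF : ProperFilter omega. Proof. exact: ultra_proper. Qed.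
#[local] Existing Instance pF.
Let p0 : 0 < p. Proof. exact: lt_le_trans p1. Qed.

Definition vavg xi n : B := ((size (en n))%:R^-1)%:C%C *: \sum_(x <- en n) xi x.

Definition vlim xi (l : B) := forall e : R, 0 < e ->
  \forall n \near omega, rnorm (vavg xi n - l) <= e.

Lemma vavg_lin (a : C) xi eta n :
  vavg (fun x => a *: xi x + eta x) n = a *: vavg xi n + vavg eta n.
Proof.
rewrite /vavg big_split/= -scaler_sumr scalerDr !scalerA.
by congr (_ *: _ + _); rewrite mulrC.
Qed.

(** [tau a] is an injective self-map of a finite piece, hence permutes it. *)
Lemma vavg_act a xi n : vavg (fun x => sigma a (xi (tau a x))) n = sigma a (vavg xi n).
Proof.
have sigmaZ c v : sigma a (c *: v) = c *: sigma a v.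
  have := sigma_lin a c v 0; rewrite !addr0 => ->.
  by have := sigma_lin a (-1) 0 0; rewrite !scaleN1r !addNr => ->; rewrite addr0.
rewrite /vavg sigmaZ; congr (_ *: _).
have -> : sigma a (\sum_(x <- en n) xi x) = \sum_(x <- en n) sigma a (xi x).
  elim/big_rec2: _ => [|x u v _ <-]; first by have := sigmaZ 0 0; rewrite !scale0r.
  by have := sigma_lin a 1 (xi x) v; rewrite !scale1r.
rewrite -(big_map (tau a) predT (fun y => sigma a (xi y))); apply: perm_big.
have um : uniq (map (tau a) (en n)).
  by rewrite map_inj_uniq ?enum_piece_uniq//; exact: act_inj.
have [] := @uniq_min_size _ (map (tau a) (en n)) (en n) um.
- by move=> _ /mapP[x xn ->]; move: xn; rewrite !mem_enum_piece act_piece.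
- by rewrite size_map.
move=> _ h; apply: uniq_perm => //; exact: enum_piece_uniq.
Qed.

Lemma vlim_lin (a : C) xi eta l m : vlim xi l -> vlim eta m ->
  vlim (fun x => a *: xi x + eta x) (a *: l + m).
Proof.
move=> hl hm e e0; have a1 : 0 < rnorm a + 1 by rewrite ltr_wpDl// rnorm_ge0.
have r0 : 0 < e / (rnorm a + 1) by rewrite divr_gt0.
apply: (@filterS2 _ omega _ _ _ _ _ (hl _ r0) (hm _ r0)) => n h1 h2.
rewrite vavg_lin opprD addrACA -scalerBr (le_trans (rnormD _ _))// rnormZ.
apply: (le_trans (lerD (ler_wpM2l (rnorm_ge0 _) h1) h2)).
by rewrite -{2}[e / _]mul1r -mulrDl mulrC divfK// lt0r_neq0.
Qed.

Lemma vlim_act a xi l : vlim xi l -> vlim (fun x => sigma a (xi (tau a x))) (sigma a l).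
Proof.
move=> hl e e0; apply: (@filterS _ omega _ _ _ _ (hl e e0)) => n.
rewrite vavg_act; have -> : sigma a (vavg xi n) - sigma a l = sigma a (vavg xi n - l).
  by have := sigma_lin a (-1) l (vavg xi n);
    rewrite !scaleN1r [- l + _]addrC [- sigma a l + _]addrC => ->.
by rewrite sigma_norm.
Qed.

Lemma vlim_uniq xi l m : vlim xi l -> vlim xi m -> l = m.
Proof.
move=> hl hm; apply/eqP; rewrite -subr_eq0; apply/eqP/rnorm_le_eq0/le_all_pos => e e0.
have e2 : 0 < e / 2 by rewrite divr_gt0.
have [n [h1 h2]] := filter_ex (filterI (hl _ e2) (hm _ e2)).
rewrite add0r (le_trans (rdist_triangle (vavg xi n) _ _))// [e]splitr rdistC.
exact: lerD.
Qed.

Lemma vlim_cst v : vlim (fun=> v) v.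
Proof.
move=> e e0; apply: (@filterE _ omega) => n; rewrite /vavg big_const_seq count_predT iter_addr_0.
have -> : ((size (en n))%:R^-1)%:C%C *: (v *+ size (en n)) = v.
  rewrite -[v *+ _]scaler_nat scalerA -(rmorph_nat (real_complex R)) -rmorphM/= mulVf ?scale1r//.
  by rewrite pnatr_eq0 -lt0n (enum_piece_gt0 M).
by rewrite subrr rnorm0 ltW.
Qed.

Lemma vavg_le xi (K : R) n : (forall x, rnorm (xi x) <= K) -> rnorm (vavg xi n) <= K.
Proof.
move=> hK; rewrite /vavg rnormZ rnormC_real ger0_norm ?invr_ge0 ?ler0n//.
have s0 : 0 < (size (en n))%:R :> R by rewrite ltr0n (enum_piece_gt0 M).
rewrite ler_pdivrMl//; apply: (le_trans (rnorm_sum _ _ _)).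
apply: (le_trans (ler_sum _ (fun x _ => hK x))).
by rewrite big_const_seq count_predT iter_addr_0 mulr_natl.
Qed.

(** An average is the sum of the values weighted by their frequencies, and each of these finitely
    many frequencies converges along the ultrafilter. *)
Lemma vlim_ex xi : finite_set (range xi) -> exists l, vlim xi l.
Proof.
move=> fxi; pose S : seq B := fset_set (range xi).
pose phi b x : R := (xi x == b)%:R.
have bphi b x : `|phi b x| <= 1 by rewrite /phi; case: eqP => _; rewrite ?normr1 ?normr0.
exists (\sum_(b <- S) (mean (phi b))%:C%C *: b) => e e0.
pose L := \sum_(b <- S) rnorm b + 1.
have L0 : 0 < L by rewrite ltr_wpDl// sumr_ge0// => b _; exact: rnorm_ge0.
have eL : 0 < e / L by rewrite divr_gt0.
have h : \forall n \near omega, forall b, b \in S -> `|avg en (phi b) n - mean (phi b)| <= e / L.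
  elim: S {L L0 eL} (e / L) eL => [|b S IH] r r0; first by apply: (@filterE _ omega) => n b.
  have /cvgrPdist_le/(_ _ r0) h : avg en (phi b) @ omega --> mean (phi b).
    apply: (ulim_cvg uomega (M := 1)) => n.
    by apply: (avg_bound (enum_piece_gt0 M)).
  apply: (@filterS2 _ omega _ _ _ _ _ h (IH r r0)) => n h1 h2 c.
  by rewrite inE => /orP[/eqP ->|]; [rewrite distrC|exact: h2].
apply: (@filterS _ omega _ _ _ _ h) => n {}h.
have -> : vavg xi n = \sum_(b <- S) (avg en (phi b) n)%:C%C *: b.
  have xiE x : xi x = \sum_(b <- S) (phi b x)%:C%C *: b.
    rewrite (@sum_seq1 _ _ _ (xi x)) ?fset_uniq//.
    - by rewrite /phi eqxx scale1r.
    - by move=> b /negbTE bx; rewrite /phi eq_sym bx scale0r.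
    by rewrite in_fset_set// => /negP[]; rewrite inE; exists x.
  rewrite /vavg (eq_bigr _ (fun x _ => xiE x)) exchange_big/= scaler_sumr.
  apply: eq_bigr => b _; rewrite -scaler_suml scalerA; congr (_ *: _).
  by rewrite /avg rmorphM rmorph_sum.
rewrite -sumrB (le_trans (rnorm_sum _ _ _))//.
apply: (@le_trans _ _ (\sum_(b <- S) e / L * rnorm b)).
  rewrite big_seq [leRHS]big_seq; apply: ler_sum => b bS.
  rewrite -scalerBl rnormZ -rmorphB/= rnormC_real ler_wpM2r ?rnorm_ge0//; exact: h.
rewrite -mulr_sumr mulrAC ler_pdivrMr// ler_wpM2l ?(ltW e0)// /L lerDl.
exact: ler01.
Qed.

(** The inequality [t <= r + r * (t / r) ^ p] holds trivially for [t <= r], and for [t > r] because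
    then [t / r > 1]. Averaging it over a piece and taking [r] equal to the norm of [J xi] gives the
    factor 2. *)
Lemma vlim_le xi l : finite_set (range xi) -> vlim xi l -> rnorm l <= 2 * rnorm (J xi).
Proof.
move=> fxi hl; have Sxi := unif_simple_finite fxi; pose N := rnorm (J xi).
have N0 : 0 <= N by exact: rnorm_ge0.
have key (r : R) : 0 < r -> rnorm l <= r + r * (N / r) `^ p.
  move=> r0; apply: le_all_pos => e e0.
  have r0' : 0 <= r^-1 by rewrite invr_ge0 ltW.
  rewrite powRM// J_norm//.
  set m := mean _.
  have e2 : 0 < e / 2 by rewrite divr_gt0.
  (* The factor multiplying the averaged p-th powers: approximating their limit up to [e / 2]
     divided by it costs [e / 2] in the end. *)
  have K0 : 0 < r * (r^-1 `^ p) by rewrite mulr_gt0// powR_gt0// invr_gt0.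
  have [K hK] := bdd_pow p1 Sxi.
  have /cvgrPdist_le/(_ _ (divr_gt0 e2 K0)) h : avg en (fun x => rnorm (xi x) `^ p) @ omega --> m.
    apply: (ulim_cvg uomega (M := K)) => n.
    exact: (avg_bound (enum_piece_gt0 M)).
  have [n [h1 h2]] := filter_ex (filterI (hl _ e2) h).
  have tr (t : R) : 0 <= t -> t <= r + r * (t `^ p * r^-1 `^ p).
    move=> t0; have [tr|rt] := leP t r; first by rewrite ler_wpDr// !mulr_ge0 ?powR_ge0// ltW.
    rewrite ler_wpDl ?(ltW r0)// -powRM// -ler_pdivrMl// mulrC -{1}[t / r]powRr1 ?divr_ge0 ?(ltW
      r0)//.
    by rewrite ler_powR// ler_pdivlMr// mul1r ltW.
  have h3 : rnorm (vavg xi n) <= r + r * (avg en (fun x => rnorm (xi x) `^ p) n * r^-1 `^ p).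
    rewrite /vavg rnormZ rnormC_real ger0_norm ?invr_ge0 ?ler0n//.
    have s0 : 0 < (size (en n))%:R :> R by rewrite ltr0n (enum_piece_gt0 M).
    rewrite ler_pdivrMl//.
    apply: (le_trans (rnorm_sum _ _ _));
      apply: (le_trans (ler_sum _ (fun x _ => tr _ (rnorm_ge0 (xi x))))).
    rewrite big_split/= big_const_seq count_predT iter_addr_0 mulrDr mulr_natl lerD2l.
    rewrite /avg -mulr_sumr -mulr_suml; set S := \sum_(_ <- _) _; set s := _%:R in s0 *.
    have -> : s * (r * (s^-1 * S * r^-1 `^ p)) = r * (S * r^-1 `^ p) * (s * s^-1) by ring.
    by rewrite divff ?gt_eqF// mulr1.
  rewrite -/N; have h4 : rnorm l <= rnorm (vavg xi n) + e / 2.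
    by rewrite -(subrK (vavg xi n) l) addrC (le_trans (rnormD _ _))// lerD2l rdistC.
  apply: (le_trans h4); apply: (le_trans (lerD h3 (lexx _))).
  move: h2; rewrite distrC ler_norml => /andP[_]; rewrite lerBlDr => h2.
  have q : r * (e / 2 / (r * r^-1 `^ p) * r^-1 `^ p) = e / 2.
    have -> : r * (e / 2 / (r * r^-1 `^ p) * r^-1 `^ p) = e / 2 / (r * r^-1 `^ p) * (r * r^-1 `^
      p) by ring.
    by rewrite divfK// gt_eqF.
  apply: (le_trans (lerD (lerD (lexx r) (ler_wpM2l (ltW r0) (ler_wpM2r (powR_ge0 _ _) h2)))
    (lexx _))).
  by rewrite mulrDl mulrDr q [e / 2 + _]addrC -!addrA -splitr.
have [N0'|Nn0] := eqVneq N 0.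
  rewrite -/N N0' mulr0; apply: le_all_pos => e e0; have := key e e0.
  by rewrite N0' mul0r powR0 ?gt_eqF// mulr0 addr0 add0r.
have Np : 0 < N by rewrite lt_def Nn0.
by have := key N Np; rewrite divff// powR1 mulr1 -mulr2n mulr_natl.
Qed.

(** The limit of averages exists for finitely valued functions, is bounded by [vlim_le], and extends
    by density. That the extension is still a limit of averages on all of [unif_simple] needs a
    separate approximation. *)
Lemma mean_op : exists E : D -> B,
  [/\ forall xi, unif_simple xi -> vlim xi (E (J xi)), linear E &
      forall b, rnorm (E b) <= 2 * rnorm b].
Proof.
have /choice[E0 hE0] : forall xi, exists l, finite_set (range xi) -> vlim xi l.
  move=> xi; have [/vlim_ex[l hl]|nf] := pselect (finite_set (range xi)); first by exists l.
  by exists 0.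
pose FV : set (X -> B) := [set xi | finite_set (range xi)].
have FV0 : FV 0 by apply: (@sub_finite_set _ _ [set 0]) => // _ [x _ <-].
have FVl (a : C) (u v : X -> B) : FV u -> FV v -> FV (a *: u + v).
  by move=> Fu Fv; exact: (@finite_range2 _ _ _ _ (fun u v : B => a *: u + v)).
have [|||||||||E [EE El En]] := @extension R (X ->
  B) D B FV setT J E0 (@rnorm R D) 2 (ler0n _ _) FV0.
- exact: FVl.
- by [].
- by [].
- by move=> a u v Fu Fv; apply: J_lin; exact: unif_simple_finite.
- move=> a u v Fu Fv; apply: (vlim_uniq (hE0 _ (FVl a _ _ Fu Fv))).
  by apply: vlim_lin; exact: hE0.
- by move=> u v _ _; exact: rnormD.
- by move=> a u _; exact: rnormZ.
- move=> b _ e e0; have e2 : 0 < e / 2 by rewrite divr_gt0.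
  have [xi Sxi bxi] := J_dense b e2; have [s fs hs] := Sxi _ e2.
  exists s => //; apply: (le_trans (rdist_triangle (J xi) _ _)); rewrite [e]splitr lerD//.
  have -> : J xi - J s = J (fun x => (-1) *: s x + xi x).
    by rewrite (J_lin _ (unif_simple_finite fs) Sxi) scaleN1r addrC.
  apply: (J_le_cst p1 uomega J_norm) (unif_simple_lin _ (unif_simple_finite fs) Sxi) _ (ltW e2).
  by apply: (@filterE _ omega) => n x _; rewrite scaleN1r addrC.
- by move=> u Fu; apply: vlim_le => //; exact: hE0.
exists E; split => [xi Sxi|a u v|b]; [|exact: El|exact: En].
(* The error is [e / 4] between the averages of [xi] and [s], [e / 4] for the convergence of the
   latter, and [2 * (e / 4)] between [E (J s)] and [E (J xi)], as [E] has bound 2. *)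
move=> e e0; have e4 : 0 < e / 4 by rewrite divr_gt0.
have [s fs hs] := Sxi _ e4; have /(_ _ e4) := hE0 _ fs; rewrite -EE//.
apply: (@filterS _ omega) => n h.
have Sd := unif_simple_lin (-1) (unif_simple_finite fs) Sxi.
have hd x : rnorm ((-1) *: s x + xi x) <= e / 4 by rewrite scaleN1r addrC.
have h1 : rnorm (vavg xi n - vavg s n) <= e / 4.
  have := vavg_lin (-1) s xi n; rewrite scaleN1r addrC => <-.
  by apply: vavg_le.
have h2 : rnorm (E (J s) - E (J xi)) <= 2 * (e / 4).
  rewrite rdistC; have := El (-1) (J s) (J xi) I I;
    rewrite !scaleN1r [- J s + _]addrC [- E _ + _]addrC => <-.
  rewrite (le_trans (En _ I))// ler_wpM2l//.
  have := J_lin (-1) (unif_simple_finite fs) Sxi; rewrite scaleN1r addrC => <-.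
  apply: (J_le_cst p1 uomega J_norm Sd _ (ltW e4)).
  by apply: (@filterE _ omega) => m x _; exact: hd.
apply: (le_trans (rdist_triangle (vavg s n) _ _)).
apply: (le_trans (lerD h1 (rdist_triangle (E (J s)) _ _))).
apply: (le_trans (lerD (lexx _) (lerD h h2))).
by move: (e) => r; lra.
Qed.

End Averaging.

(** * Displacement from a spectral gap *)

Section LinearMaps.
Variables (R : realType) (B B' : normedModType R[i]) (f : B -> B').
Hypothesis lf : linear f.
Local Notation C := R[i].

Lemma lin0 : f 0 = 0.
Proof. by have := lf (-1) 0 0; rewrite !scaleN1r !addNr. Qed.

Lemma linZ a v : f (a *: v) = a *: f v.
Proof. by have := lf a v 0; rewrite lin0 !addr0. Qed.

Lemma linB u v : f (u - v) = f u - f v.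
Proof. by have := lf (-1) v u; rewrite !scaleN1r [- v + _]addrC [- f v + _]addrC. Qed.

Lemma linD u v : f (u + v) = f u + f v.
Proof. by have := lf 1 u v; rewrite !scale1r. Qed.

Lemma rnorm_normalize (v : B) : v != 0 -> rnorm ((rnorm v)^-1%:C%C *: v) = 1.
Proof.
move=> v0; rewrite rnormZ rnormC_real ger0_norm ?invr_ge0 ?rnorm_ge0// mulVf//.
by apply: contra_neq v0; exact: rnorm_eq0.
Qed.

Lemma lin_normalize v : v != 0 -> rnorm (f v) = rnorm (f ((rnorm v)^-1%:C%C *: v)) * rnorm v.
Proof.
move=> v0; rewrite linZ rnormZ rnormC_real ger0_norm ?invr_ge0 ?rnorm_ge0// mulrAC mulVf ?mul1r//.
by apply: contra_neq v0; exact: rnorm_eq0.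
Qed.

(** Representations are only required to be continuous; this bound makes the supremum defining
    [opnorm] a true upper bound. *)
Lemma lin_continuous_bounded : continuous f ->
  exists K : R, forall v, rnorm v <= 1 -> rnorm (f v) <= K.
Proof.
move=> /(_ 0)/cvg_rnormP/(_ 1 ltr01); rewrite near_map lin0 => /nbhs_ballP[e /= e0 he].
have e0' : 0 < complex.Re e by case: (e) e0 => [a b]; rewrite ltcE/= => /andP[_].
have eE : e = (complex.Re e)%:C%C by rewrite RRe_real// gtr0_real.
pose r := complex.Re e / 2; have r0 : 0 < r by rewrite divr_gt0.
exists r^-1 => v v1.
have : rnorm (0 - f (r%:C%C *: v)) < 1.
  apply: he; rewrite -ball_normE /ball_/= eE ltr_rnormE sub0r rnormN rnormZ rnormC_real gtr0_norm//.
  apply: (@le_lt_trans _ _ r); first by rewrite ler_piMr// ltW.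
  by rewrite ltr_pdivrMr// mulr_natr mulr2n ltrDl.
rewrite sub0r rnormN linZ rnormZ rnormC_real gtr0_norm// => /ltW.
by rewrite -ler_pdivlMl// mulr1.
Qed.

End LinearMaps.

Lemma opnorm_bound (R : realType) (B : normedModType R[i]) (f : B -> B) v :
  linear f -> continuous f -> rnorm (f v) <= opnorm f * rnorm v.
Proof.
move=> lf cf; have [->|v0] := eqVneq v 0; first by rewrite lin0// rnorm0 mulr0.
rewrite lin_normalize// ler_wpM2r ?rnorm_ge0//; apply: ub_le_sup.
  by have [K hK] := lin_continuous_bounded lf cf; exists K => _ [u /= u1 <-]; exact: hK.
by eexists; [|reflexivity]; rewrite /= rnorm_normalize.
Qed.

Section RepFixed.
Variables (R : realType) (X : choiceType) (d : X -> X -> \bar R) (P : groupType).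
Variable M : translation_space d P.
Variables (B : normedModType R[i]) (rep : (X -> X -> R[i]) -> B -> B).
Hypothesis hrep : is_representation d rep.

Lemma rep_bound T v : Cu d T -> rnorm (rep T v) <= l1norm d T * rnorm v.
Proof.
move=> CT; have lT := rep_linear hrep CT; have cT := rep_continuous hrep CT.
apply: (le_trans (opnorm_bound v lT cT)); rewrite ler_wpM2r ?rnorm_ge0//.
exact: rep_norm hrep _ CT.
Qed.

Lemma rep_pmat_le A f v : covered M A f -> inj_on A f -> rnorm (rep (pmat R A f) v) <= rnorm v.
Proof.
move=> cf jf; apply: (le_trans (rep_bound v (pmat_Cu (R := R) cf))).
by rewrite -[leRHS]mul1r ler_wpM2r ?rnorm_ge0//; exact: (l1norm_le1 cf jf).
Qed.

Lemma pt_lin V : partial_translation d V ->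
  linear (rep V) /\ linear (rep (range_proj V)).
Proof.
move=> ptV; have [A [f [-> cf _]]] := pt_pmat M ptV; split.
  by apply: (rep_linear hrep); exact: (pmat_Cu (R := R) cf).
by rewrite (range_pmat R); apply: (rep_linear hrep); exact: (pmat_Cu (R := R) (covered_id M A)).
Qed.

Lemma rep_fixed0 : rep_fixed d rep 0.
Proof. by move=> V ptV; have [l1 l2] := pt_lin ptV; rewrite !lin0. Qed.

Lemma rep_fixedZ a w : rep_fixed d rep w -> rep_fixed d rep (a *: w).
Proof. by move=> hw V ptV; have [l1 l2] := pt_lin ptV; rewrite !linZ// hw. Qed.

End RepFixed.

(** The conclusion concerns a finite list [F] independent of [v], in the true norm and not modulo
    invariant vectors. This is possible since the gap bounds a quotient norm from below, which the
    norm dominates. *)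
Lemma spectral_gap_displacement (R : realType) (p : R) (omega : set_system nat)
    (X : choiceType) (d : X -> X -> \bar R) (P : groupType) (M : translation_space d P)
    (E0 : set (X * X)) (B : completeNormedModType R[i]) (sigma : P -> B -> B) :
  1 <= p -> UltraFilter omega -> is_entourage d E0 -> geometric_T d E0 (is_Lp_space p) ->
  is_Lp_space p B -> (forall a, linear (sigma a)) ->
  (forall a v, rnorm (sigma a v) = rnorm v) ->
  (forall a b v, sigma (a * b)%g v = sigma a (sigma b v)) ->
  (forall a, most omega (piece M) (fun x => act M a x = x -> forall v, sigma a v = v)) ->
  exists (F : seq P) (c : R), 0 < c /\
    forall v, qnorm [set v | forall a, sigma a v = v] v = 1 ->
      exists2 a, a \in F & c <= rnorm (sigma a v - v).
Proof.
move=> p1 uomega entE0 gT LB sl sn sM sfix.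
have [d0 [T [mu [Phi [Phi1 Phi2 Phi3 Phi4]]]]] := LB.
have [D [J [LD J_lin J_norm J_dense]]] :=
  bochner_space p1 uomega (mem_enum_piece M) (enum_piece_gt0 M) Phi1 Phi2 Phi3 Phi4.
have [ch chP] := uniform_choice M.
have [rep [hrep repE]] := rep_ex p1 uomega sl sn sM sfix J_lin J_norm J_dense chP.
have [E [EJ lE bE]] := mean_op p1 uomega J_lin J_norm J_dense.
have [c c0 hc] := gT D LD rep hrep.
have [F _ hF] := chP E0 entE0.
(* [F] holds the values of the choice function on [E0]. The averaging map has bound 2, so the
   constant function [v] stays at distance [t >= 1/2] from the invariant vectors; normalizing at
   most doubles its displacement, and [2 * (c / 4) < c]. *)
exists F, (c / 4); split; first by rewrite divr_gt0.
move=> v v1; apply/not_exists2P => hv.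
pose W := [set v | forall a, sigma a v = v]; pose Wr := rep_fixed d rep.
have Wr0 : Wr !=set0 by exists 0; exact: (rep_fixed0 M hrep).
(* The full translation by [a] is a partial translation with range projection 1, so it fixes [w];
   and [E] intertwines it with [sigma a], as is checked on the dense vectors [J xi]. *)
have EW w : Wr w -> W (E w).
  move=> hw a; have ca := covered_act M setT a.
  have ja : inj_on setT (act M a) by move=> x y _ _; exact: act_inj.
  have := hw _ (pmat_pt (R := R) ca ja).
  rewrite range_pmat -mone_pmat (rep_one hrep) => hw'.
  have lr : linear (rep (pmat R setT (act M a))).
    by apply: (rep_linear hrep); exact: (pmat_Cu (R := R) ca).
  rewrite -{2}hw'.
  have h : (sigma a \o E) =1 (E \o rep (pmat R setT (act M a))); last exact: h.
  have lsE : linear (sigma a \o E) by move=> z u u' /=; rewrite lE sl.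
  have lEr : linear (E \o rep (pmat R setT (act M a))) by move=> z u u' /=; rewrite lr lE.
  apply: (lin_dense_eq J_dense (K := 2) (L := 2) lsE lEr) => [u|u|xi Sxi] /=.
  - by rewrite sn.
  - by apply: (le_trans (bE _)); rewrite ler_wpM2l//; exact: (rep_pmat_le hrep _ ca ja).
  rewrite repE//; last exact: (pmat_Cu (R := R) ca).
  have Sc := unif_simple_conv sl sn chP (pmat_Cu (R := R) ca) Sxi.
  have Se : unif_simple (fun x => sigma a (xi (act M a x))).
    by apply: (unif_simple_map _ (unif_simple_comp _ Sxi)) => u u'; rewrite -(linB (sl a)) sn.
  rewrite (J_most p1 uomega J_lin J_norm Sc Se).
    apply: (vlim_uniq uomega (M := M) (xi := fun x => sigma a (xi (act M a x)))).
      by apply: (vlim_act uomega sl sn); exact: EJ.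
    exact: EJ.
  apply: (mostS uomega _ (transport_most uomega sM sfix chP a)) => x kx.
  by rewrite conv_pmat// in_setT kx.
pose xi := fun _ : X => v; have Sxi : unif_simple xi := unif_simple_cst X v.
pose b := J xi; pose t := qnorm Wr b.
have Eb : E b = v by apply: (vlim_uniq uomega (EJ _ Sxi)); exact: (vlim_cst uomega M v).
have t2 : 2^-1 <= t.
  apply: qnorm_ge => // w Ww; rewrite -[leLHS]mulr1 ler_pdivrMl//.
  have h : 1 <= rnorm (v - E w) by rewrite -v1; exact: qnorm_le (EW w Ww).
  by apply: (le_trans h); rewrite -Eb -(linB lE).
have t0 : 0 < t by apply: lt_le_trans t2; rewrite invr_gt0.
have ti0 : 0 < t^-1 by rewrite invr_gt0.
have WrZ := @rep_fixedZ _ _ _ _ M _ _ hrep.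
have b1 : qnorm Wr (t^-1%:C%C *: b) = 1 by rewrite qnormZ// mulVf// gt_eqF.
have [V [ptV VE0]] := hc _ b1.
have [l1 l2] := pt_lin M hrep ptV.
rewrite (linZ l1) (linZ l2) -scalerBr qnormZ//.
have [A [f [VE cf jf]]] := pt_pmat M ptV.
suff h : rnorm (rep V b - rep (range_proj V) b) <= c / 4.
  apply/negP; rewrite -ltNge; apply: (@le_lt_trans _ _ (2 * (c / 4))); last first.
    by move: c0; clear; lra.
  rewrite ler_pM//; first by rewrite ltW.
  - by apply: qnorm_ge => // w _; exact: rnorm_ge0.
  - by rewrite -(invrK 2) lef_pV2 ?posrE// invr_gt0.
  by apply: le_trans h; rewrite -[X in rnorm X]subr0; apply: qnorm_le; exact: (rep_fixed0 M hrep).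
have CV := pmat_Cu (R := R) cf; have CA := pmat_Cu (R := R) (covered_id M A).
rewrite VE range_pmat !repE//.
have SV := unif_simple_conv sl sn chP CV Sxi; have SA := unif_simple_conv sl sn chP CA Sxi.
rewrite addrC -scaleN1r -J_lin//.
apply: (J_le_cst p1 uomega J_norm (unif_simple_lin _ SA SV)); last by rewrite divr_ge0// ltW.
have k1 := transport_most uomega sM sfix chP 1%g.
apply: (mostS uomega _ k1) => x kx; rewrite scaleN1r addrC !conv_pmat//; last exact: covered_id.
case: ifPn => [/set_mem Ax|_]; last by rewrite subrr rnorm0 divr_ge0// ltW.
have [cF _] : ch x (f x) \in F /\ f x = act M (ch x (f x)) x.
  by apply: hF; apply: VE0; rewrite /supp/= VE pmat_neq0 mem_set//= eqxx.
rewrite act1 in kx; rewrite /id kx (sigma1 sl sn sM) leNgt; apply/negP => /ltW hx.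
by have [|] := hv (ch x (f x)).
Qed.

(** * Isometric actions *)

Section IsometricActions.
Variables (R : realType) (G : groupType) (B : normedModType R[i]) (rho : G -> B -> B).
Hypothesis hrho : is_isometric_action rho.

Lemma iso_lin g : linear (rho g). Proof. by have [] := hrho.1 g. Qed.

Lemma iso_rnorm g v : rnorm (rho g v) = rnorm v.
Proof. by have [_ _ h] := hrho.1 g; apply: (@complexI R); rewrite -!rnormE. Qed.

Lemma isoM g h v : rho (g * h)%g v = rho g (rho h v).
Proof. by rewrite hrho.2. Qed.

Lemma iso1 v : rho 1%g v = v.
Proof.
have h : rho 1%g (rho 1%g v - v) = 0 by rewrite (linB (iso_lin _)) -isoM mulg1 subrr.
by apply/eqP; rewrite -subr_eq0; apply/eqP/rnorm_eq0; rewrite -(iso_rnorm 1%g) h rnorm0.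
Qed.

Lemma act_fixed0 : act_fixed rho 0.
Proof. by move=> g; rewrite (lin0 (iso_lin g)). Qed.

(* Iterating [g], the displacement of [v] by [g ^+ n] is close to [n] times
   the fixed vector [w], while it stays bounded. *)
Lemma drift_le g v w (e : R) : act_fixed rho w -> rnorm (rho g v - v - w) <= e ->
  rnorm w <= e.
Proof.
move=> fw h; have it n : rnorm (iter n (rho g) v - v - w *+ n) <= e *+ n.
  elim: n => [|n IH]; first by rewrite /= subrr mulr0n subr0 rnorm0.
  have -> : iter n.+1 (rho g) v - v - w *+ n.+1 =
      rho g (iter n (rho g) v - v - w *+ n) + (rho g v - v - w).
    have wn : rho g (w *+ n) = w *+ n.
      elim: n {IH} => [|n IH]; first by rewrite mulr0n (lin0 (iso_lin g)).
      by rewrite mulrS (linD (iso_lin g)) fw IH.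
    rewrite !(linB (iso_lin g)) wn iterS mulrS addrACA.
    by rewrite [rho g _ - rho g v + _]addrA subrK -opprD [w + _]addrC.
  by apply: (le_trans (rnormD _ _)); rewrite iso_rnorm mulrS addrC lerD.
have nit n : rnorm (iter n (rho g) v) = rnorm v.
  by elim: n => //= n IH; rewrite iso_rnorm.
rewrite leNgt; apply/negP => ew.
have dlt : 0 < rnorm w - e by rewrite subr_gt0.
pose n := (Num.trunc ((rnorm v + rnorm v) / (rnorm w - e))).+1.
have : (rnorm v + rnorm v) / (rnorm w - e) < n%:R by exact: truncnS_gt.
rewrite ltr_pdivrMr// mulrBr => hn.
have nw : rnorm (w *+ n) = n%:R * rnorm w.
  by rewrite -scaler_nat rnormZ -(rmorph_nat (real_complex R)) rnormC_real ger0_norm.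
have : rnorm (w *+ n) <= e *+ n + (rnorm v + rnorm v).
  have -> : w *+ n = - (iter n (rho g) v - v - w *+ n) + (iter n (rho g) v - v) by rewrite opprB
    subrK.
  apply: (le_trans (rnormD _ _)); rewrite rnormN lerD//.
  by apply: (le_trans (rnormB _ _)); rewrite nit.
by rewrite nw -[e *+ n]mulr_natl leNgt -ltrBrDl hn.
Qed.

Lemma word_displacement (S : {fset G}) w g v (e : R) : 0 <= e -> is_word S w g ->
  (forall s, s \in S -> rnorm (rho s v - v) <= e) -> rnorm (rho g v - v) <= e *+ size w.
Proof.
move=> e0 [+ <-] hS; elim: w => [|s w IH] hw; first by rewrite big_nil iso1 subrr rnorm0.
rewrite big_cons isoM /= mulrSr.
apply: (le_trans (rdist_triangle (rho s v) _ _)); rewrite -(linB (iso_lin s)) iso_rnorm.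
apply: lerD; last by apply: hS; apply: hw; rewrite mem_head.
by apply: IH => t tw; apply: hw; rewrite inE tw orbT.
Qed.

Lemma sup_displacement (S : {fset G}) (W : set B) v (c : R) :
  sup [set qnorm W (rho g v - v) | g in [set` S]] <= c ->
  forall g, g \in S -> qnorm W (rho g v - v) <= c.
Proof.
move=> h g gS; apply: le_trans h; apply: ub_le_sup; last by exists g.
exists (\sum_(h <- S) `|qnorm W (rho h v - v)|) => _ [h hS <-].
rewrite (bigD1_seq h) ?fset_uniq//=; apply: (le_trans (ler_norm _)).
by rewrite lerDl sumr_ge0.
Qed.

(** [drift_le] upgrades a small displacement modulo fixed vectors to one in norm. The elements of
    [F] are then reached by words of bounded length in the arbitrary generating set [S]. *)
Lemma displacement_T (P : groupType) (q : P -> G) (S : {fset G}) (F : seq P) (c : R) :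
  (forall g, exists a, q a = g) -> sym_gen_set S -> 0 < c ->
  (forall v, qnorm [set v | forall a, rho (q a) v = v] v = 1 ->
    exists2 a, a \in F & c <= rnorm (rho (q a) v - v)) ->
  exists2 c' : R, 0 < c' & forall v : B, qnorm (act_fixed rho) v = 1 ->
      ~ (sup [set qnorm (act_fixed rho) (rho g v - v) | g in [set` S]] <= c').
Proof.
move=> qs [Ssym Sgen] c0 hF.
have WE : [set v | forall a, rho (q a) v = v] = act_fixed rho.
  by apply/seteqP; split => v h g //; have [a <-] := qs g.
rewrite WE in hF.
have [K hK] : exists K : nat, forall a, a \in F -> exists2 w, is_word S w (q a) & (size w <= K)%N.
  elim: F {hF} => [|a F [K IH]]; first by exists 0%N.
  have [w hw] := Sgen (q a); exists (maxn K (size w)) => b;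
    rewrite inE => /orP[/eqP ->|/IH[w' h1 h2]].
    by exists w; rewrite // leq_maxr.
  by exists w' => //; rewrite leq_max h2.
(* A displacement within [2 * e] of a fixed vector [w] has norm below [4 * e], as [w] itself has
   norm at most [2 * e]. Words of length at most [K] then displace by at most
   [4 * e * K.+1 = c / 2]. *)
pose e := c / (8 * (K.+1)%:R).
have e0 : 0 < e by rewrite divr_gt0// mulr_gt0// ltr0n.
exists e => // v v1 hsup.
have small g : g \in S -> rnorm (rho g v - v) <= 4 * e.
  move=> /(sup_displacement hsup) he.
  have he2 : qnorm (act_fixed rho) (rho g v - v) < 2 * e.
    by apply: (le_lt_trans he); rewrite mulr_natl mulr2n ltrDl.
  have [w Ww hw] := qnorm_lt (ex_intro _ 0 act_fixed0) he2.
  have w2 := drift_le Ww (ltW hw).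
  rewrite -(subrK w (rho g v - v)) (le_trans (rnormD _ _))//.
  have -> : 4 * e = 2 * e + 2 * e by ring.
  by rewrite lerD// ltW.
have [a aF] := hF v v1; have [w hw wK] := hK a aF.
have e4 : 0 <= 4 * e by rewrite mulr_ge0// ltW.
apply/negP; rewrite -ltNge; apply: (le_lt_trans (word_displacement e4 hw small)).
apply: (@le_lt_trans _ _ (4 * e *+ K.+1)).
  by apply: ler_wpMn2l => //; exact: leqW.
rewrite -mulr_natr /e; have K0 : 0 < (K.+1)%:R :> R by rewrite ltr0n.
have -> : 4 * (c / (8 * K.+1%:R)) * K.+1%:R = c / 2.
  by field; rewrite gt_eqF.
by rewrite ltr_pdivrMr// mulr_natr mulr2n ltrDl.
Qed.

End IsometricActions.

(** * Spectral gap from displacement *)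

Section RepCalculus.
Variables (R : realType) (X : choiceType) (d : X -> X -> \bar R) (P : groupType).
Variable M : translation_space d P.
Variables (B : normedModType R[i]) (rep : (X -> X -> R[i]) -> B -> B).
Hypothesis hrep : is_representation d rep.
Local Notation tau := (act M).
Local Notation tg := (piece M).
Local Notation cov := (covered M).
Local Notation r A f := (rep (pmat R A f)).
Implicit Types (A : set X) (f : X -> X) (v w : B).

Lemma rep_pmat_linear A f : cov A f -> linear (r A f).
Proof. by move=> cf; apply: (rep_linear hrep); exact: (pmat_Cu cf). Qed.

Lemma rep_pmatM A f A' f' v : cov A f -> cov A' f' ->
  r A f (r A' f' v) = r [set x | A x /\ A' (f x)] (f' \o f) v.
Proof.
move=> cf cf'; rewrite -(pmatM (R := R) _ _ cf).
by rewrite (rep_mul hrep (pmat_Cu (R := R) cf) (pmat_Cu (R := R) cf')).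
Qed.

Lemma rep_pmat1 v : r setT id v = v.
Proof. by rewrite -mone_pmat (rep_one hrep). Qed.

Lemma rep_pmat_eq A f A' f' v : (forall x, A x <-> A' x) -> (forall x, A x -> f x = f' x) ->
  r A f v = r A' f' v.
Proof. by move=> h h'; congr (rep _ v); exact: pmat_eq. Qed.

Lemma rep_pmat_split A f Q v : cov A f ->
  r A f v = r [set x | A x /\ Q x] f v + r [set x | A x /\ ~ Q x] f v.
Proof.
move=> cf.
have c1 : cov [set x | A x /\ Q x] f by apply: covered_sub cf => x [].
have c2 : cov [set x | A x /\ ~ Q x] f by apply: covered_sub cf => x [].
have := rep_lin hrep 1 (pmat_Cu (R := R) c1) (pmat_Cu (R := R) c2).
move=> /(congr1 (fun F => F v)); rewrite scale1r => <-; congr (rep _ v).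
apply/funext => x; apply/funext => y; rewrite /pmat mul1r.
have [Ax|nAx] := pselect (A x); last first.
  by rewrite !memNset ?addr0// => -[].
have [Qx|nQx] := pselect (Q x).
  rewrite (mem_set Ax) [x \in [set x | A x /\ Q x]]mem_set//.
  by rewrite [x \in [set x | A x /\ ~ Q x]]memNset ?addr0// => -[].
rewrite (mem_set Ax) [x \in [set x | A x /\ ~ Q x]]mem_set//.
by rewrite [x \in [set x | A x /\ Q x]]memNset ?add0r// => -[].
Qed.

(** An empty set splits into two copies of itself, so the vector equals its own double. *)
Lemma rep_pmat0 A f v : (forall x, ~ A x) -> r A f v = 0.
Proof.
move=> nA; have cf : cov A f by exists [::] => x /nA.
have := rep_pmat_split (fun=> True) v cf; rewrite [X in _ = X + _](@rep_pmat_eq _ _ A f);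
  last 2 first.
- by move=> x; split => // -[].
- by [].
rewrite [X in _ = _ + X](@rep_pmat_eq _ _ A f); last 2 first.
- by move=> x; split => [[]|/nA].
- by [].
by move=> /eqP; rewrite -{1}[r A f v]addr0 (inj_eq (addrI _)) eq_sym => /eqP.
Qed.

Lemma rep_pmat_sum (I : eqType) (F : seq I) (k : X -> I) A f v : uniq F ->
  (forall x, A x -> k x \in F) -> cov A f ->
  r A f v = \sum_(a <- F) r [set x | A x /\ k x = a] f v.
Proof.
elim: F A => [|a F IH] A /=; first by move=> _ kF _; rewrite big_nil rep_pmat0// => x /kF.
move=> /andP[aF uF] kF cf; rewrite big_cons (rep_pmat_split (fun x => k x = a) v cf); congr (_ + _).
have cf' : cov [set x | A x /\ k x <> a] f by apply: covered_sub cf => x [].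
rewrite (IH _ uF _ cf') => [|x [Ax kx]]; last first.
  by have := kF x Ax; rewrite inE => /orP[/eqP|].
apply: eq_big_seq => b bF; apply: rep_pmat_eq => // x /=.
split=> [[[]]//|[Ax kb]]; do 2!split=> //; move=> ka.
by move: aF; rewrite -ka kb bF.
Qed.

Definition translate g := r setT (tau g).

Lemma inj_act A g : inj_on A (tau g).
Proof. by move=> x y _ _; exact: act_inj. Qed.

Lemma translateM g h v : translate (g * h)%g v = translate g (translate h v).
Proof.
rewrite /translate rep_pmatM; [|exact: covered_act|exact: covered_act].
by apply: rep_pmat_eq => // x _; rewrite actM.
Qed.

Lemma translate1 v : translate 1%g v = v.
Proof. by rewrite -[RHS]rep_pmat1; apply: rep_pmat_eq => // x _; rewrite act1. Qed.

(** A translation and its inverse are both contractions. *)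
Lemma translate_iso : is_isometric_action translate.
Proof.
split=> [g|g h]; last by apply/funext => v; exact: translateM.
split; first by apply: rep_pmat_linear; exact: covered_act.
  exists (translate g^-1%g) => v.
    by rewrite -translateM mulVg translate1.
  by rewrite -translateM mulgV translate1.
move=> v; rewrite !rnormE; congr (_%:C%C); apply/eqP; rewrite eq_le.
have le h u : rnorm (translate h u) <= rnorm u.
  by apply: (rep_pmat_le hrep _ (covered_act M setT h)); exact: inj_act.
by rewrite le/= -{1}(translate1 v) -(mulVg g) translateM le.
Qed.

Lemma fixedP w : rep_fixed d rep w <-> forall A f, cov A f -> inj_on A f -> r A f w = r A id w.
Proof.
split=> [fw A f cf jf|fw V ptV].
  by rewrite (fw _ (pmat_pt (R := R) cf jf)) range_pmat.
by have [A [f [-> cf jf]]] := pt_pmat M ptV; rewrite range_pmat; exact: fw.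
Qed.

(** A partial translation is cut into finitely many parts on which it agrees with a group element
    [a]. On such a part it acts as [a] followed by the projection, so it acts as the projection
    alone on a fixed vector. *)
Lemma translate_fixed : act_fixed translate = rep_fixed d rep.
Proof.
apply/seteqP; split => w.
  move=> fw; apply/fixedP => A f cf jf; have [F hF] := cf.
  have /choice[k hk] : forall x, exists a, A x -> a \in F /\ f x = tau a x.
    by move=> x; have [/hF[a aF fx]|nA] := pselect (A x); [exists a|exists 1%g].
  have uF := undup_uniq F.
  have kF x : A x -> k x \in undup F by move=> /hk[+ _]; rewrite mem_undup.
  rewrite (rep_pmat_sum w uF kF cf) (rep_pmat_sum w uF kF (covered_id M A)); apply: eq_bigr => a _.
  rewrite -{2}(fw a) rep_pmatM; [|exact: covered_id|exact: covered_act].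
  by apply: rep_pmat_eq => x; [split=> [//|[]]|move=> [/hk[_ ->] <-]].
move=> /fixedP fw g; rewrite /translate fw ?rep_pmat1//; [exact: covered_act|exact: inj_act].
Qed.

Definition defect A f v := r A f v - r A id v.

Lemma defect_cut A f Q v : cov A f ->
  r Q id (defect A f v) = defect [set x | A x /\ Q x] f v.
Proof.
move=> cf; have cQ := covered_id M Q; have cA := covered_id M A.
rewrite /defect (linB (rep_pmat_linear cQ)) !rep_pmatM//; congr (_ - _);
  apply: rep_pmat_eq => // x /=.
  by split=> -[].
by split=> -[].
Qed.

(** * From defects modulo invariant vectors to defects in norm *)

Section Cut.
Variables (E0 : set (X * X)) (e : R) (v : B) (kappa : X -> X).
Hypothesis small : forall V, partial_translation d V -> supp V `<=` E0 ->
  qnorm (rep_fixed d rep) (rep V v - rep (range_proj V) v) < e.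
Hypothesis kappa_inj : injective kappa.
Hypothesis kappa_cov : cov setT kappa.
Hypothesis kappa_fix : forall x, kappa x = x -> forall y, tg y = tg x -> y = x.

Let sub_E0 A f := forall x, A x -> E0 (x, f x).

Let small_pmat A f : cov A f -> inj_on A f -> sub_E0 A f ->
  exists2 w, rep_fixed d rep w & rnorm (defect A f v - w) < e.
Proof.
move=> cf jf sA; have := small (pmat_pt (R := R) cf jf).
rewrite range_pmat => h; apply: qnorm_lt; first by exists 0; exact: (rep_fixed0 M hrep).
by apply: h => -[x y]; rewrite /supp/= pmat_neq0 => /andP[/set_mem Ax /eqP ->]; exact: sA.
Qed.

(* [w] is invariant, so it is moved off [A] by [kappa] without change, while
   the defect is carried by [A]. *)
Lemma defect_disjoint A f : cov A f -> inj_on A f -> sub_E0 A f ->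
  (forall x, A x -> ~ A (kappa x)) -> rnorm (defect A f v) <= e + e.
Proof.
move=> cf jf sA Ak; have [w /fixedP fw hw] := small_pmat cf jf sA.
have cA := covered_id M A; have ck : cov A kappa by apply: covered_sub kappa_cov.
have jA : inj_on A id by [].
have jk : inj_on A kappa by move=> x y _ _; exact: kappa_inj.
set y := defect A f v in hw *.
have yA : r A id y = y.
  by rewrite /y defect_cut// /defect; congr (_ - _); apply: rep_pmat_eq => // x; split=> [[]|].
have ky : r A kappa y = 0.
  by rewrite -yA rep_pmatM//; apply: rep_pmat0 => x [/Ak].
have -> : y = r A id (y - w) + (r A kappa w - r A kappa y).
  by rewrite (linB (rep_pmat_linear cA)) (fw _ _ ck jk) ky subr0 subrK yA.
rewrite -(linB (rep_pmat_linear ck)) (le_trans (rnormD _ _))// lerD//.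
  by apply: (le_trans (rep_pmat_le hrep _ cA jA)); exact: ltW.
by apply: (le_trans (rep_pmat_le hrep _ ck jk)); rewrite rdistC ltW.
Qed.

(** In the manner of Katetov's three-set lemma: [A] is maximal among the sets disjoint from their
    image, and the other two are its preimage and its image. A moved point outside all three could
    be added to [A]. *)
Lemma three_sets : exists A1 A2 A3 : set X,
  [/\ forall x, A1 x -> ~ A1 (kappa x), forall x, A2 x -> ~ A2 (kappa x),
      forall x, A3 x -> ~ A3 (kappa x) &
      forall x, kappa x <> x -> [\/ A1 x, A2 x | A3 x]].
Proof.
pose free (A : set X) := forall x, A x -> ~ A (kappa x).
have [A [fA maxA]] : exists A, free A /\ forall A', A `<` A' -> ~ free A'.
  apply: Zorn_bigcup => F Ffree Ftot x [A1 FA1 A1x] [A2 FA2 A2k].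
  by have [h|h] := Ftot _ _ FA1 FA2;
    [apply: (Ffree _ FA2 _ (h _ A1x))|apply: (Ffree _ FA1 _ A1x); exact: h].
exists A, (kappa @^-1` A), (kappa @` A); split => //.
- by move=> x /= /fA.
- by move=> _ [x Ax <-] [y Ay /kappa_inj yk]; apply: (fA x Ax); rewrite -yk.
move=> x kx; have [Ax|nAx] := pselect (A x); first exact: Or31.
have [Akx|nAkx] := pselect (A (kappa x)); first exact: Or32.
apply: Or33; apply: contrapT => nk.
have /maxA : A `<` A `|` [set x].
  by split; [move=> y; left|move=> /(_ x) h; apply: nAx; apply: h; right].
apply=> y [Ay|/= ->] [Aky|/= kyx].
- exact: fA Aky.
- by apply: nk; exists y.
- exact: nAkx.
- exact: kx.
Qed.

(** Each of the three sets contributes [e + e] through [defect_disjoint]; they are removed one after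
    the other to make the parts disjoint. *)
Lemma defect_E0 A f : cov A f -> inj_on A f -> sub_E0 A f -> rnorm (defect A f v) <= 6 * e.
Proof.
move=> cf jf sA; have [A1 [A2 [A3 [h1 h2 h3 hk]]]] := three_sets.
have e0 : 0 <= e.
  have [|||w _ hw] := @small_pmat set0 id; [exact: covered_id|by []|by []|].
  by apply: (le_trans (rnorm_ge0 _)); exact: ltW hw.
have part Q (AQ : set X) : (forall x, Q x -> AQ x) -> (forall x, AQ x -> ~ AQ (kappa x)) ->
    rnorm (defect [set x | A x /\ Q x] f v) <= e + e.
  move=> QA hQ; apply: defect_disjoint.
  - by apply: covered_sub cf => x [].
  - by apply: inj_sub jf => x [].
  - by move=> x [/sA].
  - by move=> x [_ /QA/hQ h] [_ /QA].
have split_defect (A' Q : set X) : cov A' f -> defect A' f v =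
    defect [set x | A' x /\ Q x] f v + defect [set x | A' x /\ ~ Q x] f v.
  move=> cA'; rewrite /defect (rep_pmat_split Q v cA') (rep_pmat_split Q v (covered_id M A')).
  by rewrite opprD addrACA.
pose D1 := [set x | A x /\ ~ A1 x]; pose D2 := [set x | D1 x /\ ~ A2 x].
pose D3 := [set x | D2 x /\ ~ A3 x].
have c1 : cov D1 f by apply: covered_sub cf => x [].
have c2 : cov D2 f by apply: covered_sub c1 => x [].
rewrite (split_defect _ A1 cf) -/D1 (split_defect _ A2 c1) -/D2 (split_defect _ A3 c2) -/D3.
(* What is left consists of points fixed by [kappa], which are alone in their piece; as [f]
   preserves pieces, it is the identity there. *)
have -> : defect D3 f v = 0.
  apply/eqP; rewrite subr_eq0; apply/eqP/rep_pmat_eq => // x [[[Ax n1] n2] n3].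
  have kx : kappa x = x by apply: contrapT => /hk[].
  by apply: (kappa_fix kx); have [F hF] := cf; have [a _ ->] := hF _ Ax; rewrite act_piece.
have b1 := part A1 A1 (fun x h => h) h1.
have b2 : rnorm (defect [set x | D1 x /\ A2 x] f v) <= e + e.
  have := part [set x | A2 x /\ ~ A1 x] A2 (fun x h => h.1) h2; congr (rnorm _ <= _).
  by congr (_ - _); apply: rep_pmat_eq => // x; split=> [[Ax [a2 a1]]|[[Ax a1] a2]]; do ?split.
have b3 : rnorm (defect [set x | D2 x /\ A3 x] f v) <= e + e.
  have := part [set x | A3 x /\ ~ A2 x /\ ~ A1 x] A3 (fun x h => h.1) h3; congr (rnorm _ <= _).
  by congr (_ - _); apply: rep_pmat_eq => // x; split=> [[Ax [a3 [a2 a1]]]|[[[Ax a1] a2] a3]];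
    do ?split.
rewrite addr0; apply: (le_trans (rnormD _ _)); apply: (le_trans (lerD b1 (rnormD _ _))).
apply: (le_trans (lerD (lexx _) (lerD b2 b3))).
by rewrite le_eqVlt; apply/orP; left; apply/eqP; ring.
Qed.

End Cut.

(** The domain is cut by the element [a] leading to the intermediate point. On a part, [f] is
    [tau a], with graph in the previous iterate, followed by a map [g] with graph in [E0]. The
    defect is that of [tau a] plus a contraction of that of [g], so each part costs [K + 6]. The
    constant does not depend on [v] or [e]. *)
Lemma defect_iter (E0 : set (X * X)) (kappa : X -> X) n : injective kappa -> cov setT kappa ->
  (forall x, kappa x = x -> forall y, tg y = tg x -> y = x) -> is_entourage d E0 ->
  is_entourage d (iter n (fun D => (E0 \; D)%relation) E0) /\
  exists2 K : R, 0 <= K & forall (e : R) v,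
    (forall V, partial_translation d V -> supp V `<=` E0 ->
      qnorm (rep_fixed d rep) (rep V v - rep (range_proj V) v) < e) ->
    forall A f, cov A f -> inj_on A f ->
    (forall x, A x -> iter n (fun D => (E0 \; D)%relation) E0 (x, f x)) ->
    rnorm (defect A f v) <= K * e.
Proof.
move=> ki kc kf entE0; elim: n => [|n [entD [K K0 hK]]].
  by split=> //; exists 6 => // e v small A f cf jf sA; exact: (defect_E0 small ki kc kf).
rewrite iterS; set D := iter n _ E0 in entD hK *.
have /(entourageP M)[F hF] := entD; have /(entourageP M)[G hG] := entE0.
split.
  apply/(entourageP M);
    exists [seq (a * b)%g | a <- F, b <- G] => x y [z /= /hF[a aF ->] /hG[b bG ->]].
  by exists (a * b)%g; [exact: allpairs_f|rewrite actM].
exists ((K + 6) *+ size (undup F)); first by rewrite mulrn_wge0// addr_ge0.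
move=> e v small A f cf jf sA.
have /choice[k hk] : forall x, exists a, A x -> [/\ a \in F, D (x, tau a x) & E0 (tau a x, f x)].
  move=> x; have [/sA[z /= Dz Ez]|nA] := pselect (A x); last by exists 1%g.
  by have [a aF za] := hF _ _ Dz; exists a => _; rewrite -za.
have kF x : A x -> k x \in undup F by move=> /hk[+ _ _]; rewrite mem_undup.
have uF := undup_uniq F.
have -> : defect A f v = \sum_(a <- undup F) defect [set x | A x /\ k x = a] f v.
  by rewrite /defect (rep_pmat_sum v uF kF cf) (rep_pmat_sum v uF kF (covered_id M A)) sumrB.
have bound a : rnorm (defect [set x | A x /\ k x = a] f v) <= (K + 6) * e.
  set A' := [set x | _]; pose g := f \o tau a^-1%g; pose B' := [set y | A' (tau a^-1%g y)].
  have cA' : cov A' (tau a) by exact: covered_act.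
  have jA' : inj_on A' (tau a) by exact: inj_act.
  have cg : cov B' g.
    have [H hH] := cf; exists [seq (a^-1 * b)%g | b <- H] => y [By _] /=.
    have [b bH fE] := hH _ By; exists (a^-1 * b)%g; first exact: map_f.
    by rewrite /g/= fE actM.
  have jg : inj_on B' g.
    by move=> y y' [By _] [By' _] /(jf _ _ By By') /act_inj.
  have -> : defect A' f v = r A' (tau a) (defect B' g v) + defect A' (tau a) v.
    have cB := covered_id M B'.
    rewrite /defect (linB (rep_pmat_linear cA')) !rep_pmatM// addrA.
    rewrite (@rep_pmat_eq _ (g \o tau a) A' f); last 2 first.
    - by move=> x /=; rewrite /B'/= actK; split=> // -[].
    - by move=> x _; rewrite /g/= actK.
    rewrite (@rep_pmat_eq _ (id \o tau a) A' (tau a)) ?subrK// => x /=.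
    by rewrite /B'/= actK; split=> // -[].
  rewrite mulrDl addrC (le_trans (rnormD _ _))// lerD//.
    by apply: (hK _ _ small) => // x [Ax kx]; have [_ + _] := hk _ Ax; rewrite kx.
  apply: (le_trans (rep_pmat_le hrep _ cA' jA'));
    apply: (defect_E0 small ki kc kf cg jg) => y [By ky].
  by have [_ _] := hk _ By; rewrite ky /g/= actVK.
apply: (le_trans (rnorm_sum _ _ _)); apply: (le_trans (ler_sum _ (fun a _ => bound a))).
by rewrite big_const_seq count_predT iter_addr_0 mulrnAl.
Qed.

End RepCalculus.

(** On each piece one generator moving some point is used; by the first hypothesis on the action it
    moves every point of that piece. If all generators fix the piece pointwise, transitivity makes
    it a single point. *)
Lemma moving_map (R : realType) (X : choiceType) (d : X -> X -> \bar R) (P : groupType)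
    (M : translation_space d P) (S : {fset P}) : sym_gen_set S ->
  (forall a x y, act M a x = x -> piece M y = piece M x -> act M a y = y) ->
  (forall x y, piece M y = piece M x -> exists a, y = act M a x) ->
  exists kappa : X -> X, [/\ injective kappa, covered M setT kappa &
    forall x, kappa x = x -> forall y, piece M y = piece M x -> y = x].
Proof.
move=> [_ Sgen] free trans.
have /choice[s hs] : forall n, exists a, (a \in S \/ a = 1%g) /\
    ((exists2 x, piece M x = n & act M a x <> x) \/
     forall b x, b \in S -> piece M x = n -> act M b x = x).
  move=> n; have [[b [bS mv]]|h] := pselect (exists b, b \in S /\
      exists2 x, piece M x = n & act M b x <> x).
    by exists b; split; left.
  exists 1%g; split; first by right.
  right=> b x bS xn; apply: contrapT => bx; apply: h.
  by exists b; split => //; exists x.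
exists (fun x => act M (s (piece M x)) x); split.
- move=> x y xy; have pxy : piece M x = piece M y.
    by have := congr1 (piece M) xy; rewrite !act_piece.
  by move: xy; rewrite pxy => /act_inj.
- exists (1%g :: S) => x _; exists (s (piece M x)) => //.
  by have [[sS|->] _] := hs (piece M x); rewrite inE ?eqxx// sS orbT.
move=> x sx y yx; have [_ [[z zx]|triv]] := hs (piece M x).
  by case; apply: free sx _.
have [a ->] := trans _ _ yx; have [w [+ <-]] := Sgen a.
elim: w => [|b w IH] hw; first by rewrite big_nil act1.
rewrite big_cons actM (triv b x (hw _ (mem_head _ _)) erefl).
by apply: IH => c cw; apply: hw; rewrite inE cw orbT.
Qed.

(** The graphs of the generators form an entourage, hence lie in one iterate of [E0]; [defect_iter]
    then bounds displacements by generators through defects in [E0]. *)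
Lemma property_T_spectral_gap (R : realType) (X : choiceType) (d : X -> X -> \bar R)
    (P : groupType) (M : translation_space d P) (S : {fset P}) (E0 : set (X * X))
    (BB : completeNormedModType R[i] -> Prop) : sym_gen_set S ->
  (forall a x y, act M a x = x -> piece M y = piece M x -> act M a y = y) ->
  (forall x y, piece M y = piece M x -> exists a, y = act M a x) ->
  sym_gen_entourage d E0 -> property_T_wrt S BB -> geometric_T d E0 BB.
Proof.
move=> genS free trans [entE0 _ genE0] TS B LB rep hrep.
have [kappa [ki kc kf]] := moving_map genS free trans.
have [c c0 hc] := TS B LB _ (translate_iso M hrep).
have [|n En] := genE0 [set xy | exists2 s, s \in S & xy.2 = act M s xy.1].
  by apply/(entourageP M); exists S => x y [s sS /= ->]; exists s.
rewrite (translate_fixed M hrep) in hc.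
pose W := rep_fixed d rep.
have [_ [K K0 hK']] := defect_iter hrep n ki kc kf entE0.
have hK e v :
    (forall V, partial_translation d V -> supp V `<=` E0 ->
      qnorm W (rep V v - rep (range_proj V) v) < e) ->
    forall s, s \in S -> rnorm (translate M rep s v - v) <= K * e.
  move=> small s sS.
  have := hK' e v small setT (act M s) (covered_act M setT s) (@inj_act _ _ _ _ M setT s).
  rewrite /defect (rep_pmat1 hrep); apply => x _; apply: En => /=.
  by exists s.
have K1 : 0 < K + 1 by rewrite ltr_wpDl.
(* If all defects in [E0] were smaller than this, generators would displace [v] by at most
   [K * c / (K + 1) <= c], against property (T). *)
exists (c / (K + 1)); first by rewrite divr_gt0.
move=> v v1; apply: contrapT => hV; apply: (hc v v1).
have small V : partial_translation d V -> supp V `<=` E0 ->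
    qnorm W (rep V v - rep (range_proj V) v) < c / (K + 1).
  by move=> ptV VE; rewrite ltNge; apply/negP => h; apply: hV; exists V.
(* For an empty generating set the supremum is 0 by convention. *)
set D := [set _ | _ in _]; have [->|/set0P D0] := eqVneq D set0.
  by rewrite sup0 ltW.
apply: ge_sup => // _ [g gS <-].
apply: (le_trans (qnorm_le _ (rep_fixed0 M hrep))); rewrite subr0.
apply: (le_trans (hK _ _ small g gS)).
by rewrite mulrCA ler_piMr ?(ltW c0)// ler_pdivrMr// mul1r lerDl.
Qed.

(** * Unions of finite groups *)

Fixpoint words (T : Type) (L : seq T) (k : nat) : seq (seq T) :=
  if k is k'.+1 then [::] :: [seq x :: w | x <- L, w <- words L k'] else [:: [::]].

Lemma mem_words (T : eqType) (L : seq T) k w : (forall x, x \in w -> x \in L) ->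
  (size w <= k)%N -> w \in words L k.
Proof.
elim: k w => [|k IH] [|x w] //= hw wk; rewrite inE; apply/allpairsP; exists (x, w); split => //=.
  by apply: hw; rewrite mem_head.
by apply: IH => // y yw; apply: hw; rewrite inE yw orbT.
Qed.

Lemma words_sub (T : eqType) (L : seq T) k w : w \in words L k -> forall x, x \in w -> x \in L.
Proof.
elim: k w => [|k IH] w /=; first by rewrite inE => /eqP ->.
rewrite inE => /orP[/eqP -> //|/allpairsP[[x u] /= [xL uk ->]] y].
by rewrite inE => /orP[/eqP ->|]; [|exact: IH uk y].
Qed.

Section GroupUnion.
Variables (R : realType) (Q : nat -> groupType) (P : groupType).
Hypothesis Q_fin : forall n, finite_set [set: Q n].
Variable q : forall n, P -> Q n.
Hypothesis qM : forall n a b, q n (a * b)%g = (q n a * q n b)%g.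
Variable dn : forall n, Q n -> Q n -> nat.
Hypothesis dn_act : forall a, exists k, forall n x, (dn x (x * q n a)%g <= k)%N.
Hypothesis dn_cover : forall k, exists F : seq P, forall n (x y : Q n), (dn x y <= k)%N ->
  exists2 a, a \in F & y = (x * q n a)%g.
Local Notation X := (sep_union (fun n => Q n : choiceType)).
Local Notation d := (@sep_dist R (fun n => Q n : choiceType) dn).

(** Word metrics are left invariant, so multiplication on the right displaces every point of a piece
    by a distance controlled by [a] alone. *)
Definition union_act (a : P) (x : X) : X :=
  Tagged (fun n => Q n : choiceType) (tagged x * q (tag x) a)%g.

Let q1 n : q n 1%g = 1%g.
Proof. by apply: (@mulgI _ (q n 1%g)); rewrite -qM !mulg1. Qed.

Let union_act1 x : union_act 1%g x = x.
Proof. by case: x => n x; rewrite /union_act/= q1 mulg1. Qed.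

Let union_actM a b x : union_act (a * b)%g x = union_act b (union_act a x).
Proof. by case: x => n x; rewrite /union_act/= qM mulgA. Qed.

Definition union_enum n : seq X :=
  [seq Tagged (fun n => Q n : choiceType) x | x <- fset_set [set: Q n]].

Let union_enum_uniq n : uniq (union_enum n).
Proof.
rewrite map_inj_uniq ?fset_uniq// => x y /eqP.
by rewrite eq_Tagged => /eqP.
Qed.

Let mem_union_enum n (x : X) : (x \in union_enum n) = (tag x == n).
Proof.
apply/mapP/eqP => [[y _ ->] //|]; case: x => m x /= xm; case: n / xm.
exists x; last by [].
by rewrite in_fset_set ?inE//; exact: Q_fin.
Qed.

Let union_enum_gt0 n : (0 < size (union_enum n))%N.
Proof.
have : Tagged (fun n => Q n : choiceType) (1%g : Q n) \in union_enum n by rewrite mem_union_enum.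
by case: union_enum.
Qed.

Let union_entourageP (E : set (X * X)) : is_entourage d E <->
  exists F : seq P, forall x y, E (x, y) -> exists2 a, a \in F & y = union_act a x.
Proof.
split=> [[r hr]|[F hF]].
  have [F hF] := dn_cover (Num.trunc r); exists F => -[n x] [m y] /hr.
  rewrite /sep_dist/=; have [nm|_] := eqVneq n m; last by rewrite leNgt ltry.
  case: m / nm y => y; rewrite tagged_asE lee_fin => dr.
  have [|a aF ->] := hF n x y; last by exists a.
  rewrite truncn_ge_nat//; exact: le_trans dr.
have [k hk] : exists k, forall a, a \in F -> forall n x, (@dn n x (x * q n a)%g <= k)%N.
  elim: F {hF} => [|a F [k hk]]; first by exists 0%N.
  have [l hl] := dn_act a; exists (maxn k l) => b; rewrite inE => /orP[/eqP -> n x|bF n x].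
    by rewrite leq_max hl orbT.
  by rewrite leq_max hk.
exists k%:R => x y /hF[a aF ->]; rewrite /sep_dist/= eqxx lee_fin ler_nat.
by rewrite /union_act tagged_asE; exact: hk.
Qed.

Definition union_translation_space : translation_space d P :=
  TranslationSpace union_act1 union_actM union_enum_uniq mem_union_enum
    union_enum_gt0 (fun a x => erefl (tag x)) union_entourageP.

Lemma union_act_eq a (x : X) : union_act a x = x <-> q (tag x) a = 1%g.
Proof.
case: x => n x; split=> /=.
  move=> /eqP; rewrite eq_Tagged => /eqP /= h.
  by apply: (@mulgI _ x); rewrite mulg1.
by move=> qa; rewrite /union_act/= qa mulg1.
Qed.

End GroupUnion.

Lemma proj_eq1 (G : groupType) (N : normal_subgroup G) a :
  Defs.proj N a = 1%g <-> nsub N a.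
Proof.
split=> [h|Na]; last by apply/esym/Defs.projP; rewrite invg1 mul1g.
have /Defs.projP : Defs.proj N 1%g = Defs.proj N a by rewrite h.
by rewrite invg1 mul1g.
Qed.

Section LimitGroupFacts.
Variables (Gamma : nat -> marked_group) (omega : set_system nat) (fomega : free_ultrafilter omega).
Variable N : nat.
Hypothesis gensN : forall n, (#|` gens (Gamma n)| <= N)%N.
Local Notation G := (limit_group Gamma fomega).

(** The [i]-th generators of all the groups at once; the default 1 pads the smaller generating sets,
    so that the same [N] letters serve every [n]. *)
Definition letter_seq i : prod_group Gamma := fun n => nth 1%g (gens (Gamma n)) i.

Lemma letter_bounded i : bounded_length (letter_seq i).
Proof.
apply/asboolP; exists 1%N => n; rewrite /letter_seq.
have [iN|iN] := ltnP i (size (gens (Gamma n))); last by rewrite nth_default// wlen1.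
apply: (@wlen_le _ [:: nth 1%g (gens (Gamma n)) i]); split; last by rewrite big_seq1.
by move=> s; rewrite inE => /eqP ->; exact: mem_nth.
Qed.

Definition letter i : bprod Gamma := exist _ (letter_seq i) (letter_bounded i).

Definition word_prod (w : seq nat) : bprod Gamma := (\prod_(i <- w) letter i)%g.

Lemma val_word_prod w n : val (word_prod w) n = (\prod_(i <- w) letter_seq i n)%g.
Proof.
rewrite /word_prod; elim: w => [|i w IH]; first by rewrite !big_nil.
by rewrite !big_cons -IH.
Qed.

Lemma short_words n (g : Gamma n) k : (wlen (gens (Gamma n)) g <= k)%N ->
  exists2 w, w \in words (iota 0 N) k & val (word_prod w) n = g.
Proof.
have [s [sS <-] <-] := wlen_word g => sk.
exists [seq index x (gens (Gamma n)) | x <- s].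
  apply: mem_words; last by rewrite size_map.
  move=> _ /mapP[x /sS xS ->]; rewrite mem_iota add0n/= (leq_trans _ (gensN n))//.
  by rewrite index_mem.
rewrite val_word_prod big_map; apply: eq_big_seq => x /sS xS.
by rewrite /letter_seq nth_index.
Qed.

Lemma bprod_cover k : exists F : seq (bprod Gamma), forall n (x y : Gamma n),
  (wdist (gens (Gamma n)) x y <= k)%N -> exists2 a, a \in F & y = (x * val a n)%g.
Proof.
exists [seq word_prod w | w <- words (iota 0 N) k] => n x y /short_words[w wk wE].
by exists (word_prod w); [exact: map_f|rewrite wE mulgA mulgV mul1g].
Qed.

Lemma bprod_displacement (a : bprod Gamma) : exists k, forall n (x : Gamma n),
  (wdist (gens (Gamma n)) x (x * val a n)%g <= k)%N.
Proof.
have /asboolP[k hk] := valP a; exists k => n x.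
by rewrite /wdist mulgA mulVg mul1g; exact: hk.
Qed.

Let uomega : UltraFilter omega := fomega.1.
Let pF : ProperFilter omega. Proof. exact: (@ultra_proper _ _ uomega). Qed.
#[local] Existing Instance pF.

(** A sequence of bounded length is, term by term, given by one of finitely many words in the [N]
    letters. The ultrafilter selects a single word that is right for most [n], and this word
    represents its class. *)
Lemma limit_group_fg : finitely_generated G.
Proof.
pose pr : bprod Gamma -> G := Defs.proj (null_subgroup Gamma fomega).
have prM a b : pr (a * b)%g = (pr a * pr b)%g by symmetry; exact: qmulE.
have prV a : pr a^-1%g = (pr a)^-1%g by symmetry; exact: qinvE.
pose L := [seq pr (letter i) | i <- iota 0 N].
pose S : {fset G} := [fset x in L ++ [seq x^-1%g | x <- L]]%fset.
have SE x : (x \in S) = (x \in L) || (x \in [seq x^-1%g | x <- L]).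
  by rewrite in_fset/= mem_cat.
exists S; split=> [s|g].
  rewrite !SE => /orP[sL|/mapP[x xL ->]]; apply/orP; first by right; exact: map_f.
  by left; rewrite invgK.
rewrite -(Defs.projK g); set a := repr g.
have /asboolP[k hk] := valP a.
have /choice[w hw] : forall n, exists w, w \in words (iota 0 N) k /\ val (word_prod w) n = val a n.
  by move=> n; have [w wk wE] := short_words (hk n); exists w.
have [w0 w0N h0] := @ultra_finite _ _ omega w (words (iota 0 N) k) uomega (fun n => (hw n).1).
have -> : Defs.proj (null_subgroup Gamma fomega) a = pr (word_prod w0).
  apply/Defs.projP; apply/(null_lengthP fomega); apply: (@filterS _ omega _ _ _ _ h0) => n /= wn.
  suff : ((val a n)^-1 * val (word_prod w0) n)%g = 1%g by [].
  by rewrite -wn (hw n).2 mulVg.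
exists [seq pr (letter i) | i <- w0]; split.
  move=> _ /mapP[i /(words_sub w0N) iN ->]; rewrite SE; apply/orP; left.
  by apply: (map_f (fun i => pr (letter i))).
rewrite big_map /word_prod; elim: w0 {w0N h0} => [|i w0 IH]; first by rewrite !big_nil.
by rewrite !big_cons prM IH.
Qed.

End LimitGroupFacts.

(** * Filtrations and box spaces *)

Section Filtrations.
Variable G : groupType.

Definition full_subgroup : normal_subgroup G :=
  @NormalSubgroup G setT I (fun _ _ _ _ => I) (fun _ _ => I) (fun _ _ _ => I).

Definition cap_subgroup (N N' : normal_subgroup G) : normal_subgroup G :=
  @NormalSubgroup G (nsub N `&` nsub N') (conj (nsub1 N) (nsub1 N'))
    (fun g h gN hN => conj (nsubM gN.1 hN.1) (nsubM gN.2 hN.2))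
    (fun g gN => conj (nsubV gN.1) (nsubV gN.2))
    (fun g h gN => conj (nsubJ h gN.1) (nsubJ h gN.2)).

Lemma full_finite_index : finite_index full_subgroup.
Proof.
apply: (@sub_finite_set _ _ [set Defs.proj full_subgroup 1%g]) => // x _ /=.
by rewrite -(Defs.projK x); apply/Defs.projP.
Qed.

Lemma cap_finite_index N N' : finite_index N -> finite_index N' ->
  finite_index (cap_subgroup N N').
Proof.
move=> fN fN'; pose f (x : quot (cap_subgroup N N')) :=
  (Defs.proj N (repr x), Defs.proj N' (repr x)).
have finj : injective f.
  move=> x y [/Defs.projP h /Defs.projP h'].
  by rewrite -(Defs.projK x) -(Defs.projK y); apply/Defs.projP.
apply: (@sub_finite_set _ _ (f @^-1` setT)) => //.
apply: finite_preimage; first by move=> x y _ _; exact: finj.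
by rewrite -setXTT; exact: finite_setX.
Qed.

(** Successive intersections of subgroups separating [e 0], [e 1], and so on from 1; surjectivity of
    [e] makes the total intersection trivial. *)
Lemma residually_finite_filtration (e : nat -> G) : (forall g, exists n, e n = g) ->
  residually_finite G -> exists F : filtration G, True.
Proof.
move=> e_surj rf.
have /choice[N hN] : forall g, exists N : normal_subgroup G,
    finite_index N /\ (g <> 1%g -> ~ nsub N g).
  move=> g; have [->|/eqP g1] := eqVneq g 1%g.
    by exists full_subgroup; split => //; exact: full_finite_index.
  by have [N fN Ng] := rf g g1; exists N.
pose F := fix F n := if n is n'.+1 then cap_subgroup (F n') (N (e n)) else N (e 0%N).
have Fn n : nsub (F n) `<=` nsub (N (e n)) by case: n => [//|n] g [].
unshelve eexists (@Filtration G F _ _ _) => //.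
- by move=> n g [].
- elim=> [|n IH]; first exact: (hN _).1.
  by apply: cap_finite_index => //; exact: (hN _).1.
apply/seteqP; split => g /=; last by move=> -> n _; exact: nsub1.
move=> Fg; apply: contrapT => g1; have [n en] := e_surj g.
by apply: (hN g).2 => //; have := Fn n g (Fg n I); rewrite en.
Qed.

End Filtrations.

Lemma marked_group_enum (G : marked_group) : exists e : nat -> G, forall g, exists n, e n = g.
Proof.
pose f (w : seq nat) : G := (\prod_(i <- w) nth 1%g (gens G) i)%g.
exists (fun n => if choice.unpickle n is Some w then f w else 1%g) => g.
have [s [sS <-] _] := wlen_word g.
exists (choice.pickle [seq index x (gens G) | x <- s]); rewrite choice.pickleK /f big_map.
by apply: eq_big_seq => x /sS xS; rewrite nth_index.
Qed.

Section Box.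
Variables (R : realType) (G : marked_group) (F : filtration G).
Local Notation Q := (fun n => quot (F n) : groupType).

Lemma box_act (a : G) : exists k, forall n (x : Q n),
  (@quot_dist G (F n) (wdist (gens G)) x (x * Defs.proj (F n) a)%g <= k)%N.
Proof.
exists (wlen (gens G) a) => n x; apply: natmin_le.
exists (repr x), (repr x * a)%g; split; first exact: Defs.projK.
  by rewrite -{2}(Defs.projK x); symmetry; exact: qmulE.
by rewrite /wdist mulgA mulVg mul1g.
Qed.

(** The minimum in [quot_dist] is attained, so two close cosets have representatives joined by a
    short word of [G]; there are finitely many such words, whatever [n]. *)
Lemma box_cover k : exists B : seq G, forall n (x y : Q n),
  (@quot_dist G (F n) (wdist (gens G)) x y <= k)%N ->
  exists2 a, a \in B & y = (x * Defs.proj (F n) a)%g.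
Proof.
exists [seq (\prod_(s <- w) s)%g | w <- words (gens G) k] => n x y.
have [|g [h [gx hy E]]] := @natminP [set k | exists g h,
    [/\ Defs.proj (F n) g = x, Defs.proj (F n) h = y & wdist (gens G) g h = k]].
  by exists (wdist (gens G) (repr x) (repr y)), (repr x), (repr y); split => //; exact: Defs.projK.
move=> dk; rewrite /quot_dist -E in dk; rewrite -gx -hy.
have [w [wS wE] wk] := wlen_word (g^-1 * h)%g.
exists (\prod_(s <- w) s)%g.
  by apply: map_f; apply: mem_words => //; rewrite wk.
rewrite wE; transitivity (Defs.proj (F n) (g * (g^-1 * h))%g).
  by rewrite mulgA mulgV mul1g.
by symmetry; exact: qmulE.
Qed.

Definition box_translation_space : translation_space (@box_dist R G F) G :=
  @union_translation_space R Q G (fil_finite F) (fun n => Defs.proj (F n))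
    (fun n a b => esym (qmulE (F n) a b)) _ box_act box_cover.

End Box.

(** * Property (T) of limit groups and residually finite groups *)

(** The group [bprod Gamma] acts on the union by right multiplication and on [B] through its
    quotient, the limit group. *)
Lemma limit_group_T (R : realType) (p : R) (Gamma : nat -> marked_group)
    (E0 : set (union_space Gamma * union_space Gamma))
    (omega : set_system nat) (fomega : free_ultrafilter omega) : 1 <= p ->
  (forall n, finite_set [set: Gamma n]) ->
  (exists N, forall n, (#|` gens (Gamma n)| <= N)%N) ->
  is_entourage (@union_dist R Gamma) E0 ->
  geometric_T (@union_dist R Gamma) E0 (is_Lp_space p) ->
  property_T (limit_group Gamma fomega) (is_Lp_space p).
Proof.
move=> p1 fin [N gensN] entE0 gT; split; first exact: (limit_group_fg fomega gensN).
move=> S genS B LB rho hrho; pose pr : bprod Gamma -> limit_group Gamma fomega :=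
  Defs.proj (null_subgroup Gamma fomega).
have prM a b : pr (a * b)%g = (pr a * pr b)%g by symmetry; exact: qmulE.
pose M : translation_space (@union_dist R Gamma) (bprod Gamma) :=
  @union_translation_space R (fun n => Gamma n : groupType) (bprod Gamma) fin
    (fun n a => val a n) (fun n a b => erefl) _ (@bprod_displacement Gamma) (bprod_cover gensN).
have sM a b v : rho (pr (a * b)%g) v = rho (pr a) (rho (pr b) v).
  by rewrite prM (isoM hrho).
have sfix a : most omega (piece M) (fun x => act M a x = x -> forall v, rho (pr a) v = v).
  have uomega : UltraFilter omega := fomega.1.
  have pF : ProperFilter omega := @ultra_proper _ _ uomega.
  (* Either [a] is trivial on most pieces, and then its class is 1 in the limit group, or it is
     nontrivial on most pieces, and then it has no fixed point there. *)
  have [oa|oa] := in_ultra_setVsetC [set n | val a n = 1%g] uomega.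
    have -> : pr a = 1%g by apply/proj_eq1/null_lengthP.
    by apply: (@filterE _ omega) => n x _ _ v; exact: iso1.
  apply: (@filterS _ omega _ _ _ _ oa) => n an x xn.
  by move=> /union_act_eq qa; case: an; rewrite -xn.
have [F [c [c0 hF]]] := spectral_gap_displacement p1 fomega.1 entE0 gT LB
  (fun a => iso_lin hrho (pr a)) (fun a => iso_rnorm hrho (pr a)) sM sfix.
apply: (displacement_T hrho (q := pr) _ genS c0 hF).
by move=> g; exists (repr g); exact: Defs.projK.
Qed.

Lemma free_ultrafilter_ex : exists omega : set_system nat,
  UltraFilter omega /\ forall A, (\forall n \near \oo, A n) -> omega A.
Proof.
have [omega [uomega h]] := @ultraFilterLemma nat (\oo) _.
by exists omega.
Qed.

Lemma box_T_group (R : realType) (p : R) (G : marked_group) (F : filtration G)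
    (E0 : set (box_space F * box_space F)) : 1 <= p ->
  is_entourage (@box_dist R G F) E0 ->
  geometric_T (@box_dist R G F) E0 (is_Lp_space p) ->
  property_T G (is_Lp_space p).
Proof.
move=> p1 entE0 gT; split; first by exists (gens G); exact: gensP.
move=> S genS B LB rho hrho.
have [omega [uomega ooomega]] := free_ultrafilter_ex.
have pF : ProperFilter omega := @ultra_proper _ _ uomega.
have [|F' [c [c0 hF]]] := @spectral_gap_displacement R p omega _ _ _ (box_translation_space R F)
    E0 B rho p1 uomega entE0 gT LB (iso_lin hrho) (iso_rnorm hrho) (isoM hrho).
  move=> a; have [->|/eqP a1] := eqVneq a 1%g.
    by apply: (@filterE _ omega) => n x _ _ v; exact: iso1.
  (* By trivial intersection [a] leaves some subgroup, and by nesting all later ones; so it fixes no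
     point of the later pieces, which are most pieces as the ultrafilter is free. *)
  have [n0 an0] : exists n0, ~ nsub (F n0) a.
    apply: contrapT => h; apply: a1.
    have : (\bigcap_n nsub (F n)) a by move=> n _; apply: contrapT => na; apply: h; exists n.
    by rewrite fil_trivial.
  have an n : (n0 <= n)%N -> ~ nsub (F n) a.
    move=> /subnK <-; elim: (n - n0)%N => [//|k IH] h; apply: IH.
    exact: fil_nested h.
  apply: ooomega; exists n0 => // n /= n0n x xn.
  by move=> /union_act_eq/proj_eq1; rewrite xn => /(an n n0n).
by apply: (displacement_T hrho (q := id) _ genS c0 hF) => g; exists g.
Qed.

(** Each piece is a quotient group acted on by right multiplication, so the action is transitive on
    it and an element with one fixed point acts trivially on the piece. *)
Lemma group_T_box (R : realType) (BB : completeNormedModType R[i] -> Prop)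
    (G : marked_group) (F : filtration G) (E0 : set (box_space F * box_space F)) :
  sym_gen_entourage (@box_dist R G F) E0 -> property_T G BB ->
  geometric_T (@box_dist R G F) E0 BB.
Proof.
move=> genE0 [_ /(_ _ (gensP G)) TG].
apply: (property_T_spectral_gap (M := box_translation_space R F) (gensP G) _ _ genE0 TG).
  move=> a x y /union_act_eq ax yx; apply/union_act_eq.
  by move: yx => /= ->.
move=> [n x] [m y] /= mn; case: n / mn x => x.
exists (repr (x^-1 * y)%g); rewrite /union_act/= Defs.projK.
by rewrite mulgA mulgV mul1g.
Qed.

Theorem theorem1p5 (R : realType) (p : R) (p_gt1 : 1 < p) :
  (forall (Gamma : nat -> marked_group)
      (Gamma_finite : forall n, finite_set [set: Gamma n])
      (gens_bounded : exists N, forall n, (#|` gens (Gamma n)| <= N)%N)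
      (E0 : set (union_space Gamma * union_space Gamma))
      (E0_gen : sym_gen_entourage (@union_dist R Gamma) E0)
      (omega : set_system nat) (fomega : free_ultrafilter omega),
    geometric_T (@union_dist R Gamma) E0 (is_Lp_space p) ->
    property_T (limit_group Gamma fomega) (is_Lp_space p))
  /\
  (forall (Gamma : marked_group) (Gamma_rf : residually_finite Gamma)
      (E0 : forall F : filtration Gamma, set (box_space F * box_space F))
      (E0_gen : forall F, sym_gen_entourage (@box_dist R Gamma F) (E0 F)),
    (property_T Gamma (is_Lp_space p) <->
       forall F : filtration Gamma,
         geometric_T (@box_dist R Gamma F) (E0 F) (is_Lp_space p)) /\
    (property_T Gamma (is_Lp_space p) <->
       exists F : filtration Gamma,
         geometric_T (@box_dist R Gamma F) (E0 F) (is_Lp_space p))).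
Proof.
have p1 : 1 <= p := ltW p_gt1; split.
  move=> Gamma fin gN E0 [entE0 _ _] omega fomega.
  exact: limit_group_T.
move=> Gamma rf E0 genE0.
have aTb : property_T Gamma (is_Lp_space p) -> forall F : filtration Gamma,
    geometric_T (@box_dist R Gamma F) (E0 F) (is_Lp_space p).
  by move=> TG F; exact: group_T_box.
have cTa (F : filtration Gamma) : geometric_T (@box_dist R Gamma F) (E0 F) (is_Lp_space p) ->
    property_T Gamma (is_Lp_space p).
  by move=> gT; have [entE0 _ _] := genE0 F; exact: box_T_group gT.
(* Some filtration has to exist, both to specialize the statement about all filtrations and to
   witness the existential one. *)
have [e e_surj] := marked_group_enum Gamma.
have [F _] := residually_finite_filtration e_surj rf.
split; split=> [/aTb // h|h].
- exact: (cTa F).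
- by exists F.
by have [F' gT] := h; exact: cTa gT.
Qed.
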